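(* Let $\mathcal{S}=-\mathcal{B}\mathcal{A}^{-1}\mathcal{B}^{\mathrm T}$ with $\mathcal{A}=I\otimes A_0+\sum_{m=1}^{M}G_m\otimes A_m$ and $\mathcal{B}=I\otimes B$, and let $\widetilde{\mathcal{S}}_p=I\otimes D_p$, with all matrices and constants as defined in the context. Then $$\frac{\theta^2\gamma^2}{\overline{\nu}_0+\sqrt3\,\sigma_\nu\,\chi}\;\le\;\frac{\boldsymbol q^{\mathrm T}\,\mathcal{B}\mathcal{A}^{-1}\mathcal{B}^{\mathrm T}\,\boldsymbol q}{\boldsymbol q^{\mathrm T}(I\otimes D_p)\,\boldsymbol q}\;\le\;\frac{\Theta^2}{\underline{\nu}_0-\sqrt3\,\sigma_\nu\,\chi}\qquad\text{for all }\boldsymbol q\in\mathbb{R}^{QN_p}\setminus\{\boldsymbol 0,\boldsymbol 1\},$$ where writing $\setminus\{\boldsymbol 0,\boldsymbol 1\}$ means that all constant vectors $\boldsymbol q$ are excluded.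
   Context: Setting. $D\subset\mathbb{R}^2$ is a bounded domain with sufficiently regular boundary, equipped with a regular triangulation of mesh size $h$. The problem is a stochastic Galerkin finite element discretization of enclosed Stokes flow with random viscosity $\nu_0(x)+\sigma_\nu\sum_{m=1}^{M}\sqrt{\lambda_m}\,\nu_m(x)\,y_m$, a truncated Karhunen-Loève expansion with independent random variables $y_m$ uniformly distributed on $[-\sqrt3,\sqrt3]$. Viscosity data. $\nu_0\in L^\infty(D)$ with $\underline{\nu}_0:=\operatorname{ess\,inf}_{D}\nu_0>0$ and $\overline{\nu}_0:=\operatorname{ess\,sup}_{D}\nu_0<\infty$; $\sigma_\nu>0$ is a real number; $(\lambda_m,\nu_m)_{m\in\mathbb{N}}$ are the eigenpairs of the covariance integral operator, with $\sqrt{\lambda_m}\,\nu_m\in L^\infty(D)$. Put $\chi_m:=\|\sqrt{\lambda_m}\,\nu_m\|_{L^\infty(D)}$ and assume $\chi:=\sum_{m=1}^\infty\chi_m<\infty$. Standing assumption: $\underline{\nu}_0>\sqrt3\,\sigma_\nu\,\chi$. Finite element matrices (Taylor-Hood $P_2/P_1$). Let $\{\phi_i\}_{i=1}^{N_u}$ be the basis of the space $\boldsymbol V_0^h$ of vector-valued continuous piecewise quadratic functions on the triangulation vanishing on $\partial D$, and $\{\varphi_i\}_{i=1}^{N_p}$ the nodal basis of continuous piecewise linear functions. Let $W_0^h$ be the space of continuous piecewise linear functions $q$ with $\int_D q\,dx=0$. Define $(A)_{ij}=\int_D\nabla\phi_i\cdot\nabla\phi_j\,dx$, $(A_0)_{ij}=\int_D\nu_0\,\nabla\phi_i\cdot\nabla\phi_j\,dx$,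 $(A_m)_{ij}=\int_D\sigma_\nu\sqrt{\lambda_m}\,\nu_m\,\nabla\phi_i\cdot\nabla\phi_j\,dx$ ($m=1,\dots,M$), $(B)_{ij}=-\int_D\varphi_i\,\nabla\cdot\phi_j\,dx$ ($B\in\mathbb{R}^{N_p\times N_u}$), $(M_p)_{ij}=\int_D\varphi_i\varphi_j\,dx$ (the pressure mass matrix), and $D_p=\operatorname{diag}(M_p)$, the diagonal part of $M_p$. Constants. $\gamma>0$ is the inf-sup constant of the mixed finite element approximation: $\gamma=\inf_{0\ne q\in W_0^h}\sup_{0\ne v\in\boldsymbol V_0^h}\frac{|\int_D q\,\nabla\cdot v\,dx|}{\|\nabla v\|_{L^2(D)}\|q\|_{L^2(D)}}$ (the elements are inf-sup stable). $\theta,\Theta>0$ are constants with $\theta^2\le\frac{\boldsymbol q^{\mathrm T}M_p\boldsymbol q}{\boldsymbol q^{\mathrm T}D_p\boldsymbol q}\le\Theta^2$ for all $\boldsymbol q\in\mathbb{R}^{N_p}\setminus\{\boldsymbol 0\}$ (for these elements $\theta^2=\tfrac12$, $\Theta^2=2$). Stochastic Galerkin matrices. Let $\rho$ be the uniform probability measure on $[-\sqrt3,\sqrt3]^M$ and let $\{\psi_i\}_{i=1}^{Q}$, $Q=\binom{M+k}{k}$, be the $\rho$-orthonormal Legendre basis of the space of $M$-variate polynomials of total degree at most $k$. Then $I$ is the $Q\times Q$ identity and $(G_m)_{ij}=\int y_m\,\psi_i(y)\psi_j(y)\,\rho(dy)$ for $m=1,\dots,M$. $\otimes$ denotes the Kronecker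 product.
   Formalization: The lower bound is stated only for q whose Q blocks all represent zero-mean pressures in W_0^h: as printed it fails, e.g. for q=1+εv with Q=1 or q=e_1⊗1 with Q>1, since B^T 1=0. The upper bound holds for all non-constant q. *)

(* Defs.v *)
From HB Require Import structures.
From mathcomp Require Import all_boot all_order all_algebra.
From mathcomp Require Import all_classical all_reals all_analysis.
From mathcomp Require Import ess_sup_inf mxtens.
Set Implicit Arguments.
Unset Strict Implicit.
Unset Printing Implicit Defensive.
Import Order.TTheory GRing.Theory Num.Theory.
Import numFieldNormedType.Exports.
Local Open Scope classical_set_scope.
Local Open Scope ring_scope.

Definition area (R : realType) :
    {measure set (measurableTypeR R * measurableTypeR R) -> \bar R} :=
  (@lebesgue_measure R \x @lebesgue_measure R)%E.
Arguments area {R}.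

(* f is set to -oo (resp. +oo) outside D, which leaves its essential supremum
   (resp. infimum) over D unchanged. *)
Definition ess_sup_on (R : realType) (D : set (R * R)) (f : R * R -> R) :=
  ess_sup area (patch (cst -oo%E) D (EFin \o f)).

Definition ess_inf_on (R : realType) (D : set (R * R)) (f : R * R -> R) :=
  ess_inf area (patch (cst +oo%E) D (EFin \o f)).

Definition Linfty_norm (R : realType) (D : set (R * R)) (f : R * R -> R) :=
  ('N[area]_(+oo) [EFin \o (f \_ D)])%E.

Section domain_and_mesh.
Variable R : realType.
Implicit Types (D : set (R * R)) (Np : nat).

(* The only boundary regularity required is that D is the interior of its
   closure, which holds for every Lipschitz (even continuous) boundary. *)
Definition bounded_domain D :=
  [/\ open D, connected D, D !=set0, bounded_set D & (closure D)° = D].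

Definition hull Np (p : 'I_Np -> R * R) (K : {set 'I_Np}) : set (R * R) :=
  [set x | exists w : 'I_Np -> R,
    [/\ forall i, 0 <= w i, \sum_(i in K) w i = 1
      & x = \sum_(i in K) w i *: p i]].

(* A triangle is given by the set of (the indices of) its three vertices; the
   fourth clause says that two triangles meet in a common edge, a common vertex
   or not at all, as the hull of the empty set is empty. *)
Definition triangulation D Np (p : 'I_Np -> R * R) (T : {set {set 'I_Np}}) :=
  [/\ injective p,
      forall i, exists2 K, K \in T & i \in K,
      forall K, K \in T -> #|K| = 3%N /\ (hull p K)° !=set0,
      forall K L, K \in T -> L \in T ->
        hull p K `&` hull p L = hull p (K :&: L)
    & closure D = [set x | exists2 K, K \in T & hull p K x]].

Definition polynomial_on (r : nat) (A : set (R * R)) (f : R * R -> R) :=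
  exists c : nat -> nat -> R, forall x, A x ->
    f x = \sum_(i < r.+1) \sum_(j < r.+1 | (i + j <= r)%N)
            c i j * x.1 ^+ i * x.2 ^+ j.

Variables (D : set (R * R)) (Np : nat) (p : 'I_Np -> R * R).
Variable T : {set {set 'I_Np}}.

(* Finite element functions are only meaningful on the closure of D. *)
Definition continuous_Pk (r : nat) (f : R * R -> R) :=
  {within closure D, continuous f} /\
  forall K, K \in T -> polynomial_on r (hull p K) f.

Definition V0h (v : R * R -> R * R) :=
  [/\ continuous_Pk 2 (fun x => (v x).1),
      continuous_Pk 2 (fun x => (v x).2)
    & forall x, closure D x -> ~ D x -> v x = 0].

Definition W0h (q : R * R -> R) :=
  continuous_Pk 1 q /\ \int[area]_(x in D) q x = 0.

Definition V0h_basis Nu (phi : 'I_Nu -> R * R -> R * R) :=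
  [/\ forall i, V0h (phi i),
      forall c : 'I_Nu -> R,
        (forall x, closure D x -> \sum_i c i *: phi i x = 0) ->
        forall i, c i = 0
    & forall v, V0h v -> exists c : 'I_Nu -> R,
        forall x, closure D x -> v x = \sum_i c i *: phi i x].

Definition P1_nodal_basis (vphi : 'I_Np -> R * R -> R) :=
  (forall i, continuous_Pk 1 (vphi i)) /\
  (forall i j, vphi i (p j) = (i == j)%:R).

End domain_and_mesh.

Section forms.
Variables (R : realType) (D : set (R * R)).
Implicit Types (v w : R * R -> R * R) (q : R * R -> R).

(* Classical derivatives: for finite element functions they exist off the
   edges of the mesh, hence almost everywhere. *)
Definition dx1 q x : R := 'D_((1 : R), (0 : R)) q x.
Definition dx2 q x : R := 'D_((0 : R), (1 : R)) q x.

Definition div v x :=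
  dx1 (fun z => (v z).1) x + dx2 (fun z => (v z).2) x.

Definition grad_dot v w x :=
  dx1 (fun z => (v z).1) x * dx1 (fun z => (w z).1) x +
  dx2 (fun z => (v z).1) x * dx2 (fun z => (w z).1) x +
  dx1 (fun z => (v z).2) x * dx1 (fun z => (w z).2) x +
  dx2 (fun z => (v z).2) x * dx2 (fun z => (w z).2) x.

Definition L2_norm q := Num.sqrt (\int[area]_(x in D) (q x) ^+ 2).

Definition L2_norm_grad v := Num.sqrt (\int[area]_(x in D) grad_dot v v x).

Definition inf_sup_constant Np (p : 'I_Np -> R * R) (T : {set {set 'I_Np}}) :
    \bar R :=
  ereal_inf [set s | exists q, [/\ W0h D p T q, exists2 x, D x & q x != 0
    & s = ereal_sup [set t | exists v, [/\ V0h D p T v,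
            exists2 x, D x & v x != 0
          & t = (`|\int[area]_(x in D) (q x * div v x)|
                 / (L2_norm_grad v * L2_norm q))%:E]]]].

Definition stiffness_mx Nu (nu : R * R -> R) (phi : 'I_Nu -> R * R -> R * R) :
    'M[R]_Nu :=
  \matrix_(i, j) \int[area]_(x in D) (nu x * grad_dot (phi i) (phi j) x).

Definition divergence_mx Nu Np (phi : 'I_Nu -> R * R -> R * R)
    (vphi : 'I_Np -> R * R -> R) : 'M[R]_(Np, Nu) :=
  \matrix_(i, j) - \int[area]_(x in D) (vphi i x * div (phi j) x).

Definition mass_mx Np (vphi : 'I_Np -> R * R -> R) : 'M[R]_Np :=
  \matrix_(i, j) \int[area]_(x in D) (vphi i x * vphi j x).

End forms.

Definition diag_part (R : realType) n (A : 'M[R]_n) : 'M[R]_n :=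
  diag_mx (\row_i A i i).

Definition quad_form (R : realType) n (A : 'M[R]_n) (q : 'cV[R]_n) : R :=
  (q^T *m A *m q) 0 0.

Section karhunen_loeve.
Variables (R : realType) (D : set (R * R)).

Definition covariance_function (C : R * R -> R * R -> R) :=
  [/\ measurable_fun (D `*` D) (fun z => C z.1 z.2),
      forall x z, D x -> D z -> C x z = C z x
    & forall n (x : 'I_n -> R * R) (c : 'I_n -> R), (forall i, D (x i)) ->
        0 <= \sum_i \sum_j c i * c j * C (x i) (x j)].

Definition covariance_eigenpair (C : R * R -> R * R -> R)
    (lam : R) (nu : R * R -> R) :=
  [/\ 0 <= lam,
      measurable_fun D nu,
      area.-integrable D (EFin \o (fun x => nu x ^+ 2)),
      ~ (\forall x \ae area, D x -> nu x = 0)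
    & \forall x \ae area, D x ->
        area.-integrable D (EFin \o (fun z => C x z * nu z)) /\
        \int[area]_(z in D) (C x z * nu z) = lam * nu x].

End karhunen_loeve.

Section uniform_law.
Variable R : realType.

Lemma Nsqrt3_lt_sqrt3 : - Num.sqrt 3 < Num.sqrt 3 :> R.
Proof. by rewrite gtrN // sqrtr_gt0. Qed.

Local Notation tpl n := (n.-tuple (measurableTypeR R)).

Definition cons_pair n (z : measurableTypeR R * tpl n) : tpl n.+1 :=
  [tuple of z.1 :: z.2].

Lemma measurable_cons_pair n : measurable_fun setT (@cons_pair n).
Proof. exact: measurable_cons measurable_fst measurable_snd. Qed.

HB.instance Definition _ n :=
  isMeasurableFun.Build _ _ _ _ (@cons_pair n) (@measurable_cons_pair n).

(* The M-fold product of the uniform law on [-sqrt 3, sqrt 3]. *)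
Fixpoint uniform_law (M : nat) : probability (tpl M) R :=
  if M is n.+1 then
    distribution (uniform_prob Nsqrt3_lt_sqrt3 \x uniform_law n)%E
      (@cons_pair n)
  else dirac [tuple].

End uniform_law.

Section legendre.
Variable R : realType.

(* Rodrigues' formula on [-1, 1]. *)
Definition legendre (n : nat) : {poly R} :=
  (2 ^+ n * n`!%:R)^-1 *: (('X^2 - 1) ^+ n)^`(n).

(* Orthonormal for the uniform law on [-sqrt 3, sqrt 3]. *)
Definition legendre_normalized (n : nat) (t : R) : R :=
  Num.sqrt (2 * n + 1)%N%:R * (legendre n).[t / Num.sqrt 3].

Definition legendre_tensor M k (al : M.-tuple 'I_k.+1) (y : M.-tuple R) : R :=
  \prod_(m < M) legendre_normalized (tnth al m) (tnth y m).

(* An ordering of the multi-indices of total degree at most k. *)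
Definition multiindex_ordering M k
    (al : 'I_('C(M + k, k)) -> M.-tuple 'I_k.+1) :=
  injective al /\
  forall t, (exists i, al i = t) <-> (\sum_(m < M) tnth t m <= k)%N.

Definition galerkin_mx M k (al : 'I_('C(M + k, k)) -> M.-tuple 'I_k.+1)
    (m : 'I_M) : 'M[R]_('C(M + k, k)) :=
  \matrix_(i, j) \int[uniform_law R M]_y
    (tnth y m * legendre_tensor (al i) y * legendre_tensor (al j) y).

End legendre.

(* Main.v *)
Require Import Defs.
From mathcomp Require Import all_boot all_order all_algebra.
From mathcomp Require Import all_classical all_reals all_analysis.
From mathcomp Require Import mxtens.
From mathcomp Require Import ess_sup_inf measurable_realfun zify ring lra.
Import Order.TTheory GRing.Theory Num.Theory.
Import numFieldNormedType.Exports.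
Local Open Scope classical_set_scope.
Local Open Scope ring_scope.
Set Implicit Arguments.
Unset Strict Implicit.
Unset Printing Implicit Defensive.

(* The Galerkin matrix calA lies between al and be times the Gram matrix of the
   gradients, where al = nu_min - sqrt 3 sigma chi and be = nu_max + sqrt 3 sigma
   chi: the Legendre basis is orthonormal and |y_m| <= sqrt 3, so |z^T G_m z| <=
   sqrt 3 |z|^2, and the viscosity bounds hold almost everywhere.  For the Schur
   complement form X = q^T B A^-1 B^T q with w = A^-1 B^T q one has X = l(w) =
   w^T A w, where l(v) = q^T B v.
   Upper bound: expand 0 <= |q_h + al div w_h|^2 and use |div w_h| <= |grad w_h|
   in L2; the latter is int d1 u d2 w = int d2 u d1 w, which follows from the
   translation invariance of the integral applied to difference quotients of
   the extensions by zero, so that no trace theory is needed.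
   Lower bound: X >= 2 l(v) - be |grad v_h|^2 for every v, applied to an almost
   optimal inf-sup witness v chosen separately for each stochastic index.
   The mass matrix is finally compared with its diagonal by theta and Theta. *)

(** * Measure and integration in the plane *)

(** All integrals are moved from [D] to [D'], the part of [D] off a single null set [N] that
    contains the mesh edges and the exceptional points of all viscosity bounds. On [D'] the
    derivatives exist, the essential bounds hold pointwise and every integrand is bounded and
    measurable, so the Schur complement can be treated over an abstract finite measure space. The
    extension by zero of a velocity component is globally Lipschitz and vanishes near almost every
    point outside [D]. Its difference quotients are therefore bounded, supported in one box and
    convergent almost everywhere. The same device shows that zero energy forces the zero function,
    hence that [calA] is invertible and [invmx] a true inverse. The pointwise estimate of the
    divergence by the gradient would cost a factor 2; the exchange of derivatives under the integral
    is what gives the constant 1 of the upper bound. For the lower bound the witness of each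
    stochastic block is scaled so that its energy is at most the squared pressure norm of that
    block. The blocks can then be added, and one common factor [g / be] optimises all of them at
    once. *)

Section null_sets.
Context d (T : measurableType d) (R : realType).
Variable mu : {measure set T -> \bar R}.
Implicit Types (D N : set T).
Import HBNNSimple.

(* The library versions of this fact require [f] to be measurable. *)
Lemma integral_setD_null D N (f : T -> \bar R) : measurable N -> mu N = 0 ->
  (\int[mu]_(x in D) f x = \int[mu]_(x in D `\` N) f x)%E.
Proof.
move=> mN N0.
suff ge0_case (g : T -> \bar R) : (forall x, D x -> 0 <= g x)%E ->
    (\int[mu]_(x in D) g x = \int[mu]_(x in D `\` N) g x)%E.
  rewrite integralE [RHS]integralE; congr (_ - _)%E; exact: ge0_case.
move=> g0; apply/eqP; rewrite eq_le; apply/andP; split.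
(* The integral of a nonnegative function, measurable or not, is a supremum over simple functions
   below it. Cutting such an [h] off on [N] keeps its integral and puts it below [g] on [D] without
   [N]. *)
- rewrite ge0_integralE//; apply: ge_ereal_sup => /= _ [h hg <-].
  rewrite -integralT_nnsfun.
  rewrite (@ge0_negligible_integral _ _ _ mu setT N)//; last 2 first.
  - exact/measurable_EFinP.
  - by move=> x _; rewrite lee_fin.
  have mC : measurable (~` N) by exact: measurableC.
  rewrite setTD integral_mkcond.
  have -> : (fun x => (h x)%:E) \_ (~` N) = EFin \o proj_nnsfun h mC.
    by rewrite -mrestrict -restrict_EFin.
  rewrite integralT_nnsfun.
  rewrite [leRHS]ge0_integralE; last by move=> x [Dx _]; exact: g0.
  apply: ereal_sup_ubound => /=; exists (proj_nnsfun h mC) => // x.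
  have := congr1 (@^~ x) (mrestrict h mC) => /= <-.
  have := hg x; rewrite !patchE.
  have [xN|xN] := boolP (x \in ~` N); have [xD|xD] := boolP (x \in D).
  + by rewrite ifT// in_setD xD -in_setC.
  + by rewrite ifF// in_setD (negbTE xD).
  + rewrite ifF ?lee_fin// in_setD xD/=; apply/negbTE; move: xN.
    by rewrite in_setC.
  + by rewrite ifF// in_setD (negbTE xD).
- rewrite ge0_integralE; last by move=> x [Dx _]; exact: g0.
  rewrite [leRHS]ge0_integralE//; apply: ge_ereal_sup => /= _ [h hg <-].
  apply: ereal_sup_ubound => /=; exists h => // x; apply: (le_trans (hg x)).
  rewrite !patchE; case: ifPn; rewrite in_setD; first by case/andP => ->.
  by case: ifPn => //; rewrite inE => /g0.
Qed.

Lemma Rintegral_setD_null D N (f : T -> R) : measurable N -> mu N = 0 ->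
  \int[mu]_(x in D) f x = \int[mu]_(x in D `\` N) f x.
Proof. by move=> mN N0; congr fine; exact: integral_setD_null. Qed.

Lemma integrable_bounded_fun D (f : T -> R) (B : R) : measurable D ->
  (mu D < +oo)%E -> measurable_fun D f -> (forall x, D x -> `|f x| <= B) ->
  mu.-integrable D (EFin \o f).
Proof.
move=> mD Doo mf fB.
apply: measurable_bounded_integrable => //.
by exists B; split; [exact: num_real|move=> M BM x Dx; apply: (le_trans (fB _ Dx)); exact: ltW].
Qed.

End null_sets.

Section plane_measure.
Variable R : realType.
Local Notation plane := (measurableTypeR R * measurableTypeR R)%type.

(** The sigma-algebra of the plane is the product one, generated by rectangles; an open set belongs
    to it as a countable union of boxes with rational corners. *)
Lemma open_measurable_plane (U : set (R * R)) :
  open U -> measurable (U : set plane).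
Proof.
move=> oU.
pose box (i : (rat * rat) * (rat * rat)) : set plane :=
  `]ratr i.1.1, ratr i.1.2[ `*` `]ratr i.2.1, ratr i.2.2[.
have -> : U = \bigcup_i (if `[< box i `<=` U >] then box i else set0).
  apply/seteqP; split => [[x y] Uxy|z [i _]]; last by case: asboolP => // bU /bU.
  have : nbhs (x, y) U by apply: open_nbhs_nbhs.
  move=> /nbhs_ballP[e /= e0 eU].
  have /rat_in_itvoo[a] : x - e < x by rewrite ltrBlDr ltrDl.
  have /rat_in_itvoo[b] : x < x + e by rewrite ltrDl.
  have /rat_in_itvoo[c] : y - e < y by rewrite ltrBlDr ltrDl.
  have /rat_in_itvoo[d] : y < y + e by rewrite ltrDl.
  rewrite !in_itv/= => /andP[d1 d2] /andP[c1 c2] /andP[b1 b2] /andP[a1 a2].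
  exists ((a, b), (c, d)) => //; case: asboolP => [_|].
    by rewrite /box/= !in_itv/= a2 b1 c2 d1.
  case=> -[u v]; rewrite /box /= !in_itv/= => -[/andP[au ub] /andP[cv vd]].
  by apply: eU; split; rewrite /= /ball/= ltr_norml; lra.
apply: countable_bigcupT_measurable => [|i]; first exact: countableP.
by case: ifPn => // _; apply: measurableX; exact: measurable_itv.
Qed.

Lemma closed_measurable_plane (U : set (R * R)) :
  closed U -> measurable (U : set plane).
Proof.
move=> cU; rewrite -(setCK U); apply: measurableC.
by apply: open_measurable_plane; exact: closed_openC.
Qed.

Lemma continuous_measurable_plane (f : R * R -> R) : continuous f ->
  measurable_fun setT (f : plane -> R).
Proof.
move=> cf; apply: (measurability _ (RGenOpens.measurableE R)) => _ [_ [a [b ->]] <-].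
rewrite setTI; apply: open_measurable_plane; apply: open_comp => //.
Qed.

Lemma area_setX (A B : set R) : measurable A -> measurable B ->
  area (A `*` B) = (lebesgue_measure A * lebesgue_measure B)%E.
Proof.
exact: (@product_measure1E _ _ (measurableTypeR R) (measurableTypeR R) R
  lebesgue_measure lebesgue_measure).
Qed.

Lemma area_open_gt0 (U : set (R * R)) : open U -> U !=set0 -> (0 < area U)%E.
Proof.
move=> oU [[x y] Uxy].
have /nbhs_ballP[e /= e0 eU] : nbhs (x, y) U by apply: open_nbhs_nbhs.
have le_box : (area (ball x e `*` ball y e : set plane) <= area (U : set plane))%E.
  apply: le_measure; rewrite ?inE.
  - by apply: measurableX; exact: measurable_ball.
  - exact: open_measurable_plane.
  - by move=> [u v] [/= xu yv]; apply: eU.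
apply: lt_le_trans le_box; rewrite area_setX; try exact: measurable_ball.
rewrite !lebesgue_measure_ball ?ltW// -EFinM lte_fin.
by rewrite mulr_gt0// pmulrn_lgt0.
Qed.

Lemma bounded_set_box (D : set (R * R)) : bounded_set D ->
  exists2 B : R, 0 < B & forall x, D x -> `|x.1| <= B /\ `|x.2| <= B.
Proof.
move=> [M [_ DM]]; exists (Num.max M 0 + 1).
  by rewrite ltr_wpDl// le_max lexx orbT.
move=> x Dx.
have /DM/(_ x Dx)/= : M < Num.max M 0 + 1 by rewrite ltr_pwDr// le_max lexx.
by rewrite prod_normE ge_max => /andP.
Qed.

Lemma area_bounded_lty (D : set (R * R)) : bounded_set D ->
  measurable (D : set plane) -> (area D < +oo)%E.
Proof.
move=> /bounded_set_box[B B0 DB] mD.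
pose S : set plane := `[- B, B] `*` `[- B, B].
have le_box : (area D <= area S)%E.
  apply: le_measure; rewrite ?inE//.
  - by apply: measurableX; exact: measurable_itv.
  - by move=> x /DB[x1 x2]; split; rewrite /= in_itv/= -ler_norml.
apply: le_lt_trans le_box _; rewrite area_setX; try exact: measurable_itv.
by rewrite !lebesgue_measure_itv/=; case: ifPn => _; rewrite ?mule0 ?ltry// -EFinB -EFinM ltry.
Qed.

Definition shift_plane (a : R * R) (x : plane) : plane := (x.1 + a.1, x.2 + a.2).

Lemma measurable_shift_plane a : measurable_fun setT (shift_plane a).
Proof.
apply/measurable_fun_pairP; split => /=.
  by apply: measurable_funD => //; exact: measurable_fst.
by apply: measurable_funD => //; exact: measurable_snd.
Qed.

Lemma lebesgue_measure_shift (a : R) (A : set R) : measurable A ->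
  lebesgue_measure ((fun x : R => x + a) @^-1` A) = lebesgue_measure A.
Proof.
move=> mA; apply/esym.
have mf : measurable_fun setT (fun x : measurableTypeR R => (x + a : measurableTypeR R)).
  by apply: measurable_funD.
rewrite -[RHS]/(pushforward lebesgue_measure (fun x : measurableTypeR R => (x + a : measurableTypeR R)) A).
apply: lebesgue_measure_unique => //= _ [[u v]] _ <-.
rewrite /pushforward/=.
have -> : (fun x => x + a) @^-1` `]u, v] = `](u - a), (v - a)]%classic.
  by apply/seteqP; split => x /=; rewrite !in_itv/= ltrBlDr lerBrDr.
by rewrite !lebesgue_measure_itv/= !lte_fin -!EFinB ltrD2r; case: ifPn => // _; congr EFin; ring.
Qed.

Lemma area_shift (a : R * R) (A : set plane) : measurable A ->
  pushforward area (shift_plane a) A = area A.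
Proof.
move=> mA; apply/esym.
have mf := measurable_shift_plane a.
apply: product_measure_unique => // B C mB mC.
have mshift (b : R) (E : set R) : measurable E -> measurable ((fun x : R => x + b) @^-1` E).
  by move=> mE; rewrite -[X in measurable X]setTI; apply: measurable_funD.
transitivity (area (((fun x : R => x + a.1) @^-1` B) `*` ((fun x : R => x + a.2) @^-1` C))).
  by congr (area _); apply/seteqP; split.
rewrite area_setX; try exact: mshift.
by rewrite !lebesgue_measure_shift.
Qed.

(** Positive and negative parts are treated separately, so that measurability suffices and
    integrability need not be known. *)
Lemma integral_shift (a : R * R) (f : plane -> \bar R) : measurable_fun setT f ->
  (\int[area]_x f (shift_plane a x) = \int[area]_x f x)%E.
Proof.
move=> mf.
suff ge0_case (g : plane -> \bar R) : measurable_fun setT g -> (forall x, 0 <= g x)%E ->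
    (\int[area]_x g (shift_plane a x) = \int[area]_x g x)%E.
  rewrite integralE [RHS]integralE; congr (_ - _)%E.
  - rewrite -(ge0_case (f^\+)%E)//; last exact: measurable_funepos.
    by apply: eq_integral => x _; rewrite !funeposE.
  - rewrite -(ge0_case (f^\-)%E)//; last exact: measurable_funeneg.
    by apply: eq_integral => x _; rewrite !funenegE.
move=> mg g0; have ms := measurable_shift_plane a.
have := @ge0_integral_pushforward _ _ plane plane R (shift_plane a) ms area setT g
  measurableT mg (fun y _ => g0 y).
rewrite preimage_setT => <-.
by apply: eq_measure_integral => A mA _; exact: area_shift.
Qed.

(** Vertical sections of a non-vertical line are single points; a vertical line is a product with a
    null factor. *)
Lemma area_line (a b c : R) : (a, b) != (0, 0) ->
  area [set x : plane | a * x.1 + b * x.2 = c] = 0%E.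
Proof.
have [->|b0] := eqVneq b 0; last first.
  move=> _; rewrite /area/= /product_measure1 integral0_eq// => x _ /=.
  rewrite (_ : xsection _ _ = [set (c - a * x) / b]) ?lebesgue_measure_set1//.
  apply/seteqP; split => y; rewrite /xsection/= inE/=.
    by move=> <-; field.
  by move=> ->; field.
rewrite xpair_eqE eqxx andbT => a0.
rewrite (_ : [set _ | _] = [set c / a] `*` setT); last first.
  apply/seteqP; split => -[x y] /=; rewrite mul0r addr0.
    by move=> <-; split => //; field.
  by move=> [-> _]; field.
by rewrite area_setX// lebesgue_measure_set1 mul0e.
Qed.

End plane_measure.

(** * Triangulations and finite element functions *)

Section gluing.
Variable R : realType.

(** The furthest point [m] up to which the bound from [s] holds cannot lie before [t]: one of the
    finitely many closed sets contains [m] together with points arbitrarily close on its right, and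
    its own bound carries the estimate past [m]. The sets need not be intervals, which spares a
    subdivision of the segment. *)
Lemma lipschitz_glue (I : finType) (F : I -> set R) (g : R -> R) (L : R) :
  continuous g -> (forall i, closed (F i)) -> (forall t, exists i, F i t) ->
  (forall i s t, F i s -> F i t -> `|g s - g t| <= L * `|s - t|) ->
  forall s t, `|g s - g t| <= L * `|s - t|.
Proof.
move=> cg cF covF lipF s t.
wlog st : s t / s < t => [wl|].
  have [st|ts|->] := ltgtP s t; first exact: wl.
    by rewrite distrC (distrC s); exact: wl.
  by have [j Fj] := covF t; exact: (lipF j).
pose S := [set x | s <= x <= t /\ `|g s - g x| <= L * (x - s)].
have Ss : S s by rewrite /S/= lexx (ltW st) !subrr normr0 mulr0.
have ubS : has_ubound S by exists t => x [/andP[]].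
have S0 : S !=set0 by exists s.
have cS : closed S.
  have -> : S = [set x | s <= x] `&` [set x | x <= t] `&`
      [set x | 0 <= L * (x - s) - `|g s - g x|].
    apply/seteqP; split => x /=; rewrite subr_ge0.
      by move=> [/andP[sx xt] gx].
    by move=> [[sx xt] gx]; split=> //; apply/andP.
  apply: closedI; first by apply: closedI; [exact: closed_ge|exact: closed_le].
  apply: (@closed_comp _ _ (fun x => L * (x - s) - `|g s - g x|) [set y | 0 <= y]).
    move=> x _; apply: cvgB; last first.
      by apply: cvg_norm; apply: cvgB; [exact: cvg_cst|exact: cg].
    apply: cvgM; first exact: cvg_cst.
    by apply: cvgB; [exact: cvg_id|exact: cvg_cst].
  exact: closed_ge.
pose m := sup S.
have Sm : S m by apply: cS; exact: closure_sup.
have [mt|] := ltP m t; last first.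
  move=> tm; have [/andP[sm mt] gm] := Sm.
  have <- : m = t by apply/eqP; rewrite eq_le mt tm.
  by rewrite (distrC s) (ger0_norm (x := m - s)) ?subr_ge0.
(* Otherwise finitely many right neighbourhoods of [m] would intersect in points covered by no
   [F i]. *)
have [i Pi] : exists i, ~ (\forall x \near m^'+, ~ F i x).
  apply: contrapT => /forallNP nF.
  have /filter_forall : forall i, \forall x \near m^'+, ~ F i x.
    by move=> i; apply: contrapT; exact: nF.
  move=> /filter_ex[x nx]; have [i Fi] := covF x; exact: (nx i).
have Fm : F i m.
  apply: contrapT => nFm; apply: Pi.
  have : \forall x \near m, ~ F i x.
    by apply: (open_nbhs_nbhs (conj _ nFm)); exact: closed_openC.
  by rewrite /at_right near_withinE; apply: filterS.
have [x [/andP[mx xt] Fx]] : exists x, m < x < t /\ F i x.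
  apply: contrapT => /forallNP nx; apply: Pi; near=> x => Fx.
  apply: (nx x); split=> //; apply/andP; split; near: x.
    exact: nbhs_right_gt.
  exact: nbhs_right_lt.
have [/andP[sm _] gm] := Sm.
suff : S x by move/(ub_le_sup ubS); rewrite leNgt -/m mx.
split; first by rewrite (le_trans sm (ltW mx)) ltW.
have := lipF i m x Fm Fx; rewrite (distrC m) (ger0_norm (x := x - m)) ?subr_ge0 ?(ltW mx)//.
move=> gmx; rewrite -(subrKA (g m)) (le_trans (ler_normD _ _))//.
by rewrite (le_trans (lerD gm gmx))// -mulrDr addrC subrKA.
Unshelve. all: by end_near. Qed.

End gluing.

Section triangles.
Variable R : realType.
Local Notation plane := (measurableTypeR R * measurableTypeR R)%type.

Definition line (l : R * R * R) : set plane :=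
  [set x | l.1.1 * x.1 + l.1.2 * x.2 = l.2].

Definition halfplane (l : R * R * R) : set (R * R) :=
  [set x | l.2 <= l.1.1 * x.1 + l.1.2 * x.2].

Lemma continuous_affine (a b : R) : continuous (fun x : R * R => a * x.1 + b * x.2).
Proof.
move=> x; apply: cvgD; apply: cvgM; try exact: cvg_cst; [exact: cvg_fst|exact: cvg_snd].
Qed.

Lemma closed_halfplane l : closed (halfplane l).
Proof.
apply: (@closed_comp _ _ (fun x : R * R => l.1.1 * x.1 + l.1.2 * x.2) [set y | l.2 <= y]).
  by move=> x _; exact: continuous_affine.
exact: closed_ge.
Qed.

Lemma measurable_line l : measurable (line l).
Proof.
apply: closed_measurable_plane.
apply: (@closed_comp _ _ (fun x : R * R => l.1.1 * x.1 + l.1.2 * x.2) [set l.2]).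
  by move=> x _; exact: continuous_affine.
exact: closed_eq.
Qed.

(** Twice the signed area of the triangle; it is nonzero exactly when barycentric coordinates
    exist. *)
Definition tri_det (A B C : R * R) :=
  (A.1 - C.1) * (B.2 - C.2) - (A.2 - C.2) * (B.1 - C.1).

(* [tri_line A B C i] is the pair of the gradient and the opposite constant term of
   the i-th barycentric coordinate. *)
Definition tri_line (A B C : R * R) (i : 'I_3) : R * R * R :=
  let d := tri_det A B C in
  let l0 := ((B.2 - C.2) / d, - (B.1 - C.1) / d,
             ((B.2 - C.2) * C.1 - (B.1 - C.1) * C.2) / d) in
  let l1 := (- (A.2 - C.2) / d, (A.1 - C.1) / d,
             ((A.1 - C.1) * C.2 - (A.2 - C.2) * C.1) / d) in
  tnth [tuple l0; l1; (- (l0.1.1 + l1.1.1), - (l0.1.2 + l1.1.2), -1 - (l0.2 + l1.2))] i.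

Lemma tri_line_neq0 (A B C : R * R) i : tri_det A B C != 0 -> (tri_line A B C i).1 != (0, 0).
Proof.
move=> d0; apply/negP; rewrite /tri_line; set d := tri_det A B C.
have div0 (x : R) : (x / d == 0) = (x == 0) by rewrite mulf_eq0 invr_eq0 (negbTE d0) orbF.
suff H (x y : R) : x / d == 0 -> y / d == 0 -> x = 0 /\ y = 0.
  case: i => -[|[|[|//]]] i3; rewrite (tnth_nth (0,0,0))/= xpair_eqE => /andP[].
  - move=> /H/[apply][[h1 h2]]; move/eqP: d0; apply; rewrite /tri_det h1.
    by rewrite (_ : B.1 - C.1 = 0) ?mulr0 ?subrr//; lra.
  - move=> /H/[apply][[h1 h2]]; move/eqP: d0; apply; rewrite /tri_det h2.
    by rewrite (_ : A.2 - C.2 = 0) ?mul0r ?subrr//; lra.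
  - rewrite -!mulrDl -!mulNr => /H/[apply][[h1 h2]]; move/eqP: d0; apply; rewrite /tri_det.
    rewrite (_ : B.1 - C.1 = A.1 - C.1); last by lra.
    by rewrite (_ : B.2 - C.2 = A.2 - C.2) ?[_.2 * _]mulrC ?subrr//; lra.
by rewrite !div0 => /eqP -> /eqP ->.
Qed.

(** The three half-planes are the conditions that the barycentric coordinates be nonnegative. This
    form makes the triangle closed and puts its boundary on three lines. *)
Lemma triangle_halfplanes Np (p : 'I_Np -> R * R) (K : {set 'I_Np}) :
  injective p -> #|K| = 3%N -> (hull p K)° !=set0 ->
  exists2 l : 'I_3 -> R * R * R,
    forall i, (l i).1 != (0, 0) & hull p K = \bigcap_i halfplane (l i).
Proof.
move=> pinj K3 Kint.
have [c cK] : exists c, c \in K by apply/card_gt0P; rewrite K3.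
have /cards2P[a [b [ab Kab]]] : #|(K :\ c)%SET| == 2%N.
  by rewrite (cardsD1 c) cK add1n in K3; case: K3 => ->.
have sumK (V : nmodType) (F : 'I_Np -> V) : \sum_(i in K) F i = F a + F b + F c.
  by rewrite (big_setD1 c)//= Kab big_setU1 ?inE//= big_set1 addrC.
have bc : b != c.
  have : b \in (K :\ c)%SET by rewrite Kab !inE eqxx orbT.
  by rewrite !inE => /andP[].
have ac : a != c.
  have : a \in (K :\ c)%SET by rewrite Kab !inE eqxx.
  by rewrite !inE => /andP[].
set A := p a; set B := p b; set C := p c.
have hullE : hull p K = [set x | exists s t u, [/\ 0 <= s, 0 <= t, 0 <= u, s + t + u = 1
     & x = s *: A + t *: B + u *: C]].
  apply/seteqP; split => x /=.
    by move=> [w [w0]]; rewrite !sumK => w1 ->; exists (w a), (w b), (w c).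
  move=> [s [t [u [s0 t0 u0 stu ->]]]].
  exists (fun i => if i == a then s else if i == b then t else u).
  rewrite !sumK eqxx (eq_sym b a) (negbTE ab) eqxx (eq_sym c a) (negbTE ac).
  rewrite (eq_sym c b) (negbTE bc).
  by split=> // i; case: ifP => // _; case: ifP.
(* Collinear vertices would confine the hull to a line, which has area zero, whereas its nonempty
   interior has positive area. *)
have d0 : tri_det A B C != 0.
  apply/eqP => d0.
  pose l : R * R * R := (A.2 - C.2, - (A.1 - C.1), (A.2 - C.2) * C.1 - (A.1 - C.1) * C.2).
  have l0 : l.1 != (0, 0).
    apply/eqP => -[h1 h2]; move: ac; rewrite (_ : a = c) ?eqxx//; apply: pinj.
    by rewrite -/A -/C [A]surjective_pairing [C]surjective_pairing; congr pair; lra.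
  have Kl : hull p K `<=` line l.
    rewrite hullE => _ [s [t [u [_ _ _ stu ->]]]]; rewrite /line/=.
    have -> : u = 1 - s - t by lra.
    move: d0; rewrite /tri_det => d0.
    rewrite -[LHS]addr0 -[in LHS](mulr0 t) -d0 /GRing.scale/=; ring.
  have : (0 < area ((hull p K)° : set plane))%E.
    by apply: area_open_gt0 => //; exact: open_interior.
  rewrite lt0e => /andP[/negP + _]; apply; rewrite -measure_le0.
  rewrite -(@area_line R l.1.1 l.1.2 l.2); last by rewrite -surjective_pairing.
  apply: le_measure; rewrite ?inE.
  - by apply: open_measurable_plane; exact: open_interior.
  - exact: measurable_line.
  - by apply: subset_trans Kl; exact: interior_subset.
exists (tri_line A B C) => [i|]; first exact: tri_line_neq0.
rewrite hullE; apply/seteqP; split => x.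
  move=> [s [t [u [s0 t0 u0 stu ->]]]] i _.
  have us : u = 1 - s - t by lra.
  rewrite /halfplane/tri_line.
  case: i => -[|[|[|//]]] i3; rewrite !(tnth_nth (0,0,0))/= -subr_ge0.
  - apply: (le_trans s0); rewrite le_eqVlt; apply/orP; left; apply/eqP.
    by rewrite us; rewrite /tri_det in d0 *; rewrite /GRing.scale/=; field.
  - apply: (le_trans t0); rewrite le_eqVlt; apply/orP; left; apply/eqP.
    by rewrite us; rewrite /tri_det in d0 *; rewrite /GRing.scale/=; field.
  - apply: (le_trans u0); rewrite le_eqVlt; apply/orP; left; apply/eqP.
    by rewrite us; rewrite /tri_det in d0 *; rewrite /GRing.scale/=; field.
move=> xl.
have := xl (inord 0) I; have := xl (inord 1) I; have := xl (inord 2) I.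
rewrite /halfplane/tri_line !(tnth_nth (0,0,0)) !inordK//=.
set u := - _ * x.1 + _; set t := - _ / _ * x.1 + _; set s := _ / _ * x.1 + _ => u0 t0 s0.
(* Cramer's rule for the barycentric coordinates of [x]. *)
pose s' := ((x.1 - C.1) * (B.2 - C.2) - (x.2 - C.2) * (B.1 - C.1)) / tri_det A B C.
pose t' := ((A.1 - C.1) * (x.2 - C.2) - (A.2 - C.2) * (x.1 - C.1)) / tri_det A B C.
rewrite -subr_ge0 in u0; rewrite -subr_ge0 in t0; rewrite -subr_ge0 in s0.
exists s', t', (1 - s' - t').
split.
- apply: (le_trans s0); rewrite le_eqVlt; apply/orP; left; apply/eqP.
  by rewrite /s' /s; rewrite /tri_det in d0 *; field.
- apply: (le_trans t0); rewrite le_eqVlt; apply/orP; left; apply/eqP.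
  by rewrite /t' /t; rewrite /tri_det in d0 *; field.
- apply: (le_trans u0); rewrite le_eqVlt; apply/orP; left; apply/eqP.
  by rewrite /s' /t' /u; rewrite /tri_det in d0 *; field.
- ring.
- rewrite [LHS]surjective_pairing; rewrite /tri_det in d0 *.
  by congr pair; rewrite /= /s' /t' /GRing.scale/= /tri_det; field.
Qed.

End triangles.

Section polynomials.
Variable R : realType.

Definition polyf (c : nat -> nat -> R) (r : nat) (x : R * R) : R :=
  \sum_(i < r.+1) \sum_(j < r.+1 | (i + j <= r)%N) c i j * x.1 ^+ i * x.2 ^+ j.

(** Reduces properties stable under sums and products to constants and the two coordinates, so that
    the double sum is unfolded only once. *)
Lemma polyf_ind (Q : (R * R -> R) -> Prop) c r :
  (forall a, Q (fun=> a)) -> Q (fun x => x.1) -> Q (fun x => x.2) ->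
  (forall f g, Q f -> Q g -> Q (fun x => f x + g x)) ->
  (forall f g, Q f -> Q g -> Q (fun x => f x * g x)) -> Q (polyf c r).
Proof.
move=> Q0 Q1 Q2 QD QM.
have QX f n : Q f -> Q (fun x => f x ^+ n).
  move=> Qf; elim: n => [|n IH]; first exact: Q0.
  rewrite (_ : (fun x => _) = (fun x => f x * f x ^+ n)); first exact: QM.
  by apply/funext => x; rewrite exprS.
have Qsum (I : Type) (s : seq I) (P : pred I) (F : I -> R * R -> R) :
    (forall i, Q (F i)) -> Q (fun x => \sum_(i <- s | P i) F i x).
  move=> QF; elim: s => [|i s IH].
    by rewrite (_ : (fun x => _) = (fun=> 0))//; apply/funext => x; rewrite big_nil.
  have [Pi|Pi] := boolP (P i).
    rewrite (_ : (fun x => _) = (fun x => F i x + \sum_(j <- s | P j) F j x)); first exact: QD.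
    by apply/funext => x; rewrite big_cons Pi.
  rewrite (_ : (fun x => _) = (fun x => \sum_(j <- s | P j) F j x))//.
  by apply/funext => x; rewrite big_cons (negbTE Pi).
by do 2 apply: (Qsum) => ?; do 2?apply: (QM) => //; exact: QX.
Qed.

Lemma derivable_polyf c r x e : derivable (polyf c r) x e.
Proof.
apply: (@polyf_ind (fun f => derivable f x e)).
- by move=> a; exact: derivable_cst.
- apply/cvg_ex; exists e.1; apply: (@cvg_trans _ ((fun=> e.1) @ (0 : R)^')); last exact: cvg_cst.
  apply: near_eq_cvg; near=> h.
  rewrite /GRing.scale/= addrK mulKf//.
  by near: h; exact: nbhs_dnbhs_neq.
- apply/cvg_ex; exists e.2; apply: (@cvg_trans _ ((fun=> e.2) @ (0 : R)^')); last exact: cvg_cst.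
  apply: near_eq_cvg; near=> h.
  rewrite /GRing.scale/= addrK mulKf//.
  by near: h; exact: nbhs_dnbhs_neq.
- by move=> f g; exact: derivableD.
- by move=> f g; exact: derivableM.
Unshelve. all: by end_near. Qed.

Definition dist1 (x y : R * R) := `|x.1 - y.1| + `|x.2 - y.2|.

Lemma dist1_ge0 x y : 0 <= dist1 x y. Proof. by rewrite addr_ge0. Qed.

Lemma polyf_lipschitz (B : R) c r : exists2 L, 0 <= L &
  forall x y : R * R, `|x.1| <= B -> `|x.2| <= B -> `|y.1| <= B -> `|y.2| <= B ->
    `|polyf c r x - polyf c r y| <= L * dist1 x y.
Proof.
pose box := [set x : R * R | `|x.1| <= B /\ `|x.2| <= B].
(* The induction has to carry a bound [M] of the values as well, because the Lipschitz constant of a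
   product is [L * M' + M * L']. *)
suff : exists L, exists M, [/\ 0 <= L, 0 <= M, forall x, box x -> `|polyf c r x| <= M &
   forall x y, box x -> box y -> `|polyf c r x - polyf c r y| <= L * dist1 x y].
  by move=> [L [M [L0 M0 _ H]]]; exists L => // *; apply: H.
apply: (@polyf_ind (fun f => exists L, exists M, [/\ 0 <= L, 0 <= M,
  forall x, box x -> `|f x| <= M &
  forall x y, box x -> box y -> `|f x - f y| <= L * dist1 x y])).
- by move=> a; exists 0, `|a|; split => // x y _ _; rewrite subrr normr0 mul0r.
- exists 1, `|B|; split => // [x [+ _]|x y _ _]; last by rewrite mul1r lerDl.
  by move/le_trans; apply; exact: ler_norm.
- exists 1, `|B|; split => // [x [_ +]|x y _ _]; last by rewrite mul1r lerDr.
  by move/le_trans; apply; exact: ler_norm.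
- move=> f g [L [M [L0 M0 fM fL]]] [L' [M' [L0' M0' fM' fL']]].
  exists (L + L'), (M + M'); split; try exact: addr_ge0.
    by move=> x bx; rewrite (le_trans (ler_normD _ _))// lerD ?fM ?fM'.
  move=> x y bx byy; rewrite opprD addrACA mulrDl (le_trans (ler_normD _ _))//.
  by rewrite lerD ?fL ?fL'.
- move=> f g [L [M [L0 M0 fM fL]]] [L' [M' [L0' M0' fM' fL']]].
  exists (L * M' + M * L'), (M * M'); split.
  + by rewrite addr_ge0// mulr_ge0.
  + by rewrite mulr_ge0.
  + by move=> x bx; rewrite normrM ler_pM ?fM ?fM'.
  move=> x y bx byy.
  have -> : f x * g x - f y * g y = (f x - f y) * g x + f y * (g x - g y) by ring.
  rewrite (le_trans (ler_normD _ _))// !normrM mulrDl lerD//.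
    by rewrite mulrAC ler_pM ?fL ?fM'.
  by rewrite -mulrA ler_pM ?fM ?fL'.
Qed.

End polynomials.

Section mesh.
Variable R : realType.
Local Notation plane := (measurableTypeR R * measurableTypeR R)%type.
Variables (D : set (R * R)) (Np : nat) (p : 'I_Np -> R * R) (T : {set {set 'I_Np}}).
Hypothesis D_domain : bounded_domain D.
Hypothesis T_mesh : triangulation D p T.

Lemma closed_hull K : K \in T -> closed (hull p K).
Proof.
have [pinj _ T3 _ _] := T_mesh; move=> /T3[K3 Kint].
have [l _ ->] := triangle_halfplanes pinj K3 Kint.
by apply: closed_bigI => i _; exact: closed_halfplane.
Qed.

Lemma hull_closure K : K \in T -> hull p K `<=` closure D.
Proof. by move=> KT; have [_ _ _ _ ->] := T_mesh => x Kx; exists K. Qed.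

(** [N] collects the full lines through the edges, which are still null and easier to describe than
    the edges. Off these lines the three inequalities of a triangle are strict, hence persist in a
    neighbourhood. *)
Lemma mesh_edges_null : exists2 N : set plane, measurable N /\ area N = 0%E &
  forall x, closure D x -> ~ N x -> exists2 K, K \in T & (hull p K)° x.
Proof.
have [pinj _ T3 _ cD] := T_mesh.
have /choice[l lP] : forall K, exists l : 'I_3 -> R * R * R, K \in T ->
    (forall i, (l i).1 != (0, 0)) /\ hull p K = \bigcap_i halfplane (l i).
  move=> K; have [KT|] := boolP (K \in T); last by exists (fun=> 0).
  have [K3 Kint] := T3 K KT.
  by have [l l0 lK] := triangle_halfplanes pinj K3 Kint; exists l.
pose N : set plane := \big[setU/set0]_(K in T) \big[setU/set0]_i line (l K i).
exists N => [|x].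
  pose Q (A : set plane) := measurable A /\ area A = 0%E.
  have Q0 : Q set0 by split; rewrite ?measure0.
  have QU A B : Q A -> Q B -> Q (A `|` B).
    move=> [mA A0] [mB B0]; split; first exact: measurableU.
    by rewrite null_set_setU.
  apply: (big_ind Q) => // K KT; apply: (big_ind Q) => // i _.
  have [l0 _] := lP K KT; split; first exact: measurable_line.
  by rewrite /line area_line// -surjective_pairing.
rewrite cD => -[K KT Kx] nN; exists K => //.
have [_ lK] := lP K KT.
have UK : \forall y \near x, forall i, (l K i).2 < (l K i).1.1 * y.1 + (l K i).1.2 * y.2.
  apply: (@filter_forall _ _ (fun i (y : R * R) => (l K i).2 < (l K i).1.1 * y.1 + (l K i).1.2 * y.2) (nbhs x)) => i.
  pose g (y : R * R) := (l K i).1.1 * y.1 + (l K i).1.2 * y.2.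
  apply: (@open_nbhs_nbhs _ x (g @^-1` [set z | (l K i).2 < z])); split.
    by apply: open_comp; [move=> y _; exact: continuous_affine|exact: open_gt].
  have := Kx; rewrite lK => /(_ i I); rewrite /halfplane/= le_eqVlt => /predU1P[e|//].
  by exfalso; apply: nN; rewrite /N (bigD1 K)//= (bigD1 i)//=; left; left.
by apply: filterS UK => y Uy; rewrite lK => i _; apply: ltW; exact: Uy.
Qed.

(* The properties kept of the extension by zero of a finite element function; N is
   a null set containing the edges of the mesh. *)
Record lipschitz_ext (N : set plane) (u : R * R -> R) : Prop := LipschitzExt {
  ext_continuous : continuous u;
  ext_lipschitz : exists2 L, 0 <= L & forall x y, `|u x - u y| <= L * dist1 x y;
  ext_out : forall x, ~ D x -> u x = 0;
  ext_out_near : forall x, ~ D x -> ~ N x -> \forall y \near x, u y = 0;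
  ext_derivable : forall x e, ~ N x -> derivable u x e }.

(** Vanishing on the boundary makes the extension continuous. A segment between two points may cross
    many triangles and may leave [D], which need not be convex, so the Lipschitz bounds of the
    polynomial pieces are glued along the segment. *)
Lemma lipschitz_ext_Pk (N : set plane) r f :
  (forall x, closure D x -> ~ N x -> exists2 K, K \in T & (hull p K)° x) ->
  continuous_Pk D p T r f -> (forall x, closure D x -> ~ D x -> f x = 0) ->
  lipschitz_ext N (patch (cst 0) D f).
Proof.
move=> N_int [fcont fpoly] f0.
have [oD _ _ bD _] := D_domain.
set u := patch (cst 0) D f.
have uE x : closure D x -> u x = f x.
  move=> Dx; rewrite /u patchE; case: ifPn => //; rewrite notin_setE => nDx.
  by rewrite f0.
have uout x : ~ D x -> u x = 0 by move=> nDx; rewrite /u patchE memNset.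
have cuE : {within closure D, continuous u}.
  apply: subspace_eq_continuous fcont => x; rewrite inE => /uE; exact: esym.
have cuC : {within ~` D, continuous u}.
  have : {within ~` D, continuous (cst 0 : R * R -> R)} by apply: continuous_subspaceT; exact: cst_continuous.
  by apply: subspace_eq_continuous => x; rewrite inE => /uout; exact: esym.
have ucont : continuous u.
  have := withinU_continuous (@closed_closure _ D) (open_closedC oD) cuE cuC.
  rewrite (_ : _ `|` _ = setT) => [uT x A uA|].
    by have := uT x A uA; rewrite nbhs_subspaceT.
  rewrite -subTset => x _; have [Dx|nDx] := pselect (D x); last by right.
  by left; exact: subset_closure.
have [B B0 DB] := bounded_set_box bD.
have cDB : closure D `<=` [set x | `|x.1| <= B /\ `|x.2| <= B].
  have -> : [set x : R * R | `|x.1| <= B /\ `|x.2| <= B] =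
     (fun x : R * R => `|x.1|) @^-1` [set y | y <= B] `&`
     (fun x : R * R => `|x.2|) @^-1` [set y | y <= B] by apply/seteqP; split.
  rewrite closureE; apply: smallest_sub => //.
  apply: closedI; apply: closed_comp; try exact: closed_le.
    by move=> x _; apply: cvg_norm; exact: cvg_fst.
  by move=> x _; apply: cvg_norm; exact: cvg_snd.
have [c cP] : exists c : {set 'I_Np} -> nat -> nat -> R,
    forall K, K \in T -> forall x, hull p K x -> f x = polyf (c K) r x.
  have /choice[c cP] : forall K, exists c : nat -> nat -> R, K \in T ->
    forall x, hull p K x -> f x = polyf c r x.
    move=> K; have [/fpoly[c cP]|_] := boolP (K \in T); last by exists (fun _ _ => 0).
    by exists c.
  by exists c.
have /choice[L LP] : forall K, exists L, 0 <= L /\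
    forall x y : R * R, `|x.1| <= B -> `|x.2| <= B -> `|y.1| <= B -> `|y.2| <= B ->
    `|polyf (c K) r x - polyf (c K) r y| <= L * dist1 x y.
  by move=> K; have [L L0 LP] := polyf_lipschitz B (c K) r; exists L.
split=> //.
- exists (\sum_K L K) => [|x y]; first by apply: sumr_ge0 => K _; have [] := LP K.
  (* Restriction to the segment from [x] to [y]. In the closed cover [F], [Some K] stands for a
     triangle and [None] for the complement of [D]. *)
  pose g t := u (x + t *: (y - x)).
  pose F (i : option {set 'I_Np}) : set R :=
    if i is Some K then [set t | K \in T /\ hull p K (x + t *: (y - x))]
    else [set t | ~ D (x + t *: (y - x))].
  have cseg : continuous (fun t : R => x + t *: (y - x)).
    by move=> t; apply: cvgD; [exact: cvg_cst|apply: cvgZr_tmp; exact: cvg_id].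
  have := @lipschitz_glue R _ F g ((\sum_K L K) * dist1 x y) _ _ _ _ 0 1.
  rewrite /g scale0r addr0 scale1r subrKC sub0r normrN1 mulr1; apply.
  + by move=> t; exact: (@continuous_comp R _ R _ u t (cseg t) (ucont _)).
  + case=> [K|]; last first.
      by apply: (@closed_comp _ _ _ (~` D)); [move=> ? _; exact: cseg|exact: open_closedC].
    have [KT|KT] := boolP (K \in T).
      rewrite (_ : F _ = (fun t : R => x + t *: (y - x)) @^-1` hull p K).
        by apply: closed_comp; [move=> ? _; exact: cseg|exact: closed_hull].
      by apply/seteqP; split => t /=; rewrite KT; [case|].
    rewrite (_ : F _ = set0); first exact: closed0.
    by apply/seteqP; split => t //=; rewrite (negbTE KT); case.
  + move=> t; have [Dt|nDt] := pselect (D (x + t *: (y - x))); last by exists None.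
    have [_ _ _ _ cD] := T_mesh.
    have := subset_closure Dt; rewrite cD => -[K KT Kt]; by exists (Some K).
  + move=> [K|] s t /=; last first.
      by move=> /uout + /uout; rewrite /g => -> ->; rewrite subrr normr0 !mulr_ge0// ?dist1_ge0// sumr_ge0// => K _; have [] := LP K.
    move=> [KT Ks] [_ Kt].
    rewrite /g !uE; try exact: hull_closure KT _ _.
    rewrite !(cP K KT)//.
    have [s1 s2] := cDB _ (hull_closure KT Ks).
    have [t1 t2] := cDB _ (hull_closure KT Kt).
    have [L0 /(_ _ _ s1 s2 t1 t2)] := LP K; move/le_trans; apply.
    have -> : dist1 (x + s *: (y - x)) (x + t *: (y - x)) = dist1 x y * `|s - t|.
      have aff (a b : R) : `|a + s * (b - a) - (a + t * (b - a))| = `|a - b| * `|s - t|.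
        by rewrite (distrC a) -normrM; congr (`|_|); ring.
      by rewrite /dist1 mulrDl -!aff.
    rewrite mulrA ler_wpM2r// ler_wpM2r ?dist1_ge0//.
    by rewrite (bigD1 K)//= lerDl sumr_ge0// => K' _; have [] := LP K'.
(* A point of [closure D] off [N] is interior to a triangle, hence to [closure D], hence lies in [D]
   because [D] is the interior of its closure. Only points with a neighbourhood outside [closure D]
   remain. *)
- move=> x nDx nNx; have [Dx|] := pselect (closure D x).
    have [K KT Kx] := N_int x Dx nNx.
    exfalso; apply: nDx; have [_ _ _ _ <-] := D_domain.
    exact: (filterS (hull_closure KT) Kx).
  move=> ncDx; near=> y; rewrite uout// => /subset_closure; near: y.
  apply: (@open_nbhs_nbhs _ x (~` closure D)); split=> //.
  exact: closed_openC (@closed_closure _ D).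
- move=> x e nNx; have [Dx|nDx] := pselect (closure D x).
    have [K KT Kx] := N_int x Dx nNx.
    apply: (@near_eq_derivable _ _ _ (polyf (c K) r)); last exact: derivable_polyf.
    near=> y; rewrite -(cP K KT) ?uE//; last first.
      by near: y.
    apply: hull_closure KT _ _.
    by near: y.
  apply: (@near_eq_derivable _ _ _ (cst 0)); last exact: derivable_cst.
  near=> y; rewrite uout// => /subset_closure; near: y.
  apply: (@open_nbhs_nbhs _ x (~` closure D)); split=> //.
  exact: closed_openC (@closed_closure _ D).
Unshelve. all: by end_near. Qed.

End mesh.

(** * Integration by parts through difference quotients *)

Section difference_quotients.
Variable R : realType.
Local Notation plane := (measurableTypeR R * measurableTypeR R)%type.

(** Dominated convergence, the dominating function being [M] on [W] and 0 elsewhere. The limit is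
    integrated off [N] because pointwise convergence is available only there. *)
Lemma Rintegral_cvg_bounded (N W : set plane) (f_ : nat -> plane -> R) (F : plane -> R) (M : R) :
  measurable N -> area N = 0%E -> measurable W -> (area W < +oo)%E ->
  (forall n, measurable_fun setT (f_ n)) -> (forall n x, `|f_ n x| <= M) ->
  (forall n x, ~ W x -> f_ n x = 0) ->
  (forall x, ~ N x -> f_ n x @[n --> \oo] --> F x) ->
  (\int[area]_x f_ n x) @[n --> \oo] --> \int[area]_(x in ~` N) F x.
Proof.
move=> mN N0 mW Woo mf fM fW fF.
have mC : measurable (~` N) by exact: measurableC.
have fcvg : forall x, (~` N) x -> f_ n x @[n --> \oo] --> F x by [].
pose g : plane -> \bar R := (EFin \o (cst M)) \_ W.
have ig : area.-integrable (~` N) g.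
  apply: (@integrableS _ _ _ _ setT) => //.
  apply/(integrable_mkcond _ mW).
  apply: (@integrable_bounded_fun _ _ _ _ _ _ `|M|) => //.
have mF : measurable_fun (~` N) F.
  apply: (@measurable_fun_cvg _ _ _ (~` N) f_ F) => //.
  by move=> n; exact: measurable_funTS.
have [] := @dominated_convergence _ _ _ area (~` N) mC (fun n => EFin \o f_ n) (EFin \o F) g _ _ _ ig _.
- by move=> n; apply/measurable_EFinP; exact: measurable_funTS.
- exact/measurable_EFinP.
- apply: aeW => x Nx; apply: cvg_EFin; last exact: fF.
  by near=> n.
- apply: aeW => x n _ /=; rewrite /g patchE; case: ifPn => [_|].
    by rewrite lee_fin.
  by rewrite notin_setE => /fW ->; rewrite normr0.
move=> iF _ cvgF.
rewrite (_ : (fun n => _) = fine \o (fun n => (\int[area]_(x in ~` N) (f_ n x)%:E)%E)).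
  apply: fine_cvg; rewrite /Rintegral fineK; first exact: cvgF.
  exact: integrable_fin_num.
apply/funext => n; rewrite /Rintegral/= (@integral_setD_null _ _ _ _ setT N)//.
by rewrite setTD.
Unshelve. all: by end_near. Qed.


Variables (D : set (R * R)) (N : set plane).
Hypotheses (D_bounded : bounded_set D) (mN : measurable N) (N0 : area N = 0%E).
Implicit Types (u w : R * R -> R) (e : R * R).

Lemma ext_measurable_shift u (a : R * R) : lipschitz_ext D N u ->
  measurable_fun setT (fun x : plane => u (x.1 + a.1, x.2 + a.2)).
Proof.
move=> eu; apply: (measurableT_comp _ (measurable_shift_plane a)).
exact: continuous_measurable_plane (ext_continuous eu).
Qed.

Lemma harmonic_neq0 (n : nat) : n.+1%:R^-1 != 0 :> R.
Proof. by rewrite invr_eq0 pnatr_eq0. Qed.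

(** The shift is spelled out by coordinates, as in [shift_plane], so that translation invariance
    applies directly. *)
Definition dquot u e (h : R) (x : R * R) : R := (u (x.1 + (h *: e).1, x.2 + (h *: e).2) - u x) / h.

Lemma measurable_dquot u e h : lipschitz_ext D N u ->
  measurable_fun setT (dquot u e h : plane -> R).
Proof.
move=> eu; apply: measurable_funM => //; apply: measurable_funB.
  exact: ext_measurable_shift.
exact: continuous_measurable_plane (ext_continuous eu).
Qed.

Lemma dquot_bounded u e : lipschitz_ext D N u ->
  exists2 M : R, 0 <= M & forall h x, `|dquot u e h x| <= M.
Proof.
move=> /ext_lipschitz[L L0 uL]; exists (L * (`|e.1| + `|e.2|)).
  by rewrite mulr_ge0// addr_ge0.
move=> h x; have [->|h0] := eqVneq h 0.
  by rewrite /dquot invr0 mulr0 normr0 mulr_ge0// addr_ge0.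
rewrite /dquot normrM normfV ler_pdivrMr ?normr_gt0//.
rewrite (le_trans (uL _ _))// -mulrA ler_wpM2l// /dist1/=.
by rewrite /GRing.scale/= addrAC subrr add0r addrAC subrr add0r !normrM mulrDl lerD// mulrC.
Qed.

Lemma dquot_cvg u e (h : nat -> R) x : lipschitz_ext D N u -> ~ N x ->
  h @ \oo --> 0 -> (forall n, h n != 0) ->
  dquot u e (h n) x @[n --> \oo] --> 'D_e u x.
Proof.
move=> eu nNx h0 hn0.
have du : derivable u x e by apply: (ext_derivable eu).
have hd : h @ \oo --> 0^'.
  move=> A; rewrite /dnbhs/= => HA.
  have H : \forall n \near \oo, h n != 0 -> A (h n) := h0 _ HA.
  by apply: filterS H => n; apply; exact: hn0.
have := cvg_comp _ _ hd du.
apply: cvg_trans; apply: near_eq_cvg; near=> n.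
rewrite /dquot/= mulrC /GRing.scale/=; congr (_ * (u _ - _)).
by rewrite [h n *: e + x]surjective_pairing; congr pair; exact: addrC.
Unshelve. all: by end_near. Qed.

Lemma derive_ext_bounded u e : lipschitz_ext D N u ->
  exists2 M : R, 0 <= M & forall x, ~ N x -> `|'D_e u x| <= M.
Proof.
move=> eu; have [M M0 uM] := dquot_bounded e eu; exists M => // x nNx.
have h0 : (fun n : nat => n.+1%:R^-1 : R) @ \oo --> (0 : R) by exact: cvg_harmonic.
have cv := @dquot_cvg u e _ x eu nNx h0 (fun n => harmonic_neq0 n).
apply: (@closed_cvg _ _ _ _ _ [set y : R | `|y| <= M] _ _ _ cv); last first.
  by apply: nearW => n; exact: uM.
apply: (@preimage_closed _ _ (fun y : R => `|y|) [set y | y <= M]); last exact: closed_le.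
by move=> y _; exact: norm_continuous.
Qed.

Lemma measurable_derive_ext u e : lipschitz_ext D N u ->
  measurable_fun (~` N) ('D_e u : plane -> R).
Proof.
move=> eu.
have h0 : (fun n : nat => n.+1%:R^-1 : R) @ \oo --> (0 : R) by exact: cvg_harmonic.
apply: (@measurable_fun_cvg _ _ _ (~` N) (fun n => dquot u e n.+1%:R^-1)).
- by move=> n; apply: measurable_funTS; exact: measurable_dquot.
- by move=> x nNx; apply: (@dquot_cvg u e (fun n => n.+1%:R^-1)) => // n; exact: harmonic_neq0.
Qed.

Lemma derive_ext_out u e x : lipschitz_ext D N u -> ~ D x -> ~ N x -> 'D_e u x = 0.
Proof.
move=> eu nDx nNx; rewrite (@near_eq_derive _ _ _ u (cst 0))//; last exact: (ext_out_near eu).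
exact: derive_cst.
Qed.

End difference_quotients.

Lemma lim_const_seq (R : realType) (s : nat -> R) (c l : R) :
  (forall n, s n = c) -> s @ \oo --> l -> c = l.
Proof.
move=> sc sl; have e : s = (fun=> c) by apply/funext.
rewrite e in sl.
exact: (@cvg_unique _ (@Rhausdorff R) _ _ c l (cvg_cst c) sl).
Qed.

Section Rintegrable.
Context d (T : measurableType d) (R : realType).
Variables (mu : {measure set T -> \bar R}) (D : set T).
Hypothesis mD : measurable D.
Implicit Types f g : T -> R.

Lemma RintegrableD f g : mu.-integrable D (EFin \o f) -> mu.-integrable D (EFin \o g) ->
  mu.-integrable D (EFin \o (fun x => f x + g x)).
Proof. by move=> intf intg; exact: (integrableD mD intf intg). Qed.

Lemma RintegrableB f g : mu.-integrable D (EFin \o f) -> mu.-integrable D (EFin \o g) ->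
  mu.-integrable D (EFin \o (fun x => f x - g x)).
Proof. by move=> intf intg; exact: (integrableB mD intf intg). Qed.

Lemma RintegrableZ (k : R) f : mu.-integrable D (EFin \o f) ->
  mu.-integrable D (EFin \o (fun x => k * f x)).
Proof. by move=> intf; exact: (integrableZl mD k intf). Qed.

Lemma Rintegrable_sum (I : Type) (s : seq I) (F : I -> T -> R) :
  (forall i, mu.-integrable D (EFin \o F i)) ->
  mu.-integrable D (EFin \o (fun x => \sum_(i <- s) F i x)) /\
  \int[mu]_(x in D) (\sum_(i <- s) F i x) = \sum_(i <- s) \int[mu]_(x in D) F i x.
Proof.
move=> iF; elim: s => [|i s [IHi IHe]].
  have e0 : (fun x => \sum_(i <- [::]) F i x) = (fun=> 0) by apply/funext => x; rewrite big_nil.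
  rewrite e0; split; first exact: integrable0.
  by rewrite big_nil /Rintegral integral0.
have ec : (fun x => \sum_(i <- i :: s) F i x) = (fun x => F i x + \sum_(i <- s) F i x).
  by apply/funext => x; rewrite big_cons.
rewrite ec; split; first exact: RintegrableD.
by rewrite RintegralD// IHe big_cons.
Qed.

End Rintegrable.

Section integral_identities.
Variable R : realType.
Local Notation plane := (measurableTypeR R * measurableTypeR R)%type.
Variables (D : set (R * R)) (N : set plane).
Hypotheses (oD : open D) (D_bounded : bounded_set D) (mN : measurable N) (N0 : area N = 0%E).
Implicit Types (u w : R * R -> R) (a b c e : R * R).
Local Notation sh u a := (fun x : plane => u (x.1 + a.1, x.2 + a.2)).

Lemma ext_bounded u : lipschitz_ext D N u -> exists2 M : R, 0 <= M & forall x, `|u x| <= M.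
Proof.
move=> eu; have [L L0 uL] := ext_lipschitz eu.
have [B B0 DB] := bounded_set_box D_bounded.
exists (L * (B + B + 1)) => [|x]; first by rewrite mulr_ge0// !addr_ge0// ltW.
have [Dx|/(ext_out eu) ->] := pselect (D x); last first.
  by rewrite normr0 mulr_ge0// !addr_ge0// ltW.
(* [D] has width at most [B + B], so this translate lies outside [D], where [u] is zero; the
   Lipschitz bound between the two points then bounds [u x]. *)
have nD : ~ D (x.1 + (B + B + 1), x.2).
  have [/= + _] := DB _ Dx; move=> xB /DB[/= + _].
  by move: xB; rewrite !ler_norml; lra.
have := uL x (x.1 + (B + B + 1), x.2).
rewrite (ext_out eu nD) subr0 /dist1/= subrr normr0 addr0 opprD addNKr normrN (ger0_norm (x := B + B + 1))//.
by rewrite !addr_ge0// ltW.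
Qed.

Definition unit_shift a := `|a.1| <= 1 /\ `|a.2| <= 1.

(** One box for all shifts of size at most 1 gives a common support, and so a common dominating
    function, for all difference quotients along a sequence of steps. The bound [C] on the first
    coordinate serves the weight [x.1] in [ext_eq0]. *)
Lemma exists_box : exists W : set plane, exists C : R, [/\ measurable W, (area W < +oo)%E,
  0 <= C, forall x, W x -> `|x.1| <= C &
  forall x a, unit_shift a -> ~ W x -> ~ D (x.1 + a.1, x.2 + a.2)].
Proof.
have [B B0 DB] := bounded_set_box D_bounded.
pose S : set plane := `[- (B + 1), B + 1] `*` `[- (B + 1), B + 1].
have mS : measurable S by apply: measurableX; exact: measurable_itv.
exists S, (B + 1); split => //.
- apply: area_bounded_lty => //; exists (B + 1); split; first exact: num_real.
  move=> M BM x [/= + +]; rewrite !in_itv/= -!ler_norml => x1 x2.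
  by rewrite prod_normE ge_max !(le_trans _ (ltW BM)).
- by rewrite addr_ge0// ltW.
- by move=> x [/= + _]; rewrite in_itv/= -ler_norml.
- move=> x a [a1 a2] nS /DB[/= d1 d2]; apply: nS; split; rewrite /= in_itv/=.
    by move: d1 a1; rewrite !ler_norml; lra.
  by move: d2 a2; rewrite !ler_norml; lra.
Qed.

Lemma integrable_supported (W : set plane) (f : plane -> R) (M : R) :
  measurable W -> (area W < +oo)%E -> measurable_fun setT f ->
  (forall x, `|f x| <= M) -> (forall x, ~ W x -> f x = 0) ->
  area.-integrable setT (EFin \o f).
Proof.
move=> mW Woo mf fM fW.
have -> : EFin \o f = (EFin \o f) \_ W.
  apply/funext => x; rewrite patchE; case: ifPn => //; rewrite notin_setE => /fW /= ->.
  by [].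
apply/(integrable_mkcond _ mW).
apply: (@integrable_bounded_fun _ _ _ _ _ _ M) => //.
exact: measurable_funTS.
Qed.

Lemma integrable_shM u w a b : lipschitz_ext D N u -> lipschitz_ext D N w ->
  unit_shift a -> unit_shift b ->
  area.-integrable setT (EFin \o (fun x => sh u a x * sh w b x)).
Proof.
move=> eu ew ua ub.
have [W [C [mW Woo C0 _ WD]]] := exists_box.
have [M M0 uM] := ext_bounded eu; have [M' M0' wM] := ext_bounded ew.
apply: (@integrable_supported W _ (M * M')) => //.
- by apply: measurable_funM; [exact: ext_measurable_shift eu|exact: ext_measurable_shift ew].
- by move=> x; rewrite normrM ler_pM.
- by move=> x nW; rewrite (ext_out eu) ?mul0r//; exact: WD.
Qed.

(** Cross-correlation of two translates. By translation invariance only [a - b] matters, and a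
    product of difference quotients expands into four such terms. *)
Definition corr u w a b := \int[area]_x (sh u a x * sh w b x).

Lemma corr_shift u w a b c : lipschitz_ext D N u -> lipschitz_ext D N w ->
  corr u w a b = corr u w (a + c) (b + c).
Proof.
move=> eu ew; rewrite /corr /Rintegral; congr fine.
rewrite -(@integral_shift R c); last first.
  apply/measurable_EFinP; apply: measurable_funM; [exact: ext_measurable_shift eu|].
  exact: ext_measurable_shift ew.
apply: eq_integral => x _; rewrite /shift_plane/=.
by rewrite !addrA ![_ + c.1 + _]addrAC ![_ + c.2 + _]addrAC.
Qed.

Lemma Rintegral_dquotM u w e e' h : lipschitz_ext D N u -> lipschitz_ext D N w ->
  unit_shift (h *: e) -> unit_shift (h *: e') ->
  \int[area]_x (dquot u e h x * dquot w e' h x) =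
  (h ^- 2) * (corr u w (h *: e) (h *: e') - corr u w (h *: e) 0
    - corr u w 0 (h *: e') + corr u w 0 0).
Proof.
move=> eu ew ue ue'.
have u0 : unit_shift 0 by split; rewrite normr0.
have sh0 (v : R * R -> R) (x : plane) : v (x.1 + (0 : R * R).1, x.2 + (0 : R * R).2) = v x.
  by rewrite !addr0 -surjective_pairing.
set a := h *: e in ue *; set b := h *: e' in ue' *.
have iA := integrable_shM eu ew ue ue'.
have iB := integrable_shM eu ew ue u0.
have iC := integrable_shM eu ew u0 ue'.
have iE := integrable_shM eu ew u0 u0.
rewrite /corr -RintegralB// -RintegralB//; last exact: RintegrableB.
rewrite -RintegralD//; last by apply: RintegrableB => //; exact: RintegrableB.
rewrite -RintegralZl//; last by apply: RintegrableD => //; apply: RintegrableB => //; exact: RintegrableB.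
apply: eq_Rintegral => x _; rewrite /dquot -/a -/b !sh0 -exprVn; ring.
Qed.

Lemma unit_shiftN a : unit_shift a -> unit_shift (- a).
Proof. by rewrite /unit_shift/= !normrN. Qed.

(* Translating the four correlations of [Rintegral_dquotM] exchanges the two
   directions and reverses the step: a discrete double integration by parts. *)
Lemma Rintegral_dquot_swap u w e e' h : lipschitz_ext D N u -> lipschitz_ext D N w ->
  unit_shift (h *: e) -> unit_shift (h *: e') ->
  \int[area]_x (dquot u e h x * dquot w e' h x) =
  \int[area]_x (dquot u e' (- h) x * dquot w e (- h) x).
Proof.
move=> eu ew ue ue'; rewrite !Rintegral_dquotM// ?scaleNr; try exact: unit_shiftN.
rewrite sqrrN; congr (_ * _).
set a := h *: e; set b := h *: e'.
rewrite (corr_shift (- b) (- a) (a + b))//  (corr_shift (- b) 0 b)// (corr_shift 0 (- a) a)//.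
have -> : - b + (a + b) = a by rewrite addrC addrK.
by rewrite addKr !addNr !add0r; ring.
Qed.

(** The limit of [Rintegral_dquot_swap], with steps [n.+1%:R^-1] on one side and their opposites on
    the other; both families converge to derivatives off [N]. *)
Lemma Rintegral_derive_swap u w e e' : lipschitz_ext D N u -> lipschitz_ext D N w ->
  unit_shift e -> unit_shift e' ->
  \int[area]_(x in D) ('D_e u x * 'D_e' w x) = \int[area]_(x in D) ('D_e' u x * 'D_e w x).
Proof.
move=> eu ew ue ue'.
have h0 : (fun n : nat => n.+1%:R^-1 : R) @ \oo --> (0 : R) by exact: cvg_harmonic.
have h0N : (fun n : nat => - n.+1%:R^-1 : R) @ \oo --> (0 : R) by rewrite -oppr0; exact: cvgN.
have hle (n : nat) c : unit_shift c -> unit_shift ((n.+1%:R^-1 : R) *: c).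
  have hn : `|n.+1%:R^-1 : R| <= 1.
    by rewrite ger0_norm ?invr_ge0// invf_le1// ler1n.
  by move=> [c1 c2]; split; rewrite /= normrM mulr_ile1.
have [W [C [mW Woo C0 _ WD]]] := exists_box.
have Wout v x : lipschitz_ext D N v -> ~ W x -> v x = 0.
  move=> ev nW; rewrite (ext_out ev)//; have := WD x 0 _ nW.
  by rewrite !addr0 -surjective_pairing; apply; split; rewrite normr0.
have cvg_case (v v' : R * R -> R) c c' (s : nat -> R) : lipschitz_ext D N v -> lipschitz_ext D N v' ->
    (forall n, unit_shift (s n *: c)) -> (forall n, unit_shift (s n *: c')) ->
    s @ \oo --> 0 -> (forall n, s n != 0) ->
    (\int[area]_x (dquot v c (s n) x * dquot v' c' (s n) x)) @[n --> \oo] -->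
    \int[area]_(x in D) ('D_c v x * 'D_c' v' x).
  move=> ev ev' uc uc' s0 sn0.
  have [M M0 vM] := dquot_bounded c ev; have [M' M0' vM'] := dquot_bounded c' ev'.
  (* The difference quotients live on the whole plane; off [N] the derivatives of an extension
     vanish outside [D], so nothing is added. *)
  have -> : \int[area]_(x in D) ('D_c v x * 'D_c' v' x) =
      \int[area]_(x in ~` N) ('D_c v x * 'D_c' v' x).
    rewrite (@Rintegral_setD_null _ plane R area D N)// Rintegral_mkcond [RHS]Rintegral_mkcond.
    apply: eq_Rintegral => x _; rewrite !patchE in_setD in_setC.
    have [xN|xN] := boolP (x \in N); first by rewrite andbF.
    rewrite andbT; case: ifPn => //; rewrite notin_setE => nDx.
    by move: xN; rewrite notin_setE => nNx; rewrite (derive_ext_out c ev nDx nNx) mul0r.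
  apply: (@Rintegral_cvg_bounded _ N W _ _ (M * M')) => //.
  - by move=> n; apply: measurable_funM; [exact: measurable_dquot ev|exact: measurable_dquot ev'].
  - by move=> n x; rewrite normrM ler_pM.
  - by move=> n x nW; rewrite /dquot (Wout _ _ ev nW) (ext_out ev) ?subr0 ?mul0r//; exact: WD.
  - by move=> x nNx; apply: cvgM; [exact: dquot_cvg ev _ _ _|exact: dquot_cvg ev' _ _ _].
have := cvg_case u w e e' _ eu ew (fun n => hle n e ue) (fun n => hle n e' ue') h0 (@harmonic_neq0 R).
have hleN (n : nat) c : unit_shift c -> unit_shift ((- n.+1%:R^-1 : R) *: c).
  by move=> /(hle n)/unit_shiftN; rewrite scaleNr.
have h0N' (n : nat) : - n.+1%:R^-1 != 0 :> R by rewrite oppr_eq0 harmonic_neq0.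
have cvg2 := cvg_case u w e' e _ eu ew (fun n => hleN n e' ue') (fun n => hleN n e ue) h0N h0N'.
move=> cvg1.
rewrite -(cvg_lim (@Rhausdorff R) cvg1) -(cvg_lim (@Rhausdorff R) cvg2).
congr (lim (_ @ \oo)); apply/funext => n.
by apply: Rintegral_dquot_swap => //; exact: hle.
Qed.

(* Discrete form of int x1 d1(u^2) = - int u^2: the left-hand side vanishes with d1 u. *)
Lemma ext_eq0 u : lipschitz_ext D N u ->
  {ae area, forall x, D x -> ~ N x -> 'D_((1 : R), (0 : R)) u x = 0} ->
  forall x, u x = 0.
Proof.
move=> eu [N2 [mN2 N20 N2P]]; pose e : R * R := (1, 0).
pose N' := N `|` N2.
have mN' : measurable N' by exact: measurableU.
have N'0 : area N' = 0%E by rewrite null_set_setU.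
have d0 x : ~ N' x -> 'D_e u x = 0.
  move=> nN'; have nNx : ~ N x by move=> Nx; apply: nN'; left.
  have [Dx|nDx] := pselect (D x); last exact: (derive_ext_out e eu).
  have nN2 : ~ N2 x by move=> ?; apply: nN'; right.
  by have := contra_not (N2P x) nN2 => /contrapT/(_ Dx nNx).
have [W [C [mW Woo C0 WC WD]]] := exists_box.
have [M M0 uM] := ext_bounded eu; have [M' M0' duM] := dquot_bounded e eu.
have u0 : unit_shift 0 by split; rewrite normr0.
have Wout (x : plane) : ~ W x -> u x = 0.
  move=> nW; rewrite (ext_out eu)//; have := WD x 0 u0 nW.
  by rewrite !addr0 -surjective_pairing.
have mu : measurable_fun setT (u : plane -> R) := continuous_measurable_plane (ext_continuous eu).
have mfst : measurable_fun setT (fun x : plane => x.1 : R) by exact: measurable_fst.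
pose h (n : nat) : R := n.+1%:R^-1.
have hcvg : h @ \oo --> (0 : R) by exact: cvg_harmonic.
have hn0 n : h n != 0 by exact: harmonic_neq0.
have uh n : unit_shift (h n *: e).
  split; rewrite /e /=; last by rewrite scaler0 normr0 ler01.
  by rewrite /GRing.scale/= mulr1 ger0_norm ?invr_ge0// invf_le1// ler1n.
have uhN n : unit_shift (- (h n *: e)) by exact: unit_shiftN.
(* This is [x.1] times the difference quotient of the square of [u], factored as a difference of
   squares so that the quotient of [u] itself appears. *)
pose f n (x : plane) := x.1 * (dquot u e (h n) x * (sh u (h n *: e) x + u x)).
have cvg0 : (\int[area]_x f n x) @[n --> \oo] --> \int[area]_(x in ~` N') (cst 0 x : R).
  apply: (@Rintegral_cvg_bounded _ N' W f (cst 0) (C * (M' * (M + M)))) => //.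
  - move=> n; apply: measurable_funM => //; apply: measurable_funM; first exact: measurable_dquot eu.
    by apply: measurable_funD => //; exact: ext_measurable_shift eu.
  - move=> n x; have [Wx|nWx] := pselect (W x).
      rewrite /f normrM ler_pM ?WC// normrM ler_pM//.
      by rewrite (le_trans (ler_normD _ _))// lerD.
    rewrite /f (Wout _ nWx) (ext_out eu (WD _ _ (uh n) nWx)) addr0 !mulr0 normr0.
    by rewrite !mulr_ge0// addr_ge0.
  - by move=> n x nWx; rewrite /f (Wout _ nWx) (ext_out eu (WD _ _ (uh n) nWx)) addr0 !mulr0.
  - move=> x nN'; have nNx : ~ N x by move=> Nx; apply: nN'; left.
    have -> : cst 0 x = x.1 * ('D_e u x * (u x + u x)) by rewrite d0// mul0r mulr0.
    apply: cvgM; first exact: cvg_cst.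
    apply: cvgM; first exact: (dquot_cvg eu nNx hcvg hn0).
    have -> : (fun n => sh u (h n *: e) x + u x) = (fun n => dquot u e (h n) x * h n + u x + u x).
      apply/funext => n; by rewrite /dquot divfK// subrK.
    rewrite -[X in _ --> X + _]add0r -(mulr0 ('D_e u x)).
    apply: cvgD; last exact: cvg_cst.
    apply: cvgD; last exact: cvg_cst.
    by apply: cvgM => //; exact: (dquot_cvg eu nNx hcvg hn0).
have i_u2 : area.-integrable setT (EFin \o (fun x => u x * u x)).
  apply: (@integrable_supported W _ (M * M)) => //.
  - exact: measurable_funM.
  - by move=> x; rewrite normrM ler_pM.
  - by move=> x nW; rewrite Wout// mul0r.
have i_xu2 a : unit_shift a -> area.-integrable setT (EFin \o (fun x => x.1 * (sh u a x * sh u a x))).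
  move=> ua; have WaD x : ~ W x -> sh u a x = 0 by move=> nW; rewrite (ext_out eu)//; exact: WD.
  apply: (@integrable_supported W _ (C * (M * M))) => //.
  - by apply: measurable_funM => //; apply: measurable_funM; exact: ext_measurable_shift eu.
  - move=> x; have [Wx|nWx] := pselect (W x); first by rewrite normrM ler_pM ?WC// normrM ler_pM.
    by rewrite WaD// !mulr0 normr0 !mulr_ge0.
  - by move=> x nW; rewrite WaD// !mulr0.
have i_xu20 : area.-integrable setT (EFin \o (fun x => x.1 * (u x * u x))).
  have := i_xu2 0 u0; congr (area.-integrable setT (EFin \o _)).
  by apply/funext => x; rewrite !addr0 -!surjective_pairing.
have fE n : \int[area]_x f n x = - \int[area]_x (u x * u x).
  have hn := hn0 n.
  transitivity (\int[area]_x ((h n)^-1 * (x.1 * (sh u (h n *: e) x * sh u (h n *: e) x)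
      - x.1 * (u x * u x)))).
    by apply: eq_Rintegral => x _; rewrite /f /dquot; ring.
  rewrite RintegralZl//; last by apply: RintegrableB => //; exact: i_xu2.
  rewrite RintegralB//; last exact: i_xu2.
  (* Translating back turns the shifted square into [u x * u x] and the weight [x.1] into
     [x.1 - h n]; what survives the subtraction is the integral of the square times [- h n]. *)
  have -> : \int[area]_x (x.1 * (sh u (h n *: e) x * sh u (h n *: e) x)) =
      \int[area]_x (x.1 * (u x * u x) - h n * (u x * u x)).
    rewrite /Rintegral; congr fine.
    rewrite -(@integral_shift R (- (h n *: e))); last first.
      apply/measurable_EFinP; apply: measurable_funM => //.
      by apply: measurable_funM; exact: ext_measurable_shift eu.
    apply: eq_integral => x _; rewrite /shift_plane/= !subrK -surjective_pairing.
    by rewrite /e /GRing.scale/= mulr1; congr EFin; ring.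
  rewrite RintegralB//; last exact: RintegrableZ.
  rewrite RintegralZl//; by field.
have u2 : \int[area]_x (u x * u x) = 0.
  apply: oppr_inj; rewrite oppr0.
  rewrite (lim_const_seq fE cvg0).
  by rewrite /Rintegral integral0.
have : ae_eq area setT (fun x => (u x * u x)%:E) (cst 0%E).
  apply/(ae_eq_integral_abs area measurableT); first by apply/measurable_EFinP; exact: measurable_funM.
  rewrite -(fineK (integrable_fin_num measurableT (integrable_abse i_u2))).
  congr EFin; rewrite -[RHS]u2 /Rintegral; congr fine.
  by apply: eq_integral => x _; rewrite /= ger0_norm// -expr2 sqr_ge0.
move=> [N3 [mN3 N30 N3P]].
(* By continuity [U] is open; being contained in a null set, it must be empty. *)
pose U : set plane := [set x | u x != 0].
have oU : open (U : set (R * R)).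
  apply: (@open_comp _ _ u [set y | y != 0]); last exact: open_neq.
  by move=> x _; exact: (ext_continuous eu).
move=> x; apply/eqP/negPn/negP => ux.
have : (0 < area U)%E by apply: area_open_gt0 => //; exists x.
apply/negP; rewrite -leNgt -N30.
apply: le_measure; rewrite ?inE//; first exact: open_measurable_plane.
by move=> y /= uy; apply: N3P => /(_ I)[] /eqP; rewrite mulf_eq0 orbb; exact/negP.
Qed.

End integral_identities.

(** * Legendre polynomials and the stochastic Galerkin matrices *)

Section legendre_orthogonality.
Variable R : realType.
Implicit Types p q : {poly R}.

Local Notation w n := ((('X^2 - 1) ^+ n) : {poly R}).

(** Each differentiation consumes at most one factor [r]. *)
Lemma dvdp_derivn_exp (r : {poly R}) (n j : nat) : (j <= n)%N -> (r ^+ (n - j)) %| (r ^+ n)^`(j).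
Proof.
elim: j => [|j IH] jn; first by rewrite subn0 derivn0.
have /dvdpP[s es] := IH (ltnW jn).
rewrite derivnS es (_ : (n - j = (n - j.+1).+1)%N); last by rewrite -subSS subSn.
rewrite derivM dvdp_add//; first by rewrite dvdp_mull// exprS dvdp_mull.
by rewrite deriv_exp/= dvdp_mull// -mulrnAl dvdp_mull.
Qed.

Lemma legendre_kernel_root (n j : nat) (x : R) : (j < n)%N -> x ^+ 2 = 1 -> (w n)^`(j).[x] = 0.
Proof.
move=> jn x1; have /dvdpP[s ->] := dvdp_derivn_exp ('X^2 - 1) (ltnW jn).
by rewrite hornerM horner_exp !hornerE x1 subrr expr0n subn_eq0 leqNgt jn mulr0.
Qed.

(* J is the expectation for the uniform law on [-1, 1]; only its value on derivatives
   matters. *)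
Variable J : {poly R} -> R.
Hypotheses (JD : forall p q, J (p + q) = J p + J q) (JZ : forall a p, J (a *: p) = a * J p)
  (J_deriv : forall p, J p^`() = (p.[1] - p.[-1]) / 2).

Lemma J_parts p q : p.[1] * q.[1] = 0 -> p.[-1] * q.[-1] = 0 -> J (p^`() * q) = - J (p * q^`()).
Proof.
move=> h1 hN1; apply/eqP; rewrite -addr_eq0 -JD -derivM J_deriv !hornerM h1 hN1.
by rewrite subrr mul0r.
Qed.

(** Integration by parts [n] times: the boundary terms vanish since the kernel has roots of
    multiplicity [n] at 1 and -1, and each step contributes a sign. *)
Lemma J_legendre_kernel n q : J ((w n)^`(n) * q) = (-1) ^+ n * J (w n * q^`(n)).
Proof.
suff H j : (j <= n)%N -> J ((w n)^`(n) * q) = (-1) ^+ j * J ((w n)^`(n - j) * q^`(j)).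
  by rewrite (H n)// subnn derivn0.
elim: j => [|j IH] jn; first by rewrite expr0 mul1r subn0.
rewrite IH; last exact: ltnW.
rewrite (_ : (n - j = (n - j.+1).+1)%N); last by rewrite -subSS subSn.
have := @J_parts (w n)^`(n - j.+1) q^`(j); rewrite -!derivnS [(-1) ^+ j.+1]exprS mulN1r mulNr => ->.
- by rewrite mulrN.
- by rewrite legendre_kernel_root ?mul0r ?expr1n//; lia.
- by rewrite legendre_kernel_root ?mul0r ?sqrrN ?expr1n//; lia.
Qed.

Lemma size_legendre_kernel n : size (w n) = n.*2.+1 /\ w n \is monic.
Proof.
have s3 : size ('X^2 - 1 : {poly R}) = 3%N by rewrite size_XnsubC.
have m : ('X^2 - 1 : {poly R}) \is monic by rewrite monicXnsubC.
have mw := monic_exp n m; split=> //.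
have := size_exp ('X^2 - 1 : {poly R}) n; rewrite s3 /= mul2n => <-.
by rewrite prednK// size_poly_gt0 monic_neq0.
Qed.

Lemma derivn_legendre_kernel n : (w n)^`(n.*2) = (n.*2)`!%:R%:P.
Proof.
have [sw mw] := size_legendre_kernel n.
apply/polyP => i; rewrite coef_derivn coefC; case: i => [|i]; last first.
  by rewrite nth_default ?mul0rn// sw addnS ltnS leq_addr.
rewrite addn0 ffactnn; move/monicP: mw; rewrite /lead_coef sw/= => ->; by [].
Qed.

(** Moving all [n] derivatives onto the other factor kills it, its degree [m] being smaller than
    [n]. *)
Lemma legendre_orth_lt m n : (m < n)%N -> J (legendre R m * legendre R n) = 0.
Proof.
move=> mn; rewrite /legendre -scalerAl -scalerAr !JZ mulrC [_ * (w n)^`(n)]mulrC J_legendre_kernel.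
rewrite /derivn -iterD -/(derivn _ _) derivn_poly0 ?mulr0.
  by rewrite (_ : J 0 = 0) ?(mulr0, mul0r)// -(scale0r 0) JZ mul0r.
have [-> _] := size_legendre_kernel m; lia.
Qed.

Definition wallis n := J ((1 - 'X^2) ^+ n).

(** Integrate the constant 1, written as the derivative of ['X], by parts against the power [n.+1];
    the factor ['X^2] that appears is rewritten as [1 - (1 - 'X^2)] to return to powers of the same
    base. *)
Lemma wallisS n : (2 * n + 3)%:R * wallis n.+1 = (2 * n + 2)%:R * wallis n.
Proof.
have parts : J (('X)^`() * (1 - 'X^2) ^+ n.+1) = - J ('X * ((1 - 'X^2) ^+ n.+1)^`()).
  by apply: J_parts; rewrite horner_exp !hornerE ?sqrrN ?expr1n subrr expr0n ?mulr0.
move: parts; rewrite derivX mul1r -/(wallis _) => parts.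
have e : 'X * ((1 - 'X^2) ^+ n.+1)^`() =
    (- (2 * n + 2)%:R) *: ((1 - 'X^2) ^+ n) + (2 * n + 2)%:R *: ((1 - 'X^2) ^+ n.+1) :> {poly R}.
  have eS : (1 - 'X^2) ^+ n.+1 = (1 - 'X^2) * (1 - 'X^2) ^+ n :> {poly R} by rewrite exprS.
  rewrite deriv_exp/= derivB derivXn derivC sub0r eS; set P := (1 - 'X^2) ^+ n.
  rewrite -!mul_polyC polyCN !polyC_natr [2.-1]/= expr1.
  ring.
have {parts} : wallis n.+1 = (2 * n + 2)%:R * wallis n - (2 * n + 2)%:R * wallis n.+1.
  by rewrite {1}parts e JD !JZ /wallis; ring.
move=> h; rewrite (_ : (2 * n + 3 = (2 * n + 2).+1)%N); last by lia.
by rewrite -natr1 mulrDl mul1r {2}h addrC subrK.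
Qed.

Lemma wallisE n : J 1 = 1 -> wallis n * ((2 * n).+1)`!%:R = (2 ^+ n * n`!%:R) ^+ 2.
Proof.
move=> J1; elim: n => [|n IH]; first by rewrite /wallis expr0 J1 muln0 fact0 !mul1r expr1n.
have f1 : ((2 * n.+1).+1)`! = ((2 * n + 3) * ((2 * n + 2) * ((2 * n).+1)`!))%N.
  rewrite (_ : (2 * n.+1 = (2 * n).+2)%N); last by lia.
  by rewrite factS factS; congr (_ * (_ * _))%N; lia.
have f2 : n.+1`!%:R = (n + 1)%:R * n`!%:R :> R by rewrite factS natrM addn1.
have e2 : (2 ^+ n.+1 * n.+1`!%:R) ^+ 2 = (2 * n + 2)%:R ^+ 2 * (2 ^+ n * n`!%:R) ^+ 2 :> R.
  by rewrite f2 [2 ^+ n.+1]exprS; set a := 2 ^+ n; ring.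
by rewrite f1 e2 -IH !natrM mulrA [wallis _ * _]mulrC wallisS; ring.
Qed.

(** With the kernel's own derivative as second factor, [J_legendre_kernel] leaves the constant
    [(2n)!] times the mean of the kernel. The sign turns the kernel into the power of [1 - 'X^2],
    and the Wallis value cancels the normalisation in Rodrigues' formula. *)
Lemma legendre_norm n : J 1 = 1 -> J (legendre R n * legendre R n) = (2 * n + 1)%:R^-1.
Proof.
move=> J1; rewrite /legendre -scalerAl -scalerAr !JZ J_legendre_kernel.
rewrite /derivn -iterD -/(derivn _ _) addnn derivn_legendre_kernel.
have wE : (-1) ^+ n * J (w n * (n.*2)`!%:R%:P) = (n.*2)`!%:R * wallis n.
  rewrite [X in J X]mulrC mul_polyC JZ mulrCA; congr (_ * _).
  rewrite -JZ /wallis; congr J.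
  by rewrite -[1 - 'X^2]opprB [RHS]exprNn -[LHS]mul_polyC polyC_exp polyCN polyC1.
have f0 : (2 ^+ n * n`!%:R : R) != 0 by rewrite mulf_neq0 ?expf_neq0// pnatr_eq0 -?lt0n ?fact_gt0.
have n0 : (2 * n + 1)%:R != 0 :> R by rewrite pnatr_eq0 addn1.
have := wallisE n J1; rewrite factS natrM -addn1 -mul2n => wn.
rewrite -mul2n in wE; rewrite wE.
apply: (mulIf n0); rewrite mulVf//.
transitivity ((2 ^+ n * n`!%:R) ^- 2 * (wallis n * ((2 * n + 1)%:R * (2 * n)`!%:R))).
  by rewrite -exprVn; ring.
by rewrite wn mulVf// expf_neq0.
Qed.

Lemma legendre_orthonormal m n : J 1 = 1 ->
  J (legendre R m * legendre R n) = (m == n)%:R / (2 * n + 1)%:R.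
Proof.
move=> J1; have [mn|nm|->] := ltngtP m n.
- by rewrite legendre_orth_lt// mul0r.
- by rewrite mulrC legendre_orth_lt// mul0r.
- by rewrite legendre_norm// mul1r.
Qed.

End legendre_orthogonality.

(** * Expectations under the product uniform law *)

Section product_integral.
Context d1 d2 (T1 : measurableType d1) (T2 : measurableType d2) (R : realType).
Variables (m1 : {sigma_finite_measure set T1 -> \bar R}).
Variables (m2 : {sigma_finite_measure set T2 -> \bar R}).
Variables (f : T1 -> R) (g : T2 -> R).
Hypotheses (intf : m1.-integrable setT (EFin \o f)) (intg : m2.-integrable setT (EFin \o g)).

Let mf : measurable_fun setT f. Proof. by apply/measurable_EFinP; exact: measurable_int intf. Qed.
Let mg : measurable_fun setT g. Proof. by apply/measurable_EFinP; exact: measurable_int intg. Qed.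

Lemma integrable_prodM :
  (m1 \x m2)%E.-integrable setT (EFin \o (fun z => f z.1 * g z.2)).
Proof.
apply/integrable12ltyP.
  apply/measurable_EFinP; apply: measurable_funM.
    exact: (measurableT_comp mf measurable_fst).
  exact: (measurableT_comp mg measurable_snd).
have Ig : (\int[m2]_y `|(g y)%:E| < +oo)%E by have /integrableP[] := intg.
have If : (\int[m1]_y `|(f y)%:E| < +oo)%E by have /integrableP[] := intf.
have Ig0 : (\int[m2]_y `|(g y)%:E|)%E \is a fin_num by rewrite ge0_fin_numE// integral_ge0.
under eq_integral => x _.
  under eq_integral => y _ do rewrite /= normrM EFinM.
  rewrite ge0_integralZl//; last by apply/measurable_EFinP; apply: measurableT_comp.
  over.
rewrite ge0_integralZr//; last 2 first.
- by apply/measurable_EFinP; apply: measurableT_comp.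
- exact: integral_ge0.
apply: lte_mul_pinfty; [exact: integral_ge0| |exact: Ig].
by rewrite ge0_fin_numE; [exact: If|exact: integral_ge0].
Qed.

Lemma Rintegral_prodM :
  Rintegral (m1 \x m2)%E setT (fun z => f z.1 * g z.2) =
  (\int[m1]_x f x) * (\int[m2]_y g y).
Proof.
rewrite /Rintegral -integral12_prod_meas1; last exact: integrable_prodM.
have fg : (\int[m2]_y (g y)%:E)%E \is a fin_num by exact: integrable_fin_num.
have ff : (\int[m1]_y (f y)%:E)%E \is a fin_num by exact: integrable_fin_num.
rewrite /fubini_F/=.
under eq_integral => x _.
  under eq_integral => y _ do rewrite /= EFinM.
  rewrite integralZl// -(fineK fg).
  over.
by rewrite integralZr// -fineM// fineK.
Qed.

End product_integral.

Section uniform_sqrt3.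
Variable R : realType.
Local Notation s3 := (Num.sqrt 3 : R).
Local Notation unif := (uniform_prob (Nsqrt3_lt_sqrt3 R)).

Lemma sqrt3_gt0 : 0 < s3. Proof. by rewrite sqrtr_gt0. Qed.

Lemma uniform_integral (f : R -> R) : continuous f ->
  unif.-integrable setT (EFin \o f : measurableTypeR R -> \bar R) /\
  Rintegral unif setT (f : measurableTypeR R -> R) =
  (s3 - - s3)^-1 * \int[lebesgue_measure]_(x in `[(- s3), s3]) f x.
Proof.
move=> cf.
have mf : measurable_fun setT (f : measurableTypeR R -> R) by exact: continuous_measurable_fun.
have intf : lebesgue_measure.-integrable `[(- s3), s3] (EFin \o f).
  apply: continuous_compact_integrable; first exact: segment_compact.
  exact: continuous_subspaceT.
have c0 : 0 <= (s3 - - s3)^-1 by rewrite invr_ge0 opprK addr_ge0// ltW// sqrt3_gt0.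
split.
  apply/integrableP; split; first exact/measurable_EFinP.
  rewrite integral_uniform//; last by apply/measurable_EFinP; exact: measurableT_comp.
  have /integrableP[_ foo] := intf.
  by apply: lte_mul_pinfty.
rewrite /Rintegral integralE.
have mfE : measurable_fun setT (EFin \o f : measurableTypeR R -> \bar R) by exact/measurable_EFinP.
rewrite integral_uniform//; last exact: measurable_funepos.
rewrite integral_uniform//; last exact: measurable_funeneg.
pose S : set R := `[(- s3), s3]%classic.
have fp : (\int[lebesgue_measure]_(x in S) (EFin \o f)^\+ x)%E \is a fin_num.
  apply: integrable_fin_num; first exact: measurable_itv.
  by apply: integrable_funepos; first exact: measurable_itv.
have fn : (\int[lebesgue_measure]_(x in S) (EFin \o f)^\- x)%E \is a fin_num.
  apply: integrable_fin_num; first exact: measurable_itv.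
  by apply: integrable_funeneg; first exact: measurable_itv.
rewrite -muleBr//; last exact: fin_num_adde_defr.
by rewrite fineM//; [rewrite -integralE|rewrite fin_numB fp].
Qed.

Lemma uniform_integral_deriv (p : {poly R}) :
  \int[lebesgue_measure]_(x in `[(- s3), s3]) (p^`()).[x] = p.[s3] - p.[- s3].
Proof.
rewrite /Rintegral (@continuous_FTC2 _ _ (horner p)) -?EFinB//.
- by rewrite gtrN// sqrt3_gt0.
- by apply: continuous_subspaceT; exact: continuous_horner.
- split.
  + by move=> x _; exact: derivable_horner.
  + by apply: cvg_at_right_filter; exact: continuous_horner.
  + by apply: cvg_at_left_filter; exact: continuous_horner.
- by move=> x _; rewrite derivE.
Qed.

(** An instance of the functional [J]: dividing by the square root of 3 carries the uniform law to
    the one on [-1, 1], where the Legendre computation takes place. *)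
Definition scaled_expectation (p : {poly R}) : R :=
  Rintegral unif setT (fun t : measurableTypeR R => p.[t / s3]).

Lemma continuous_horner_scaled (p : {poly R}) : continuous (fun t : R => p.[t / s3]).
Proof.
have cs : continuous (fun t : R => t / s3).
  by move=> t; apply: cvgM; [exact: cvg_id|exact: cvg_cst].
move=> t; exact: (@continuous_comp R R R (fun t => t / s3) (horner p) t (cs t) (@continuous_horner R p _)).
Qed.

Lemma integrable_horner_scaled (p : {poly R}) :
  unif.-integrable setT (EFin \o (fun t : measurableTypeR R => p.[t / s3])).
Proof. by have [] := uniform_integral (@continuous_horner_scaled p). Qed.

Lemma scaled_expectationD p q :
  scaled_expectation (p + q) = scaled_expectation p + scaled_expectation q.
Proof.
rewrite /scaled_expectation -RintegralD//; try exact: integrable_horner_scaled.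
by apply: eq_Rintegral => x _; rewrite hornerD.
Qed.

Lemma scaled_expectationZ a p : scaled_expectation (a *: p) = a * scaled_expectation p.
Proof.
rewrite /scaled_expectation -RintegralZl//; last exact: integrable_horner_scaled.
by apply: eq_Rintegral => x _; rewrite hornerZ.
Qed.

Lemma scaled_expectation_deriv p : scaled_expectation p^`() = (p.[1] - p.[-1]) / 2.
Proof.
have s0 : s3 != 0 by rewrite gt_eqF// sqrt3_gt0.
rewrite /scaled_expectation (uniform_integral (@continuous_horner_scaled _)).2.
(* By the chain rule the integrand is the derivative of [s3] times the rescaled [p]; this factor
   [s3] cancels against the interval length [2 * s3], leaving the 2 of the statement. *)
have -> : (fun x : R => (p^`()).[x / s3]) = (fun x => ((s3 *: (p \Po (s3^-1 *: 'X)))^`()).[x]).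
  apply/funext => x; rewrite derivZ deriv_comp derivZ derivX hornerZ hornerM horner_comp !hornerZ hornerX -polyC1 hornerC.
  by rewrite mulr1 (mulrC x) mulrCA divff ?mulr1.
rewrite uniform_integral_deriv !hornerZ !horner_comp !hornerZ !hornerX mulrN mulVf// opprK.
by field; rewrite gt_eqF// addr_gt0// sqrt3_gt0.
Qed.

Lemma scaled_expectation1 : scaled_expectation 1 = 1.
Proof.
have /= := scaled_expectation_deriv 'X; rewrite derivX !hornerX => ->.
by rewrite opprK divff.
Qed.

Lemma legendre_normalized_integrable i j :
  unif.-integrable setT (EFin \o (fun t : measurableTypeR R =>
    legendre_normalized i t * legendre_normalized j t)).
Proof.
have := integrable_horner_scaled ((Num.sqrt (2 * i + 1)%N%:R * Num.sqrt (2 * j + 1)%N%:R) *: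
   (legendre R i * legendre R j)).
congr (_.-integrable setT (EFin \o _)); apply/funext => t.
by rewrite /legendre_normalized hornerZ hornerM; ring.
Qed.

Lemma legendre_normalized_mean_integrable i j :
  unif.-integrable setT (EFin \o (fun t : measurableTypeR R =>
    t * (legendre_normalized i t * legendre_normalized j t))).
Proof.
have s0 : s3 != 0 by rewrite gt_eqF// sqrt3_gt0.
have := integrable_horner_scaled ((Num.sqrt (2 * i + 1)%N%:R * Num.sqrt (2 * j + 1)%N%:R * s3) *:
   ('X * (legendre R i * legendre R j))).
congr (_.-integrable setT (EFin \o _)); apply/funext => t.
by rewrite /legendre_normalized hornerZ !hornerM hornerX; field.
Qed.

Lemma legendre_normalized_orthonormal i j :
  Rintegral unif setT (fun t : measurableTypeR R =>
    legendre_normalized i t * legendre_normalized j t) = (i == j)%:R.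
Proof.
transitivity (scaled_expectation ((Num.sqrt (2 * i + 1)%N%:R * Num.sqrt (2 * j + 1)%N%:R) *:
   (legendre R i * legendre R j))).
  by apply: eq_Rintegral => t _; rewrite /legendre_normalized [RHS]hornerZ hornerM; ring.
rewrite scaled_expectationZ (legendre_orthonormal scaled_expectationD scaled_expectationZ
  scaled_expectation_deriv)//; last exact: scaled_expectation1.
have [->|] := eqVneq i j; last by rewrite mul0r mulr0.
by rewrite -expr2 sqr_sqrtr ?ler0n// mul1r divff// pnatr_eq0 addn1.
Qed.

End uniform_sqrt3.

Section uniform_law.
Variable R : realType.
Local Notation s3 := (Num.sqrt 3 : R).
Local Notation unif := (uniform_prob (Nsqrt3_lt_sqrt3 R)).
Local Notation tpl n := (n.-tuple (measurableTypeR R)).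

(** Every expectation needed below reduces to products of one-variable functions: products of
    Legendre tensors, the same times a coordinate, and the indicator of a coordinate leaving the
    interval. *)
Lemma uniform_law_prod M (f : 'I_M -> measurableTypeR R -> R) :
  (forall m, unif.-integrable setT (EFin \o f m)) ->
  (uniform_law R M).-integrable setT (EFin \o (fun y : tpl M => \prod_m f m (tnth y m))) /\
  Rintegral (uniform_law R M) setT (fun y : tpl M => \prod_m f m (tnth y m)) =
  \prod_m Rintegral unif setT (f m).
Proof.
elim: M f => [|n IH] f intf.
  have e : (fun y : tpl 0 => \prod_m f m (tnth y m)) = cst 1.
    by apply/funext => y; rewrite big_ord0.
  rewrite e big_ord0; split.
    by apply: (@integrable_bounded_fun _ _ _ _ _ _ 1) => //=; rewrite ?normr1// probability_setT ltry.
  by rewrite Rintegral_cst// mul1r; exact: (congr1 fine (probability_setT (uniform_law R 0))).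
have [iF eF] := IH (fun m => f (lift ord0 m)) (fun m => intf _).
pose g (y : tpl n) := \prod_m f (lift ord0 m) (tnth y m).
have ip := integrable_prodM (intf ord0) iF.
have ep := Rintegral_prodM (intf ord0) iF.
pose F (y : tpl n.+1) := \prod_m f m (tnth y m).
have Fcons : F \o @cons_pair R n = (fun z => f ord0 z.1 * g z.2).
  apply/funext => -[x y]; rewrite /F /= big_ord_recl /=; congr (_ * _).
  by apply: eq_bigr => m _; rewrite tnthS.
have mF : measurable_fun setT (EFin \o F).
  apply/measurable_EFinP.
  apply: measurable_prod => m _.
  have mfm : measurable_fun setT (f m) by apply/measurable_EFinP; exact: measurable_int (intf m).
  apply: (measurableT_comp mfm); exact: measurable_tnth.
have mc := @measurable_cons_pair R n.
have iFc : (unif \x uniform_law R n)%E.-integrable (@cons_pair R n @^-1` setT) ((EFin \o F) \o @cons_pair R n).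
  rewrite preimage_setT; apply: eq_integrable ip => // z _ /=.
  by rewrite -[RHS]/(((F \o @cons_pair R n) z)%:E) Fcons.
split; first exact: (integrable_pushforward mc mF iFc measurableT).
have -> : Rintegral (uniform_law R n.+1) setT F =
    Rintegral (unif \x uniform_law R n)%E setT (fun z => f ord0 z.1 * g z.2).
  congr fine; have := integral_pushforward mc mF iFc measurableT.
  move=> /= ->; rewrite preimage_setT; apply: eq_integral => z _ /=.
  by rewrite -[LHS]/(((F \o @cons_pair R n) z)%:E) Fcons.
by rewrite ep eF big_ord_recl.
Qed.

Lemma unif_gt_sqrt3 : unif [set t | s3 < `|t|] = 0%E.
Proof.
rewrite /uniform_prob integral_uniform_pdf (_ : _ `&` _ = set0) ?integral_set0//.
rewrite -subset0 => t [/=]; rewrite in_itv/= -ler_norml ltNge => /negP.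
exact.
Qed.

Lemma measurable_gt_sqrt3 : measurable ([set t | s3 < `|t|] : set (measurableTypeR R)).
Proof.
rewrite (_ : [set t | _] = (fun t : R => `|t|) @^-1` `]s3, +oo[).
  have mn : measurable_fun setT (fun t : R => `|t|).
    by apply: continuous_measurable_fun; exact: norm_continuous.
  by rewrite -[X in measurable X]setTI; apply: mn => //; exact: measurable_itv.
by apply/seteqP; split => t /=; rewrite in_itv/= andbT.
Qed.

(** The law is a measure on all tuples, so the bound on a coordinate holds only almost surely. The
    indicator of [N] is a product with all other factors equal to 1. *)
Lemma uniform_law_bounded M (m : 'I_M) (N := [set y : tpl M | s3 < `|tnth y m|]) :
  measurable N /\ uniform_law R M N = 0%E.
Proof.
have mN : measurable N.
  have := @measurable_tnth _ (measurableTypeR R) M m measurableT _ measurable_gt_sqrt3.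
  by rewrite setTI.
split=> //.
pose f (i : 'I_M) (t : measurableTypeR R) : R := if i == m then \1_[set t : R | s3 < `|t|] t else 1.
have intf i : unif.-integrable setT (EFin \o f i).
  rewrite /f; case: eqP => _.
    apply: (@integrable_bounded_fun _ _ _ _ _ _ 1) => //=; first by rewrite probability_setT ltry.
      by apply: measurable_indic; exact: measurable_gt_sqrt3.
    by move=> t _; rewrite indicE; case: (_ \in _); rewrite ?normr0 ?normr1.
  by apply: (@integrable_bounded_fun _ _ _ _ _ _ 1) => //=; rewrite ?normr1// probability_setT ltry.
have [_ e] := uniform_law_prod intf.
have : Rintegral (uniform_law R M) setT (\1_N) = 0.
  transitivity (Rintegral (uniform_law R M) setT (fun y : tpl M => \prod_i f i (tnth y i))).
    apply: eq_Rintegral => y _; rewrite (bigD1 m)//= big1 ?mulr1 => [|i im]; last by rewrite /f (negbTE im).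
    by rewrite /f eqxx !indicE; congr (_%:R); apply/idP/idP; rewrite !inE.
  have i0 : Rintegral unif setT (\1_[set t : R | s3 < `|t|] : measurableTypeR R -> R) = 0.
    rewrite /Rintegral integral_indic// ?setIT; last exact: measurable_gt_sqrt3.
    exact: (congr1 fine unif_gt_sqrt3).
  by rewrite e (bigD1 m)//= /f eqxx [X in X * _]i0 mul0r.
rewrite /Rintegral integral_indic// setIT => h.
rewrite -(fineK (fin_num_measure (uniform_law R M) _ mN)).
by rewrite h.
Qed.

Variables (M k : nat) (al : 'I_('C(M + k, k)) -> M.-tuple 'I_k.+1).
Hypothesis al_inj : injective al.
Local Notation law := (uniform_law R M).
Local Notation Q := 'C(M + k, k).

Lemma legendre_tensor_orthonormal a b :
  law.-integrable setT (EFin \o (fun y : tpl M => legendre_tensor (al a) y * legendre_tensor (al b) y)) /\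
  Rintegral law setT (fun y : tpl M => legendre_tensor (al a) y * legendre_tensor (al b) y) = (a == b)%:R.
Proof.
have := @uniform_law_prod M (fun m t => legendre_normalized (tnth (al a) m) t *
  legendre_normalized (tnth (al b) m) t) (fun m => legendre_normalized_integrable _ _ _).
rewrite (_ : (fun y : tpl M => \prod_m _) = (fun y : tpl M => legendre_tensor (al a) y * legendre_tensor (al b) y)); last first.
  by apply/funext => y; rewrite /legendre_tensor -big_split.
move=> [i ->]; split=> //.
under eq_bigr do rewrite legendre_normalized_orthonormal.
have [->|ab] := eqVneq a b; first by rewrite big1// => m _; rewrite eqxx.
have [m mP] : exists m, tnth (al a) m != tnth (al b) m.
  apply/existsP; rewrite -negb_forall; apply: contra ab => /forallP H.
  by apply/eqP/al_inj/eq_from_tnth => m; apply/eqP.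
by rewrite (bigD1 m)//= (_ : (_ == _) = false) ?mul0r//; apply/negbTE.
Qed.

Lemma legendre_tensor_mean_integrable m a b :
  law.-integrable setT (EFin \o (fun y : tpl M => tnth y m * legendre_tensor (al a) y * legendre_tensor (al b) y)).
Proof.
have intf i : unif.-integrable setT (EFin \o (fun t : measurableTypeR R => (if i == m then t else 1) *
   (legendre_normalized (tnth (al a) i) t * legendre_normalized (tnth (al b) i) t))).
  case: eqP => _; first exact: legendre_normalized_mean_integrable.
  rewrite (_ : (fun t => _) = (fun t => legendre_normalized (tnth (al a) i) t * legendre_normalized (tnth (al b) i) t)).
    exact: legendre_normalized_integrable.
  by apply/funext => t; rewrite mul1r.
have [+ _] := uniform_law_prod intf.
congr (_.-integrable setT (EFin \o _)); apply/funext => y.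
rewrite big_split/= big_split/= mulrA; congr (_ * _ * _).
by rewrite (bigD1 m)//= eqxx big1 ?mulr1// => i /negbTE ->.
Qed.

Lemma galerkin_mx_sym m a b : galerkin_mx R al m a b = galerkin_mx R al m b a.
Proof. by rewrite !mxE; apply: eq_Rintegral => y _; rewrite mulrAC. Qed.

Lemma galerkin_mx_bound m (z : 'I_Q -> R) :
  `|\sum_a \sum_b galerkin_mx R al m a b * (z a * z b)| <= s3 * \sum_a z a ^+ 2.
Proof.
(* The polynomial with coefficients [z]: the forms of the identity and of the Galerkin matrix at [z]
   are the expectations of its square and of [tnth y m] times its square. *)
pose S (y : tpl M) := \sum_a z a * legendre_tensor (al a) y.
have S2 y : S y ^+ 2 = \sum_a \sum_b z a * z b * (legendre_tensor (al a) y * legendre_tensor (al b) y).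
  rewrite expr2 /S mulr_suml; apply: eq_bigr => a _; rewrite mulr_sumr.
  by apply: eq_bigr => b _; rewrite mulrACA.
have yS2 (y : tpl M) : tnth y m * S y ^+ 2 =
   \sum_a \sum_b z a * z b * (tnth y m * legendre_tensor (al a) y * legendre_tensor (al b) y).
  rewrite S2 mulr_sumr; apply: eq_bigr => a _; rewrite mulr_sumr.
  by apply: eq_bigr => b _; ring.
have int2 (F : 'I_Q -> 'I_Q -> tpl M -> R) : (forall a b, law.-integrable setT (EFin \o F a b)) ->
    law.-integrable setT (EFin \o (fun y => \sum_a \sum_b z a * z b * F a b y)) /\
    Rintegral law setT (fun y => \sum_a \sum_b z a * z b * F a b y) =
    \sum_a \sum_b z a * z b * Rintegral law setT (F a b).
  move=> iF.
  have iab a b : law.-integrable setT (EFin \o (fun y => z a * z b * F a b y)) by exact: RintegrableZ.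
  have [i1 e1] := @Rintegrable_sum _ _ _ law setT measurableT _ (index_enum _)
    (fun a y => \sum_b z a * z b * F a b y)
    (fun a => (@Rintegrable_sum _ _ _ law setT measurableT _ _ _ (iab a)).1).
  split=> //; rewrite e1; apply: eq_bigr => a _.
  rewrite (@Rintegrable_sum _ _ _ law setT measurableT _ _ _ (iab a)).2.
  by apply: eq_bigr => b _; rewrite RintegralZl.
have [iS eS] := int2 _ (fun a b => (legendre_tensor_orthonormal a b).1).
have [iy ey] := int2 _ (fun a b => legendre_tensor_mean_integrable m a b).
have eS' : Rintegral law setT (fun y => S y ^+ 2) = \sum_a z a ^+ 2.
  under eq_Rintegral do rewrite S2.
  rewrite eS; apply: eq_bigr => a _; rewrite (bigD1 a)//= big1 ?addr0 => [|b ba].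
    by rewrite (legendre_tensor_orthonormal a a).2 eqxx mulr1.
  by rewrite (legendre_tensor_orthonormal a b).2 eq_sym (negbTE ba) mulr0.
have ey' : Rintegral law setT (fun y : tpl M => tnth y m * S y ^+ 2) =
    \sum_a \sum_b galerkin_mx R al m a b * (z a * z b).
  under eq_Rintegral do rewrite yS2.
  rewrite ey; apply: eq_bigr => a _; apply: eq_bigr => b _.
  by rewrite mxE mulrC.
have iS' : law.-integrable setT (EFin \o (fun y => S y ^+ 2)).
  by move: iS; congr (_.-integrable setT (EFin \o _)); apply/funext => y; rewrite S2.
have iy' : law.-integrable setT (EFin \o (fun y : tpl M => tnth y m * S y ^+ 2)).
  by move: iy; congr (_.-integrable setT (EFin \o _)); apply/funext => y; rewrite yS2.
have [mN N0] := uniform_law_bounded m.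
rewrite -ey' -eS' -RintegralZl// ler_norml -subr_ge0 opprK -[X in _ && X]subr_ge0.
have iZ := RintegrableZ measurableT s3 iS'.
rewrite -RintegralD// -RintegralB//.
(* Off the null set [N] the two integrands are the square of [S] times [s3 + tnth y m] and
   [s3 - tnth y m], both nonnegative. *)
apply/andP; split; rewrite (Rintegral_setD_null _ _ mN N0); apply: Rintegral_ge0 => y [_ /=] /negP.
  rewrite -leNgt ler_norml => /andP[h1 h2]; rewrite -mulrDl mulr_ge0 ?sqr_ge0//; lra.
rewrite -leNgt ler_norml => /andP[h1 h2]; rewrite -mulrBl mulr_ge0 ?sqr_ge0//; lra.
Qed.

End uniform_law.

(** * Bounds on the Schur complement *)

Section bounded_measurable.
Context d (T : measurableType d) (R : realType).
Variables (mu : {measure set T -> \bar R}) (D : set T).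
Hypotheses (mD : measurable D) (Doo : (mu D < +oo)%E).
Implicit Types f g : T -> R.

(** On a set of finite measure this class consists of integrable functions and, unlike
    integrability, is stable under products, so the integrability of all integrands is checked by
    closure rules. *)
Definition bounded_measurable f :=
  measurable_fun D f /\ exists B, forall x, D x -> `|f x| <= B.
Local Notation bm := bounded_measurable.

Lemma bm_integrable f : bm f -> mu.-integrable D (EFin \o f).
Proof. by move=> [mf [B fB]]; exact: integrable_bounded_fun fB. Qed.

Lemma bm_cst c : bm (fun=> c).
Proof. by split; [exact: measurable_cst|exists `|c|]. Qed.

Lemma bmD f g : bm f -> bm g -> bm (fun x => f x + g x).
Proof.
move=> [mf [B fB]] [mg [C gC]]; split; first exact: measurable_funD.
by exists (B + C) => x Dx; rewrite (le_trans (ler_normD _ _))// lerD ?fB ?gC.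
Qed.

Lemma bmM f g : bm f -> bm g -> bm (fun x => f x * g x).
Proof.
move=> [mf [B fB]] [mg [C gC]]; split; first exact: measurable_funM.
by exists (B * C) => x Dx; rewrite normrM ler_pM ?fB ?gC.
Qed.

Lemma bmZ c f : bm f -> bm (fun x => c * f x).
Proof. exact: bmM (bm_cst c). Qed.

Lemma bmB f g : bm f -> bm g -> bm (fun x => f x - g x).
Proof.
move=> bf /(bmZ (-1)) bg; rewrite (_ : (fun x => _) = (fun x => f x + -1 * g x)); first exact: bmD.
by apply/funext => x; rewrite mulN1r.
Qed.

Lemma bm_sum (I : Type) (s : seq I) (F : I -> T -> R) :
  (forall i, bm (F i)) -> bm (fun x => \sum_(i <- s) F i x).
Proof.
move=> bF; elim: s => [|i s IH].
  by rewrite (_ : (fun x => _) = (fun=> 0)); [exact: bm_cst|apply/funext => x; rewrite big_nil].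
rewrite (_ : (fun x => _) = (fun x => F i x + \sum_(i <- s) F i x)); first exact: bmD.
by apply/funext => x; rewrite big_cons.
Qed.

Lemma Rintegral_bm_sum (I : Type) (s : seq I) (F : I -> T -> R) : (forall i, bm (F i)) ->
  \int[mu]_(x in D) (\sum_(i <- s) F i x) = \sum_(i <- s) \int[mu]_(x in D) F i x.
Proof. by move=> bF; apply: (Rintegrable_sum mD _ _).2 => i; exact: bm_integrable. Qed.

Lemma Rintegral_bilinear m n (f : 'I_m -> T -> R) (g : 'I_n -> T -> R) (x : 'I_m -> R) (y : 'I_n -> R) :
  (forall i, bm (f i)) -> (forall j, bm (g j)) ->
  \int[mu]_(z in D) ((\sum_i x i * f i z) * (\sum_j y j * g j z)) =
  \sum_i \sum_j x i * y j * \int[mu]_(z in D) (f i z * g j z).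
Proof.
move=> bf bg.
under eq_Rintegral do rewrite big_distrlr/=.
rewrite Rintegral_bm_sum => [|i]; last first.
  by apply: bm_sum => j; apply: bmM; exact: bmZ.
apply: eq_bigr => i _.
rewrite Rintegral_bm_sum => [|j]; last by apply: bmM; exact: bmZ.
apply: eq_bigr => j _.
rewrite -RintegralZl//; last by apply/bm_integrable/bmM.
by apply: eq_Rintegral => z _; rewrite mulrACA.
Qed.

End bounded_measurable.

Section tensor_forms.
Variable R : realType.

Lemma big_mxtens (Q n : nat) (F : 'I_(Q * n) -> R) :
  \sum_i F i = \sum_a \sum_j F (mxtens_index (a, j)).
Proof.
rewrite pair_bigA/= (reindex (@mxtens_index Q n))/=; first by apply: eq_bigr => -[].
by exists (@mxtens_unindex Q n) => ? _; rewrite (mxtens_indexK, mxtens_unindexK).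
Qed.

Lemma bilinear_entries m n (A : 'M[R]_(m, n)) (v : 'cV[R]_m) (w : 'cV[R]_n) :
  (v^T *m A *m w) 0 0 = \sum_i \sum_j A i j * (v i 0 * w j 0).
Proof.
rewrite mxE [RHS]exchange_big/=; apply: eq_bigr => j _.
by rewrite mxE mulr_suml; apply: eq_bigr => i _; rewrite mxE; ring.
Qed.

Lemma bilinear_tens Q m n (K : 'M[R]_Q) (X : 'M[R]_(m, n)) (v : 'cV[R]_(Q * m)) (w : 'cV[R]_(Q * n)) :
  (v^T *m (K *t X) *m w) 0 0 = \sum_a \sum_b K a b *
    \sum_i \sum_j X i j * (v (mxtens_index (a, i)) 0 * w (mxtens_index (b, j)) 0).
Proof.
rewrite bilinear_entries big_mxtens; apply: eq_bigr => a _.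
under eq_bigr do rewrite big_mxtens.
rewrite exchange_big/=; apply: eq_bigr => b _.
rewrite mulr_sumr; apply: eq_bigr => i _; rewrite mulr_sumr; apply: eq_bigr => j _.
by rewrite tensmxE -mulrA.
Qed.

Lemma bilinear_tens1 Q m n (X : 'M[R]_(m, n)) (v : 'cV[R]_(Q * m)) (w : 'cV[R]_(Q * n)) :
  (v^T *m ((1%:M : 'M[R]_Q) *t X) *m w) 0 0 = \sum_a
    \sum_i \sum_j X i j * (v (mxtens_index (a, i)) 0 * w (mxtens_index (a, j)) 0).
Proof.
rewrite bilinear_tens; apply: eq_bigr => a _.
rewrite (bigD1 a)//= mxE eqxx mul1r [X in _ + X]big1 ?addr0// => b ba.
by rewrite mxE eq_sym (negbTE ba) mul0r.
Qed.

End tensor_forms.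

(** * Schur complement bounds over an abstract measure space *)

Section spectral_bounds.
Context d (T : measurableType d) (R : realType).
Variables (mu : {measure set T -> \bar R}) (D : set T).
Hypotheses (mD : measurable D) (Doo : (mu D < +oo)%E).
Local Notation bm := (bounded_measurable D).
Variables (Np Nu Q M : nat).
(* [der 0 j], ..., [der 3 j] stand for d1 v1, d2 v1, d1 v2, d2 v2 where v = phi_j;
   hence the divergence is [der 0 j + der 3 j]. *)
Variables (der : 'I_4 -> 'I_Nu -> T -> R) (psi : 'I_Np -> T -> R).
Variables (nu0 : T -> R) (nus : 'I_M -> T -> R) (G : 'I_M -> 'M[R]_Q).
Variables (lo hi s : R) (c : 'I_M -> R).
Hypotheses (bm_der : forall i j, bm (der i j)) (bm_psi : forall i, bm (psi i)).
Hypotheses (bm_nu0 : bm nu0) (bm_nus : forall m, bm (nus m)).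
Hypothesis nu0_bound : forall x, D x -> lo <= nu0 x <= hi.
Hypothesis nus_bound : forall m x, D x -> `|nus m x| <= c m.
Hypothesis G_sym : forall m a b, G m a b = G m b a.
Hypothesis G_bound : forall m (z : 'I_Q -> R),
  `|\sum_a \sum_b G m a b * (z a * z b)| <= s * \sum_a z a ^+ 2.

Let divf j x := der 0 j x + der 3 j x.
Let stiff (nu : T -> R) : 'M[R]_Nu :=
  \matrix_(j, l) \int[mu]_(x in D) (nu x * \sum_i der i j x * der i l x).
Let B : 'M[R]_(Np, Nu) := \matrix_(i, j) - \int[mu]_(x in D) (psi i x * divf j x).
Let mass : 'M[R]_Np := \matrix_(i, j) \int[mu]_(x in D) (psi i x * psi j x).
Let calA : 'M[R]_(Q * Nu) := (1%:M : 'M[R]_Q) *t stiff nu0 + \sum_m G m *t stiff (nus m).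
Let calB : 'M[R]_(Q * Np, Q * Nu) := (1%:M : 'M[R]_Q) *t B.

(* The coefficient function, in the a-th stochastic direction, of the Galerkin
   function with coordinates v. *)
Definition fe_sum n (f : 'I_n -> T -> R) (v : 'cV[R]_(Q * n)) (a : 'I_Q) (x : T) : R :=
  \sum_j v (mxtens_index (a, j)) 0 * f j x.

Definition energy (v : 'cV[R]_(Q * Nu)) : R :=
  \sum_a \int[mu]_(x in D) (\sum_i fe_sum (der i) v a x ^+ 2).

(** These two hypotheses are where the integral identities for finite element functions enter; they
    are discharged by [div_le_energy_fem] and [energy_eq0_fem]. *)
Hypothesis div_le_energy : forall v : 'cV[R]_(Q * Nu),
  \sum_a \int[mu]_(x in D) (fe_sum divf v a x ^+ 2) <= energy v.
Hypothesis energy_eq0 : forall v : 'cV[R]_(Q * Nu), energy v = 0 -> v = 0.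

Let al := lo - s * \sum_m c m.
Let be := hi + s * \sum_m c m.
Hypothesis al_gt0 : 0 < al.

Lemma bm_fe_sum n (f : 'I_n -> T -> R) v a : (forall j, bm (f j)) -> bm (fe_sum f v a).
Proof. by move=> bf; apply: bm_sum => j; exact: bmZ. Qed.

(** Brings the whole Kronecker form under one integral. At each point [x] the stochastic matrix [K]
    then acts on the vector of values indexed by [a], so that bounds on [K] and on [nu] combine
    pointwise. *)
Lemma quad_tens_stiff (K : 'M[R]_Q) (nu : T -> R) (v : 'cV[R]_(Q * Nu)) : bm nu ->
  quad_form (K *t stiff nu) v =
  \int[mu]_(x in D) (nu x * \sum_i \sum_a \sum_b K a b * (fe_sum (der i) v a x * fe_sum (der i) v b x)).
Proof.
move=> bnu; have bf i a := bm_fe_sum v a (bm_der i).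
transitivity (\sum_i \sum_a \sum_b K a b *
    \int[mu]_(x in D) (nu x * (fe_sum (der i) v a x * fe_sum (der i) v b x))).
  rewrite /quad_form bilinear_tens.
  rewrite [RHS]exchange_big/=; apply: eq_bigr => a _.
  rewrite [RHS]exchange_big/=; apply: eq_bigr => b _.
  rewrite -mulr_sumr; congr (_ * _).
  under [RHS]eq_bigr => i _.
    rewrite (@eq_Rintegral _ _ _ mu D (fun x => (\sum_j v (mxtens_index (a, j)) 0 * (nu x * der i j x)) *
        (\sum_l v (mxtens_index (b, l)) 0 * der i l x))); last first.
      move=> x _; rewrite mulrA; congr (_ * _); rewrite /fe_sum mulr_sumr.
      by apply: eq_bigr => j _; rewrite mulrCA.
    rewrite (Rintegral_bilinear mD Doo) => //; last by move=> j; exact: bmM.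
    over.
  rewrite [RHS]exchange_big/=; apply: eq_bigr => j _.
  rewrite [RHS]exchange_big/=; apply: eq_bigr => l _.
  rewrite -mulr_sumr mxE mulrC; congr (_ * _).
  under eq_Rintegral do rewrite mulr_sumr.
  rewrite (Rintegral_bm_sum mD Doo) => [|i]; last by apply: bmM => //; exact: bmM.
  by apply: eq_bigr => i _; apply: eq_Rintegral => x _; rewrite mulrA.
rewrite [RHS](@eq_Rintegral _ _ _ mu D (fun x => \sum_i \sum_a \sum_b K a b *
    (nu x * (fe_sum (der i) v a x * fe_sum (der i) v b x)))); last first.
  move=> x _; rewrite mulr_sumr; apply: eq_bigr => i _; rewrite mulr_sumr; apply: eq_bigr => a _.
  by rewrite mulr_sumr; apply: eq_bigr => b _; rewrite mulrCA.
rewrite (Rintegral_bm_sum mD Doo) => [|i]; last first.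
  by do 2 apply: bm_sum => ?; apply: bmZ; apply: bmM => //; exact: bmM.
apply: eq_bigr => i _.
rewrite (Rintegral_bm_sum mD Doo) => [|a]; last first.
  by apply: bm_sum => ?; apply: bmZ; apply: bmM => //; exact: bmM.
apply: eq_bigr => a _.
rewrite (Rintegral_bm_sum mD Doo) => [|b]; last by apply: bmZ; apply: bmM => //; exact: bmM.
by apply: eq_bigr => b _; rewrite RintegralZl//; apply/bm_integrable => //; apply: bmM => //; exact: bmM.
Qed.

Lemma quad_formD n (X Y : 'M[R]_n) v : quad_form (X + Y) v = quad_form X v + quad_form Y v.
Proof. by rewrite /quad_form mulmxDr mulmxDl mxE. Qed.

Lemma quad_form_sum n (I : Type) (r : seq I) (F : I -> 'M[R]_n) v :
  quad_form (\sum_(i <- r) F i) v = \sum_(i <- r) quad_form (F i) v.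
Proof.
elim: r => [|i r IH]; last by rewrite !big_cons quad_formD IH.
by rewrite !big_nil /quad_form mulmx0 mul0mx mxE.
Qed.

Lemma energyE v : energy v = \int[mu]_(x in D) (\sum_i \sum_a fe_sum (der i) v a x ^+ 2).
Proof.
have bf i a := bm_fe_sum v a (bm_der i).
rewrite /energy -(Rintegral_bm_sum mD Doo) => [|a]; last first.
  by apply: bm_sum => i; apply: bmM.
by apply: eq_Rintegral => x _; rewrite exchange_big.
Qed.

Lemma energy_ge0 v : 0 <= energy v.
Proof.
apply: sumr_ge0 => a _; apply: Rintegral_ge0 => x _.
by apply: sumr_ge0 => i _; exact: sqr_ge0.
Qed.

Lemma quad_calA_bounds v : al * energy v <= quad_form calA v <= be * energy v.
Proof.
have bf i a := bm_fe_sum v a (bm_der i).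
pose H x := \sum_i \sum_a fe_sum (der i) v a x ^+ 2.
have H0 x : 0 <= H x by do 2 apply: sumr_ge0 => ? _; exact: sqr_ge0.
have bH : bm H by do 2 apply: bm_sum => ?; apply: bmM.
have iH k : mu.-integrable D (EFin \o (fun x => k * H x)) by apply/bm_integrable => //; exact: bmZ.
have kH k : k * energy v = \int[mu]_(x in D) (k * H x).
  by rewrite energyE RintegralZl//; exact: bm_integrable.
have b0 : bm (fun x => nu0 x * H x) by exact: bmM.
have q0 : quad_form ((1%:M : 'M[R]_Q) *t stiff nu0) v = \int[mu]_(x in D) (nu0 x * H x).
  rewrite quad_tens_stiff//; apply: eq_Rintegral => x _; congr (_ * _).
  apply: eq_bigr => i _; apply: eq_bigr => a _.
  rewrite (bigD1 a)//= mxE eqxx mul1r [X in _ + X]big1 ?addr0// => b ba.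
  by rewrite mxE eq_sym (negbTE ba) mul0r.
have q0_bounds : lo * energy v <= quad_form ((1%:M : 'M[R]_Q) *t stiff nu0) v <= hi * energy v.
  rewrite q0 !kH; apply/andP; split; apply: le_Rintegral => //; try exact: bm_integrable.
    by move=> x Dx; rewrite ler_wpM2r//; have /andP[] := nu0_bound Dx.
  by move=> x Dx; rewrite ler_wpM2r//; have /andP[] := nu0_bound Dx.
have qm_bounds m : - (s * c m) * energy v <= quad_form (G m *t stiff (nus m)) v <= (s * c m) * energy v.
  pose K x := nus m x * \sum_i \sum_a \sum_b G m a b * (fe_sum (der i) v a x * fe_sum (der i) v b x).
  have bK : bm K.
    apply: bmM => //; do 3 apply: bm_sum => ?; apply: bmZ; exact: bmM.
  (* For each derivative [i], [G_bound] is applied to the vector of values at the fixed point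
     [x]. *)
  have KH x : D x -> `|K x| <= s * c m * H x.
    move=> Dx; rewrite /K normrM mulrAC mulrC ler_pM ?nus_bound//.
    rewrite /H mulr_sumr (le_trans (ler_norm_sum _ _ _))//.
    by apply: ler_sum => i _; exact: G_bound.
  rewrite quad_tens_stiff// !kH; apply/andP; split; apply: le_Rintegral => //; try exact: bm_integrable.
    by move=> x /KH; rewrite mulNr ler_norml => /andP[].
  by move=> x /KH; rewrite ler_norml => /andP[].
rewrite quad_formD quad_form_sum /al /be mulrBl mulrDl -mulrA mulr_suml mulr_sumr -sumrN.
have /andP[l0 h0] := q0_bounds.
apply/andP; split; apply: lerD => //; apply: ler_sum => m _; have /andP[] := qm_bounds m.
  by rewrite mulrA mulNr.
by rewrite mulrA.
Qed.

Lemma stiff_sym nu : (stiff nu)^T = stiff nu.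
Proof.
apply/matrixP => j l; rewrite !mxE; apply: eq_Rintegral => x _; congr (_ * _).
by apply: eq_bigr => i _; rewrite mulrC.
Qed.

Lemma calA_sym : calA^T = calA.
Proof.
rewrite /calA linearD/= trmx_tens trmx1 stiff_sym; congr (_ + _).
rewrite linear_sum/=; apply: eq_bigr => m _; rewrite trmx_tens stiff_sym; congr (_ *t _).
by apply/matrixP => a b; rewrite mxE G_sym.
Qed.

(** A vector in the kernel has zero energy by the lower spectral bound. Invertibility matters
    because [invmx] returns its argument unchanged on singular matrices. *)
Lemma calA_unit : calA \in unitmx.
Proof.
rewrite -row_free_unit -kermx_eq0; apply/eqP/row_matrixP => i; rewrite row0.
set u := row i _.
have uA : u *m calA = 0 by apply/sub_kermxP; exact: row_sub.
have : energy u^T = 0.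
  apply/eqP; rewrite eq_le energy_ge0 andbT -(pmulr_rle0 _ al_gt0).
  have /andP[+ _] := quad_calA_bounds u^T; move/le_trans; apply.
  by rewrite /quad_form trmxK uA mul0mx mxE.
by move/energy_eq0 => /(congr1 trmx); rewrite trmxK trmx0.
Qed.

Variable q : 'cV[R]_(Q * Np).
Let X := quad_form (calB *m invmx calA *m calB^T) q.
Let l (v : 'cV[R]_(Q * Nu)) : R := (q^T *m calB *m v) 0 0.
Let w := invmx calA *m (calB^T *m q).

Lemma mx11_tr (Y : 'M[R]_1) : Y 0 0 = Y^T 0 0.
Proof. by rewrite mxE. Qed.

(** [w] is the velocity solving the Galerkin system with load given by [q], that is, the
    representative of [l] in the inner product of [calA]. *)
Lemma pairing_calA v : (v^T *m calA *m w) 0 0 = l v.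
Proof.
rewrite /w -[_ *m calA *m _]mulmxA mulKVmx ?calA_unit// /l.
by rewrite mx11_tr !trmx_mul !trmxK.
Qed.

Lemma quad_schurE : X = l w /\ X = quad_form calA w.
Proof.
have e : X = l w by rewrite /X /quad_form /l /w !mulmxA.
by split=> //; rewrite e -pairing_calA.
Qed.

(* This is 0 <= (w - v)^T calA (w - v). *)
Lemma schur_lower v : 2 * l v - be * energy v <= X.
Proof.
have [_ XA] := quad_schurE.
have /andP[h _] := quad_calA_bounds (w - v).
have : 0 <= quad_form calA (w - v) by apply: le_trans h; rewrite mulr_ge0 ?energy_ge0// ltW.
rewrite /quad_form; have -> : (w - v)^T = w^T - v^T by rewrite linearB.
rewrite mulmxBl mulmxBl !mulmxBr.
have e3 : (w^T *m calA *m v) 0 0 = l v.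
  by rewrite -pairing_calA [RHS]mx11_tr !trmx_mul !trmxK calA_sym mulmxA.
have /andP[_ hv] := quad_calA_bounds v.
have e4 := pairing_calA v; rewrite /quad_form in XA hv.
move=> h'; have {h'} : 0 <= X - l v - (l v - (v^T *m calA *m v) 0 0).
  by move: h'; rewrite XA -{1}e3 -e4 !mxE.
lra.
Qed.

Lemma pairing_div v : l v = - \sum_a \int[mu]_(x in D) (fe_sum psi q a x * fe_sum divf v a x).
Proof.
have bdiv j : bm (divf j) by exact: bmD.
rewrite /l /calB bilinear_tens1 -sumrN; apply: eq_bigr => a _.
rewrite (Rintegral_bilinear mD Doo)// -sumrN; apply: eq_bigr => i _.
by rewrite -sumrN; apply: eq_bigr => j _; rewrite mxE mulNr mulrC.
Qed.

Lemma massE : quad_form ((1%:M : 'M[R]_Q) *t mass) q = \sum_a \int[mu]_(x in D) (fe_sum psi q a x ^+ 2).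
Proof.
rewrite /quad_form bilinear_tens1; apply: eq_bigr => a _.
under [RHS]eq_Rintegral do rewrite expr2.
rewrite (Rintegral_bilinear mD Doo)//; apply: eq_bigr => i _; apply: eq_bigr => j _.
by rewrite mxE mulrC.
Qed.

(* Expand 0 <= \int (q_h + al div w_h)^2. *)
Lemma schur_upper : al * X <= quad_form ((1%:M : 'M[R]_Q) *t mass) q.
Proof.
have [Xl XA] := quad_schurE.
have bdiv j : bm (divf j) by exact: bmD.
have bq a := bm_fe_sum q a bm_psi; have bw a := bm_fe_sum w a bdiv.
have : 0 <= \sum_a \int[mu]_(x in D) ((fe_sum psi q a x + al * fe_sum divf w a x) ^+ 2).
  by apply: sumr_ge0 => a _; apply: Rintegral_ge0 => x _; exact: sqr_ge0.
have -> : \sum_a \int[mu]_(x in D) ((fe_sum psi q a x + al * fe_sum divf w a x) ^+ 2) =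
    quad_form ((1%:M : 'M[R]_Q) *t mass) q - 2 * al * X +
    al ^+ 2 * \sum_a \int[mu]_(x in D) (fe_sum divf w a x ^+ 2).
  rewrite massE Xl pairing_div mulrN opprK !mulr_sumr -!big_split/=; apply: eq_bigr => a _.
  rewrite -!RintegralZl -?RintegralD//; try (apply: bm_integrable => //; do ?[exact: bmM|apply: bmD|apply: bmZ]).
  by apply: eq_Rintegral => x _; ring.
have /andP[+ _] := quad_calA_bounds w; rewrite -XA => eX.
have dE := div_le_energy w.
set Dv := \sum_a _ in dE *; set m := quad_form _ q => h.
have : al ^+ 2 * Dv <= al * X.
  by rewrite expr2 -mulrA ler_wpM2l ?(ltW al_gt0)//; apply: le_trans eX; rewrite ler_wpM2l// ltW.
lra.
Qed.

Lemma energyZ t v : energy (t *: v) = t ^+ 2 * energy v.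
Proof.
rewrite /energy mulr_sumr; apply: eq_bigr => a _.
have bE : bm (fun x => \sum_i fe_sum (der i) v a x ^+ 2).
  by apply: bm_sum => i; apply: bmM; exact: bm_fe_sum.
rewrite -(RintegralZl _ mD (bm_integrable mD Doo bE)).
apply: eq_Rintegral => x _; rewrite mulr_sumr; apply: eq_bigr => i _.
rewrite -exprMn; congr (_ ^+ 2); rewrite /fe_sum mulr_sumr; apply: eq_bigr => j _.
by rewrite mxE mulrA.
Qed.

(** [schur_lower] at [t *: v] gives at least [2 * t * g * m - be * t ^+ 2 * m]; the maximum over [t]
    is attained at [g / be] and equals the stated bound. *)
Lemma schur_lower_witness v g m : 0 < be -> 0 <= g -> g * m <= l v -> energy v <= m ->
  g ^+ 2 * m / be <= X.
Proof.
move=> be0 g0 lv ev; apply: le_trans (schur_lower ((g / be) *: v)).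
have -> : l ((g / be) *: v) = g / be * l v by rewrite /l -scalemxAr mxE.
rewrite energyZ.
have -> : g ^+ 2 * m / be = 2 * (g / be * (g * m)) - be * ((g / be) ^+ 2 * m).
  by field; rewrite gt_eqF.
apply: lerB.
  by rewrite ler_wpM2l// ler_wpM2l// divr_ge0// ltW.
by rewrite ler_wpM2l ?(ltW be0)// ler_wpM2l// sqr_ge0.
Qed.

End spectral_bounds.

(** * The Taylor-Hood discretization *)

Section fem.
Variable R : realType.
Local Notation plane := (measurableTypeR R * measurableTypeR R)%type.
Variables (D : set (R * R)) (Np : nat) (p : 'I_Np -> R * R) (T : {set {set 'I_Np}}).
Hypotheses (D_domain : bounded_domain D) (T_mesh : triangulation D p T).
Variable N : set plane.
Hypotheses (mN : measurable N) (N0 : area N = 0%E).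
Hypothesis N_int : forall x, closure D x -> ~ N x -> exists2 K, K \in T & (hull p K)° x.
Local Notation D' := (D `\` N).

Lemma open_D : open D. Proof. by case: D_domain. Qed.
Lemma bounded_D : bounded_set D. Proof. by case: D_domain. Qed.

Lemma measurable_D' : measurable (D' : set plane).
Proof. by apply: measurableD => //; apply: open_measurable_plane; exact: open_D. Qed.

Lemma area_D'_lty : (area (D' : set plane) < +oo)%E.
Proof.
apply: area_bounded_lty; last exact: measurable_D'.
by have [M [Mr DM]] := bounded_D; exists M; split=> // y My x [Dx _]; exact: DM.
Qed.

Lemma lipschitz_ext_sum (n : nat) (U : 'I_n -> R * R -> R) (c : 'I_n -> R) :
  (forall j, lipschitz_ext D N (U j)) ->
  lipschitz_ext D N (fun z => \sum_j c j * U j z) /\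
  forall x e, ~ N x -> 'D_e (fun z => \sum_j c j * U j z) x = \sum_j c j * 'D_e (U j) x.
Proof.
move=> eU; elim: (index_enum _) => [|j s [eS dS]].
  have -> : (fun z => \sum_(j <- [::]) c j * U j z) = cst 0 by apply/funext => z; rewrite big_nil.
  split=> [|x e _]; last by rewrite derive_cst big_nil.
  split => //; first exact: cst_continuous.
  - by exists 0 => // x y; rewrite /= subrr normr0 mul0r.
  - by move=> x _ _; near=> y.
have -> : (fun z => \sum_(j <- j :: s) c j * U j z) = (fun z => c j * U j z) + (fun z => \sum_(j <- s) c j * U j z).
  by apply/funext => z; rewrite big_cons.
have dc x e : ~ N x -> derivable (fun z => c j * U j z) x e.
  by move=> nNx; apply: derivableM; [exact: derivable_cst|exact: (ext_derivable (eU j))].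
split=> [|x e nNx]; last first.
  rewrite deriveD; [|exact: dc|exact: (ext_derivable eS)].
  rewrite dS// big_cons; congr (_ + _).
  by rewrite -[LHS](_ : 'D_e (c j \*: U j) x = _)// deriveZ//; exact: (ext_derivable (eU j)).
split.
- move=> x; apply: cvgD; last exact: (ext_continuous eS).
  by apply: cvgM; [exact: cvg_cst|exact: (ext_continuous (eU j))].
- have [L L0 uL] := ext_lipschitz (eU j); have [L' L0' uL'] := ext_lipschitz eS.
  exists (`|c j| * L + L') => [|x y]; first by rewrite addr_ge0// mulr_ge0.
  rewrite /= opprD addrACA (le_trans (ler_normD _ _))// mulrDl lerD//.
  by rewrite -mulrBr normrM -mulrA ler_wpM2l.
- by move=> x nDx; rewrite -[LHS]/(c j * U j x + _) (ext_out (eU j) nDx) mulr0 add0r (ext_out eS).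
- move=> x nDx nNx; near=> y.
  have U0 : U j y = 0 by near: y; exact: (ext_out_near (eU j)).
  rewrite -[LHS]/(c j * U j y + _) U0 mulr0 add0r.
  by near: y; exact: (ext_out_near eS).
- by move=> x e nNx; apply: derivableD; [exact: dc|exact: (ext_derivable eS)].
Unshelve. all: by end_near. Qed.

(** The parity of [i] selects the direction and [i < 2] the velocity component. The derivative is
    taken of the extension by zero, which agrees with the classical one in the open set [D] and
    gives access to translations. *)
Definition dir (i : 'I_4) : R * R := if odd i then (0, 1) else (1, 0).
Definition zcomp (i : 'I_4) (v : R * R -> R * R) : R * R -> R :=
  patch (cst 0) D (fun z => if (i < 2)%N then (v z).1 else (v z).2).
Definition dercomp (i : 'I_4) (v : R * R -> R * R) (x : plane) : R := 'D_(dir i) (zcomp i v) x.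

Lemma ext_comp i v : V0h D p T v -> lipschitz_ext D N (zcomp i v).
Proof.
move=> [v1 v2 v0]; rewrite /zcomp; case: (i < 2)%N.
- by apply: (lipschitz_ext_Pk D_domain T_mesh N_int v1) => x cDx nDx; rewrite v0.
- by apply: (lipschitz_ext_Pk D_domain T_mesh N_int v2) => x cDx nDx; rewrite v0.
Qed.

Lemma comp_near (i : 'I_4) (v : R * R -> R * R) x : D x ->
  \forall z \near x, (if (i < 2)%N then (v z).1 else (v z).2) = zcomp i v z.
Proof.
move=> Dx; have : nbhs x D by apply: open_nbhs_nbhs; split; [exact: open_D|].
by apply: filterS => z Dz; rewrite /zcomp patchE mem_set.
Qed.

Lemma dercompE (i : 'I_4) (v : R * R -> R * R) x : D x ->
  dercomp i v x = 'D_(dir i) (fun z => if (i < 2)%N then (v z).1 else (v z).2) x.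
Proof. by move=> Dx; apply/esym/near_eq_derive; exact: comp_near. Qed.

Lemma grad_dotE v w x : D x -> grad_dot v w x = \sum_i dercomp i v x * dercomp i w x.
Proof.
move=> Dx; under eq_bigr do rewrite !dercompE//.
by rewrite !big_ord_recr big_ord0 /= add0r.
Qed.

Lemma divE v x : D x -> div v x = dercomp 0 v x + dercomp 3 v x.
Proof. by move=> Dx; rewrite !dercompE. Qed.

Lemma bm_ext_derive u e : lipschitz_ext D N u -> bounded_measurable (D' : set plane) ('D_e u).
Proof.
move=> eu; split.
  apply: measurable_funS (measurable_derive_ext e eu); first exact: measurableC.
  by move=> x [].
by have [M M0 uM] := derive_ext_bounded e eu; exists M => x [_ /uM].
Qed.

Lemma bm_dercomp i v : V0h D p T v -> bounded_measurable (D' : set plane) (dercomp i v).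
Proof. by move=> Vv; apply: bm_ext_derive; exact: ext_comp. Qed.

(** Meant for pressures, which need not vanish on the boundary and so have no continuous extension
    by zero: measurability comes from continuity in the open set [D], boundedness from the finitely
    many polynomial pieces. *)
Lemma bm_Pk r f : continuous_Pk D p T r f -> bounded_measurable (D' : set plane) f.
Proof.
move=> [cf pf]; split.
  apply: (@measurable_funS _ _ plane _ D) => //; first by apply: open_measurable_plane; exact: open_D.
  have cD x : D x -> {for x, continuous f}.
    move=> Dx; have := continuous_subspaceW (@subset_closure _ D) cf.
    by rewrite continuous_open_subspace; [apply; rewrite inE|exact: open_D].
  apply: (measurability _ (RGenOpens.measurableE R)) => _ [_ [a [b ->]] <-].
  apply: open_measurable_plane; rewrite openE => x [Dx fx].
  apply: filterI; first by apply: open_nbhs_nbhs; split; [exact: open_D|].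
  by apply: (cD x Dx); apply: open_nbhs_nbhs; split => //; exact: interval_open.
have [B B0 DB] := bounded_set_box bounded_D.
have /choice[M MP] : forall K, exists M, K \in T -> forall x, hull p K x -> D x -> `|f x| <= M.
  move=> K; have [KT|_] := boolP (K \in T); last by exists 0.
  have [c cP] := pf K KT; have [L L0 LP] := polyf_lipschitz B c r.
  exists (`|polyf c r 0| + L * (B + B)) => _ x Kx /DB[x1 x2].
  rewrite (cP x Kx) -[X in `|X|](subrK (polyf c r 0)) addrC (le_trans (ler_normD _ _))// lerD2l.
  have := LP x 0 x1 x2; rewrite normr0 (ltW B0) => /(_ isT isT)/le_trans; apply.
  by rewrite ler_wpM2l// /dist1/= !subr0 lerD.
exists (\sum_K `|M K|) => x [Dx _].
have [_ _ _ _ cDE] := T_mesh; have := subset_closure Dx; rewrite cDE => -[K KT Kx].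
rewrite (le_trans (MP K KT x Kx Dx))// (le_trans (ler_norm _))// (bigD1 K)//= lerDl.
by apply: sumr_ge0.
Qed.

End fem.

Section nonneg_integral.
Context d (T : measurableType d) (R : realType).
Variables (mu : {measure set T -> \bar R}) (D : set T).
Hypotheses (mD : measurable D) (Doo : (mu D < +oo)%E).

Lemma ae_eq0_of_Rintegral_eq0 (f : T -> R) : bounded_measurable D f ->
  (forall x, D x -> 0 <= f x) -> \int[mu]_(x in D) f x = 0 ->
  {ae mu, forall x, D x -> f x = 0}.
Proof.
move=> bf f0 If0.
have intf := bm_integrable mD Doo bf.
have : ae_eq mu D (EFin \o f) (cst 0%E).
  apply/(ae_eq_integral_abs mu mD); first by apply/measurable_EFinP; case: bf.
  rewrite (eq_integral (EFin \o f)) => [|x]; last by rewrite inE => Dx; rewrite /= ger0_norm// f0.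
  by rewrite -(fineK (integrable_fin_num mD intf)); congr EFin.
by apply: filterS => x /[apply] -[].
Qed.

End nonneg_integral.

Lemma ae_imply d (T : measurableType d) (R : realType) (mu : {measure set T -> \bar R})
  (P Q : T -> Prop) : {ae mu, forall x, P x} -> (forall x, P x -> Q x) -> {ae mu, forall x, Q x}.
Proof. by move=> + PQ; apply: filterS. Qed.

Section fem_basis.
Variable R : realType.
Local Notation plane := (measurableTypeR R * measurableTypeR R)%type.
Variables (D : set (R * R)) (Np : nat) (p : 'I_Np -> R * R) (T : {set {set 'I_Np}}).
Hypotheses (D_domain : bounded_domain D) (T_mesh : triangulation D p T).
Variable N : set plane.
Hypotheses (mN : measurable N) (N0 : area N = 0%E).
Hypothesis N_int : forall x, closure D x -> ~ N x -> exists2 K, K \in T & (hull p K)° x.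
Local Notation D' := (D `\` N : set plane).
Variables (Nu : nat) (phi : 'I_Nu -> R * R -> R * R) (phi_basis : V0h_basis D p T phi).
Local Notation der i j := (dercomp D i (phi j)).
Local Notation bm := (bounded_measurable D').

Let mD' : measurable D' := measurable_D' D_domain mN.
Let D'oo : (area D' < +oo)%E := area_D'_lty D_domain mN.

Definition comp_sum (i : 'I_4) (c : 'I_Nu -> R) (z : R * R) : R := \sum_j c j * zcomp D i (phi j) z.

Lemma ext_comp_sum i c : lipschitz_ext D N (comp_sum i c) /\
  forall x e, ~ N x -> 'D_e (comp_sum i c) x = \sum_j c j * 'D_e (zcomp D i (phi j)) x.
Proof.
have [Vphi _ _] := phi_basis.
by apply: lipschitz_ext_sum => // j; exact: (ext_comp D_domain T_mesh N_int).
Qed.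

Lemma der_sumE i c x : ~ N x -> \sum_j c j * der i j x = 'D_(dir R i) (comp_sum i c) x.
Proof. by move=> nNx; rewrite (ext_comp_sum i c).2. Qed.

Lemma comp_sum_if (i : 'I_4) c : comp_sum i c = if (i < 2)%N then comp_sum 0 c else comp_sum 3 c.
Proof.
case: ifP => i2; apply/funext => z; apply: eq_bigr => j _; congr (_ * _).
  by rewrite /zcomp i2.
by rewrite /zcomp i2.
Qed.

Lemma der_sum_ifE (i : 'I_4) c x : ~ N x -> \sum_j c j * der i j x =
  'D_(if odd i then (0, 1) else (1, 0)) (if (i < 2)%N then comp_sum 0 c else comp_sum 3 c) x.
Proof. by move=> nNx; rewrite der_sumE// comp_sum_if. Qed.

Lemma der_sum0E c x : ~ N x -> \sum_j c j * der 0 j x = 'D_((1 : R), (0 : R)) (comp_sum 0 c) x.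
Proof.
by move=> nNx; rewrite der_sum_ifE.
Qed.

Lemma der_sum3E c x : ~ N x -> \sum_j c j * der 3 j x = 'D_((0 : R), (1 : R)) (comp_sum 3 c) x.
Proof.
by move=> nNx; rewrite der_sum_ifE.
Qed.

(* |grad|^2 = div^2 + curl^2 - 2 (d1 u d2 w - d2 u d1 w), and the last term integrates to 0. *)
Lemma Rintegral_div_le c :
  \int[area]_(x in D') ((\sum_j c j * (der 0 j x + der 3 j x)) ^+ 2) <=
  \int[area]_(x in D') (\sum_i (\sum_j c j * der i j x) ^+ 2).
Proof.
have [e0 _] := ext_comp_sum 0 c; have [e3 _] := ext_comp_sum 3 c.
have bD := open_D D_domain; have bb := bounded_D D_domain.
pose u := comp_sum 0 c; pose w := comp_sum 3 c.
pose e1 : R * R := (1, 0); pose e2 : R * R := (0, 1).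
have u1 : unit_shift e1 by split; rewrite /= ?normr1 ?normr0.
have u2 : unit_shift e2 by split; rewrite /= ?normr1 ?normr0.
have swap := Rintegral_derive_swap bb mN N0 e0 e3 u1 u2.
have offN (f : plane -> R) : Rintegral area D f = Rintegral area D' f.
  exact: (@Rintegral_setD_null _ plane R area D N).
have {}swap := etrans (esym (offN _)) (etrans swap (offN _)).
have b11 : bm ('D_e1 u) by exact: bm_ext_derive.
have b12 : bm ('D_e2 u) by exact: bm_ext_derive.
have b21 : bm ('D_e1 w) by exact: bm_ext_derive.
have b22 : bm ('D_e2 w) by exact: bm_ext_derive.
rewrite (@eq_Rintegral _ _ _ area D' (fun x => ('D_e1 u x + 'D_e2 w x) ^+ 2)); last first.
  move=> x; rewrite inE => -[_ nNx]; congr (_ ^+ 2).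
  rewrite (eq_bigr _ (fun j _ => mulrDr _ _ _)) big_split.
  by congr (_ + _); [exact: der_sum0E|exact: der_sum3E].
have -> : \int[area]_(x in D') (\sum_i (\sum_j c j * der i j x) ^+ 2) =
    \int[area]_(x in D') (('D_e1 u x + 'D_e2 w x) ^+ 2 +
   (('D_e2 u x - 'D_e1 w x) ^+ 2 - 2 * ('D_e1 u x * 'D_e2 w x - 'D_e2 u x * 'D_e1 w x))).
  apply: eq_Rintegral => x; rewrite inE => -[_ nNx].
  rewrite (eq_bigr _ (fun i _ => congr1 (fun t => t ^+ 2) (der_sum_ifE i c nNx))).
  rewrite !big_ord_recr big_ord0.
  have key (a b a' b' : R) : 0 + a ^+ 2 + b ^+ 2 + a' ^+ 2 + b' ^+ 2 =
    (a + b') ^+ 2 + ((b - a') ^+ 2 - 2 * (a * b' - b * a')) by ring.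
  exact: (key ('D_e1 u x) ('D_e2 u x) ('D_e1 w x) ('D_e2 w x)).
have bS1 : bm (fun x => ('D_e1 u x + 'D_e2 w x) ^+ 2) by apply: bmM; exact: bmD.
have bS2 : bm (fun x => ('D_e2 u x - 'D_e1 w x) ^+ 2) by apply: bmM; exact: bmB.
have bP : bm (fun x => 'D_e1 u x * 'D_e2 w x) by exact: bmM.
have bP' : bm (fun x => 'D_e2 u x * 'D_e1 w x) by exact: bmM.
have bX : bm (fun x => 'D_e1 u x * 'D_e2 w x - 'D_e2 u x * 'D_e1 w x) by exact: bmB.
have b2X := bmZ 2 bX.
have bY := bmB bS2 b2X.
pose ib f (bf : bm f) := bm_integrable mD' D'oo bf.
rewrite (RintegralD mD' (ib _ bS1) (ib _ bY)) (RintegralB mD' (ib _ bS2) (ib _ b2X)).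
rewrite (RintegralZl 2 mD' (ib _ bX)) (RintegralB mD' (ib _ bP) (ib _ bP')).
have -> : \int[area]_(x in D') ('D_e1 u x * 'D_e2 w x) - \int[area]_(x in D') ('D_e2 u x * 'D_e1 w x) = 0.
  by rewrite [X in X - _]swap subrr.
rewrite mulr0 subr0 lerDl.
by apply: Rintegral_ge0 => x _; exact: sqr_ge0.
Qed.

Lemma bm_der_sum i c : bm (fun x => \sum_j c j * der i j x).
Proof.
have [Vphi _ _] := phi_basis.
by apply: bm_sum => j; apply: bmZ; exact: (bm_dercomp D_domain T_mesh mN N_int).
Qed.

Lemma fst_sum (I : Type) (s : seq I) (F : I -> R * R) : (\sum_(i <- s) F i).1 = \sum_(i <- s) (F i).1.
Proof. exact: (big_morph fst). Qed.

Lemma snd_sum (I : Type) (s : seq I) (F : I -> R * R) : (\sum_(i <- s) F i).2 = \sum_(i <- s) (F i).2.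
Proof. exact: (big_morph snd). Qed.

(** The [x.1]-derivative of each component suffices: by [ext_eq0] its vanishing kills the component,
    and linear independence of the basis does the rest. *)
Lemma energy_eq0_basis (c : 'I_Nu -> R) :
  \int[area]_(x in D') (\sum_i (\sum_j c j * der i j x) ^+ 2) = 0 -> forall j, c j = 0.
Proof.
have [Vphi phi_free _] := phi_basis.
have bD := open_D D_domain; have bb := bounded_D D_domain.
have bS : bm (fun x => \sum_i (\sum_j c j * der i j x) ^+ 2).
  by apply: bm_sum => i; apply: bmM; exact: bm_der_sum.
move=> /(ae_eq0_of_Rintegral_eq0 mD' D'oo bS) ae0.
have {}ae0 : {ae area, forall x, D x -> ~ N x -> forall i, \sum_j c j * der i j x = 0}.
  have sq0 x : 0 <= \sum_i (\sum_j c j * der i j x) ^+ 2 by apply: sumr_ge0 => i _; exact: sqr_ge0.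
  apply: filterS (ae0 _) => [x h Dx nNx i|x _]; last exact: sq0.
  have := h (conj Dx nNx) => /psumr_eq0P h0.
  by apply/eqP; rewrite -sqrf_eq0; apply/eqP; apply: h0 => // k _; exact: sqr_ge0.
have u0 : forall x, comp_sum 0 c x = 0.
  apply: (ext_eq0 bb mN N0 (ext_comp_sum 0 c).1); apply: (ae_imply ae0) => x h Dx nNx.
  by rewrite -(der_sum0E c nNx); exact: h.
have w0 : forall x, comp_sum 3 c x = 0.
  apply: (ext_eq0 bb mN N0 (ext_comp_sum 3 c).1); apply: (ae_imply ae0) => x h Dx nNx.
  (* Index 2 is the [x.1]-derivative of the second component. *)
  exact: (etrans (esym (der_sum_ifE (Ordinal (isT : 2 < 4)%N) c nNx)) (h Dx nNx _)).
apply: phi_free => x cDx; have [Dx|nDx] := pselect (D x); last first.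
  by apply: big1 => j _; have [_ _ ->] := Vphi j; rewrite ?scaler0.
rewrite [LHS]surjective_pairing fst_sum snd_sum; congr pair.
  rewrite -[RHS](u0 x); apply: eq_bigr => j _.
  by rewrite /zcomp patchE mem_set.
rewrite -[RHS](w0 x); apply: eq_bigr => j _.
by rewrite /zcomp patchE mem_set.
Qed.

Lemma dercomp_span v c x : (forall z, closure D z -> v z = \sum_j c j *: phi j z) -> D x -> ~ N x ->
  forall i, dercomp D i v x = \sum_j c j * der i j x.
Proof.
move=> vE Dx nNx i; rewrite der_sumE//.
apply: near_eq_derive; have : nbhs x D by apply: open_nbhs_nbhs; split; [exact: open_D|].
apply: filterS => z Dz; rewrite /zcomp /comp_sum patchE mem_set// (vE z (subset_closure Dz)).
rewrite fst_sum snd_sum.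
by case: ifP => i2; apply: eq_bigr => j _; rewrite /zcomp patchE mem_set// i2.
Qed.

(** The supremum need not be attained, hence a constant [g] strictly below [gamma]. Normalising the
    energy by the squared norm of [qf] lets witnesses for different pressures be added. *)
Lemma inf_sup_witness (gamma g : R) (qf : R * R -> R) :
  gamma%:E = inf_sup_constant D p T -> 0 <= g -> g < gamma ->
  W0h D p T qf -> (exists2 x, D x & qf x != 0) ->
  exists c : 'I_Nu -> R,
    (g * (\int[area]_(x in D') (qf x ^+ 2)) <=
      - (\int[area]_(x in D') (qf x * \sum_j c j * (der 0 j x + der 3 j x)))) /\
    (\int[area]_(x in D') (\sum_i (\sum_j c j * der i j x) ^+ 2) <=
      \int[area]_(x in D') (qf x ^+ 2)).
Proof.
move=> gammaE g0 gg Wq qn0.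
have [_ _ phi_span] := phi_basis.
have offN (f : plane -> R) : Rintegral area D f = Rintegral area D' f.
  exact: (@Rintegral_setD_null _ plane R area D N).
pose S := [set t : \bar R | exists v, [/\ V0h D p T v, exists2 x, D x & v x != 0
   & t = (`|\int[area]_(x in D) (qf x * div v x)| / (L2_norm_grad D v * L2_norm D qf))%:E]].
have : (g%:E < ereal_sup S)%E.
  apply: (@lt_le_trans _ _ gamma%:E); first by rewrite lte_fin.
  by rewrite gammaE; apply: ereal_inf_lbound; exists qf.
move=> /ereal_sup_gt[_ [v [Vv _ ->]]]; rewrite lte_fin.
set I := Rintegral _ _ _; set n := L2_norm_grad D v; set m := L2_norm D qf => gI.
have n0 : 0 <= n by exact: sqrtr_ge0.
have m0 : 0 <= m by exact: sqrtr_ge0.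
(* With a zero denominator the quotient would be 0 and could not exceed the nonnegative [g]; this
   yields positive norms without a Poincare inequality. *)
have nm0 : n * m != 0.
  by apply: contraTneq gI => ->; rewrite invr0 mulr0 -leNgt.
have n_gt0 : 0 < n by rewrite lt_neqAle n0 andbT; apply: contra nm0 => /eqP <-; rewrite mul0r.
have m_gt0 : 0 < m by rewrite lt_neqAle m0 andbT; apply: contra nm0 => /eqP <-; rewrite mulr0.
have [c0 vE] := phi_span v Vv.
have m2 : \int[area]_(x in D') (qf x ^+ 2) = m ^+ 2.
  by rewrite -offN /m /L2_norm sqr_sqrtr//; apply: Rintegral_ge0 => x _; exact: sqr_ge0.
have n2 : \int[area]_(x in D') (\sum_i (\sum_j c0 j * der i j x) ^+ 2) = n ^+ 2.
  rewrite /n /L2_norm_grad sqr_sqrtr; last first.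
    rewrite offN; apply: Rintegral_ge0 => x [Dx _]; rewrite (grad_dotE D_domain)//.
    by apply: sumr_ge0 => i _; exact: sqr_ge0.
  rewrite offN; apply: eq_Rintegral => x; rewrite inE => -[Dx nNx].
  rewrite (grad_dotE D_domain)//; apply: eq_bigr => i _.
  by rewrite (dercomp_span vE Dx nNx) expr2.
have IE : \int[area]_(x in D') (qf x * \sum_j c0 j * (der 0 j x + der 3 j x)) = I.
  rewrite /I offN; apply: eq_Rintegral => x; rewrite inE => -[Dx nNx]; congr (_ * _).
  rewrite (divE D_domain)// (eq_bigr _ (fun j _ => mulrDr _ _ _)) big_split.
  by congr (_ + _); apply/esym; exact: (dercomp_span vE Dx nNx).
(* The factor [m / n] brings the energy to [m ^+ 2], or to 0 when [I] is 0; the sign makes the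
   pairing, which carries the minus of the divergence matrix, equal to [m / n] times the absolute
   value of [I]. *)
pose k : R := - (Num.sg I * (m / n)).
exists (fun j => k * c0 j); rewrite m2.
have bq : bm qf by case: Wq => /(bm_Pk D_domain T_mesh N).
have bd : bm (fun x => \sum_j c0 j * (der 0 j x + der 3 j x)).
  have [Vphi _ _] := phi_basis.
  by apply: bm_sum => j; apply: bmZ; apply: bmD; exact: (bm_dercomp D_domain T_mesh mN N_int).
split.
  have -> : \int[area]_(x in D') (qf x * \sum_j (k * c0 j) * (der 0 j x + der 3 j x)) = k * I.
    rewrite -IE -(RintegralZl k mD' (bm_integrable mD' D'oo (bmM bq bd))).
    apply: eq_Rintegral => x _; rewrite mulrCA; congr (_ * _); rewrite mulr_sumr.
    by apply: eq_bigr => j _; rewrite mulrA.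
  rewrite /k mulNr opprK mulrAC -normrEsg.
  move: gI; rewrite ltr_pdivlMr ?mulr_gt0// => /ltW gI.
  rewrite [leRHS]mulrA ler_pdivlMr//.
  rewrite (_ : g * m ^+ 2 * n = g * (n * m) * m); last by ring.
  by rewrite ler_wpM2r.
have -> : \int[area]_(x in D') (\sum_i (\sum_j (k * c0 j) * der i j x) ^+ 2) = k ^+ 2 * n ^+ 2.
  have bS : bm (fun x => \sum_i (\sum_j c0 j * der i j x) ^+ 2).
    by apply: bm_sum => i; apply: bmM; exact: bm_der_sum.
  rewrite -n2 -(RintegralZl (k ^+ 2) mD' (bm_integrable mD' D'oo bS)).
  apply: eq_Rintegral => x _; rewrite mulr_sumr; apply: eq_bigr => i _.
  rewrite -exprMn; congr (_ ^+ 2); rewrite mulr_sumr.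
  by apply: eq_bigr => j _; rewrite mulrA.
rewrite /k sqrrN !exprMn exprVn -mulrA divfK ?expf_neq0 ?gt_eqF//.
rewrite sqr_sg; case: (I != 0); rewrite ?mul1r// mul0r sqr_ge0//.
Qed.

End fem_basis.

(** * Almost everywhere bounds, limits and the diagonal preconditioner *)

Section essential_bounds.
Context d (T : measurableType d) (R : realType).
Variable mu : {measure set T -> \bar R}.

Lemma ae_ge_ess_inf (D : set T) (f : T -> R) (lo : R) :
  lo%:E = ess_inf mu (patch (cst +oo%E) D (EFin \o f)) ->
  {ae mu, forall x, D x -> lo <= f x}.
Proof.
move=> loE; apply: ae_imply (ess_inf_le mu (patch (cst +oo%E) D (EFin \o f))) _ => x.
by rewrite -loE => + Dx; rewrite /patch mem_set//= lee_fin.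
Qed.

Lemma ae_le_ess_sup (D : set T) (f : T -> R) (hi : R) :
  hi%:E = ess_sup mu (patch (cst -oo%E) D (EFin \o f)) ->
  {ae mu, forall x, D x -> f x <= hi}.
Proof.
move=> hiE; apply: ae_imply (ess_sup_ge mu (patch (cst -oo%E) D (EFin \o f))) _ => x.
by rewrite -hiE => + Dx; rewrite /patch mem_set//= lee_fin.
Qed.

(** The norm of infinite exponent is an essential supremum only for a measure that is not zero,
    whence the first hypothesis. *)
Lemma ae_le_Lnormy (D : set T) (f : T -> R) (c : R) : (0 < mu setT)%E ->
  'N[mu]_(+oo)[EFin \o (f \_ D)]%E = c%:E ->
  {ae mu, forall x, D x -> `|f x| <= c}.
Proof.
move=> mu0; rewrite unlock /Lnorm mu0 => cE.
apply: ae_imply (ess_sup_ge mu (abse \o (EFin \o (f \_ D)))) _ => x.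
by rewrite cE /= patchE => + Dx; rewrite mem_set// lee_fin.
Qed.

Lemma ae_null_set (P : T -> Prop) : {ae mu, forall x, P x} ->
  exists2 N, measurable N /\ mu N = 0%E & forall x, ~ N x -> P x.
Proof.
move=> [N [mN N0 PN]]; exists N => // x nNx.
by apply: contrapT => nPx; apply: nNx; exact: PN.
Qed.

End essential_bounds.

Section series.
Variable R : realType.

Lemma nneseries_fin_terms (t : nat -> \bar R) (S : R) : (forall m, 0 <= t m)%E ->
  S%:E = (\sum_(0 <= m <oo) t m)%E ->
  exists2 c : nat -> R, forall m, t m = (c m)%:E & forall n, \sum_(m < n) c m <= S.
Proof.
move=> t0 SE.
have part n : (\sum_(0 <= m < n) t m <= S%:E)%E.
  by rewrite SE; apply: (nneseries_lim_ge n) => i *; exact: t0.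
have tfin m : t m \is a fin_num.
  rewrite ge0_fin_numE//; apply: (@le_lt_trans _ _ S%:E); last exact: ltry.
  apply: (le_trans _ (part m.+1)); rewrite big_nat_recr//= leeDr//.
  by apply: sume_ge0 => i _; exact: t0.
exists (fun m => fine (t m)) => [m|n]; first by rewrite fineK.
rewrite -lee_fin -sumEFin; apply: le_trans (part n).
rewrite big_mkord; apply: lee_sum => i _; by rewrite fineK.
Qed.

Lemma le_of_lt_family (gam K X : R) : 0 < gam -> 0 <= K ->
  (forall g, 0 <= g -> g < gam -> g ^+ 2 * K <= X) -> gam ^+ 2 * K <= X.
Proof.
move=> gam0 K0 H; apply/ler_addgt0Pr => e e0.
(* Lowering [gam] by [del] costs at most [2 * gam * K * del], which the second entry keeps below
   [e]; the added 1 guards against [K = 0], and the first entry keeps [gam - del] nonnegative. *)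
pose del : R := Num.min (gam / 2) (e / (2 * gam * K + 1)).
have den : 0 < 2 * gam * K + 1 by rewrite ltr_wpDl// !mulr_ge0// ltW.
have del0 : 0 < del by rewrite lt_min !divr_gt0.
have d1 : del <= gam / 2 by rewrite ge_min lexx.
have d2 : del <= e / (2 * gam * K + 1) by rewrite ge_min lexx orbT.
have Hg : (gam - del) ^+ 2 * K <= X by apply: H; lra.
have : del * (2 * gam * K + 1) <= e by rewrite -ler_pdivlMr.
have -> : gam ^+ 2 * K = (gam - del) ^+ 2 * K + (2 * gam * K * del - del ^+ 2 * K) by ring.
have : 0 <= del ^+ 2 * K by rewrite mulr_ge0// sqr_ge0.
move: Hg; lra.
Qed.

End series.

Section block_forms.
Variable R : realType.

Lemma quad_form_block Q n (X : 'M[R]_n) (q : 'cV[R]_(Q * n)) :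
  quad_form ((1%:M : 'M[R]_Q) *t X) q = \sum_a quad_form X (\col_j q (mxtens_index (a, j)) 0).
Proof.
rewrite /quad_form bilinear_tens1; apply: eq_bigr => a _.
rewrite bilinear_entries; apply: eq_bigr => i _; apply: eq_bigr => j _.
by rewrite !mxE.
Qed.

Lemma quad_form_diag n (X : 'M[R]_n) (q : 'cV[R]_n) :
  quad_form (diag_part X) q = \sum_j X j j * q j 0 ^+ 2.
Proof.
rewrite /quad_form /diag_part mul_mx_diag mxE; apply: eq_bigr => j _.
by rewrite !mxE expr2 mulrA [X j j * _]mulrC.
Qed.

Lemma quad_form0 n (X : 'M[R]_n) : quad_form X 0 = 0.
Proof. by rewrite /quad_form mulmx0 mxE. Qed.

Lemma quad_form_delta n (X : 'M[R]_n) j : quad_form X (delta_mx j 0) = X j j.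
Proof. by rewrite /quad_form trmx_delta -rowE -colE !mxE. Qed.

Lemma diag_preconditioner_bounds n (X : 'M[R]_n) (lo hi : R) : 0 < lo ->
  (forall j, 0 <= X j j) ->
  (forall q : 'cV[R]_n, q != 0 ->
     let r := quad_form X q / quad_form (diag_part X) q in lo <= r /\ r <= hi) ->
  forall Q (q : 'cV[R]_(Q * n)), q != 0 ->
  [/\ 0 < quad_form ((1%:M : 'M[R]_Q) *t diag_part X) q,
      lo * quad_form ((1%:M : 'M[R]_Q) *t diag_part X) q <= quad_form ((1%:M : 'M[R]_Q) *t X) q
    & quad_form ((1%:M : 'M[R]_Q) *t X) q <= hi * quad_form ((1%:M : 'M[R]_Q) *t diag_part X) q].
Proof.
move=> lo0 X0 H Q q q0.
(* A zero diagonal entry would make the ratio at the corresponding unit vector 0, against the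
   positive lower bound [lo]. *)
have Xgt0 j : 0 < X j j.
  rewrite lt_neqAle X0 andbT; apply/eqP => Xj0.
  have /H[] : delta_mx j 0 != 0 :> 'cV[R]_n.
    by apply/eqP => /matrixP/(_ j 0)/eqP; rewrite !mxE !eqxx oner_eq0.
  by rewrite quad_form_delta -Xj0 mul0r => /(lt_le_trans lo0); rewrite ltxx.
have Dge0 (u : 'cV[R]_n) : 0 <= quad_form (diag_part X) u.
  by rewrite quad_form_diag sumr_ge0// => j _; rewrite mulr_ge0 ?sqr_ge0.
have Dgt0 (u : 'cV[R]_n) : u != 0 -> 0 < quad_form (diag_part X) u.
  rewrite lt_neqAle Dge0 andbT; apply: contra_neq => /esym/eqP.
  rewrite quad_form_diag psumr_eq0 => [/allP u0|j _]; last by rewrite mulr_ge0 ?sqr_ge0.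
  apply/matrixP => j l; rewrite ord1 mxE; apply/eqP.
  by have := u0 j (mem_index_enum j); rewrite /= mulf_eq0 gt_eqF//= sqrf_eq0.
have bounds (u : 'cV[R]_n) : lo * quad_form (diag_part X) u <= quad_form X u /\
    quad_form X u <= hi * quad_form (diag_part X) u.
  have [->|u0] := eqVneq u 0; first by rewrite !quad_form0 !mulr0.
  by have [] := H u u0; rewrite ler_pdivlMr ?Dgt0// ler_pdivrMr ?Dgt0.
rewrite !quad_form_block !mulr_sumr; split; last 2 first.
- by apply: ler_sum => a _; exact: (bounds _).1.
- by apply: ler_sum => a _; exact: (bounds _).2.
have [a qa] : exists a, \col_j q (mxtens_index (a, j)) 0 != 0 :> 'cV[R]_n.
  apply: contrapT => /forallNP q0'; move/eqP: q0; apply.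
  apply/matrixP => i l; rewrite ord1 mxE -(mxtens_unindexK i).
  case: (mxtens_unindex i) => a j.
  by have /negP/negPn/eqP/matrixP/(_ j 0) := q0' a; rewrite !mxE.
by rewrite (bigD1 a)//= ltr_wpDr ?Dgt0// sumr_ge0.
Qed.

End block_forms.

Section viscosity.
Variable R : realType.
Local Notation plane := (measurableTypeR R * measurableTypeR R)%type.

(** The exceptional sets of countably many modes and of the two bounds on [nu0] are merged into one
    null set, after which everything is pointwise. Finiteness of [chi] makes each norm a real
    number. *)
Lemma viscosity_bounds (D : set (R * R)) (nu0 : R * R -> R) (lo hi : R)
  (f : nat -> R * R -> R) (chi : R) : bounded_domain D ->
  lo%:E = ess_inf_on D nu0 -> hi%:E = ess_sup_on D nu0 ->
  chi%:E = (\sum_(0 <= m <oo) Linfty_norm D (f m))%E ->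
  exists2 c : nat -> R, forall n, \sum_(m < n) c m <= chi &
  exists2 N : set plane, measurable N /\ area N = 0%E &
    forall x, ~ N x -> D x -> lo <= nu0 x <= hi /\ forall m, `|f m x| <= c m.
Proof.
move=> [oD _ D0 _ _] loE hiE chiE.
have area0 : (0 < area [set: plane])%E.
  by apply: area_open_gt0; [exact: openT | exists (0, 0)].
have [m|c cE sum_c] := nneseries_fin_terms _ chiE; first exact: Lnorm_ge0.
have [N1 [mN1 N10] N1P] := ae_null_set (ae_ge_ess_inf loE).
have [N2 [mN2 N20] N2P] := ae_null_set (ae_le_ess_sup hiE).
have /ae_null_set[N3 [mN3 N30] N3P] :
    {ae area, forall x : plane, forall m, D x -> `|f m x| <= c m}.
  by apply: ae_foralln => m; exact: (ae_le_Lnormy area0 (cE m)).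
exists c => //; exists (N1 `|` N2 `|` N3).
  split; first by apply: measurableU => //; exact: measurableU.
  by rewrite !null_set_setU//; exact: measurableU.
move=> x /not_orP[/not_orP[n1 n2] n3] Dx; split; last by move=> m; exact: N3P.
by rewrite N1P ?N2P.
Qed.

End viscosity.

Section fem_matrices.
Variable R : realType.
Local Notation plane := (measurableTypeR R * measurableTypeR R)%type.
Variables (D : set (R * R)) (Np : nat) (p : 'I_Np -> R * R) (T : {set {set 'I_Np}}).
Hypotheses (D_domain : bounded_domain D) (T_mesh : triangulation D p T).
Variable N : set plane.
Hypotheses (mN : measurable N) (N0 : area N = 0%E).
Local Notation D' := (D `\` N : set plane).

Lemma stiffness_mxE Nu (phi : 'I_Nu -> R * R -> R * R) (nu : R * R -> R) :
  stiffness_mx D nu phi = \matrix_(j, l) \int[area]_(x in D')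
    (nu x * \sum_i dercomp D i (phi j) x * dercomp D i (phi l) x).
Proof.
apply/matrixP => j l; rewrite !mxE (@Rintegral_setD_null _ plane R area D N)//.
by apply: eq_Rintegral => x; rewrite inE => -[Dx _]; congr (_ * _); exact: grad_dotE.
Qed.

Lemma divergence_mxE Nu (phi : 'I_Nu -> R * R -> R * R) (psi : 'I_Np -> R * R -> R) :
  divergence_mx D phi psi = \matrix_(i, j) - \int[area]_(x in D')
    (psi i x * (fun j x => dercomp D 0 (phi j) x + dercomp D 3 (phi j) x) j x).
Proof.
apply: eq_mx => i j; apply: congr1.
rewrite (@Rintegral_setD_null _ plane R area D N _ mN N0).
apply: eq_Rintegral => x; rewrite inE => -[Dx _].
by apply: congr1; exact: (divE D_domain (phi j) Dx).
Qed.

Lemma mass_mxE (psi : 'I_Np -> R * R -> R) :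
  mass_mx D psi = \matrix_(i, j) \int[area]_(x in D') (psi i x * psi j x).
Proof.
by apply/matrixP => i j; rewrite !mxE (@Rintegral_setD_null _ plane R area D N).
Qed.

Hypothesis N_int : forall x, closure D x -> ~ N x -> exists2 K, K \in T & (hull p K)° x.
Variables (Nu : nat) (phi : 'I_Nu -> R * R -> R * R) (phi_basis : V0h_basis D p T phi).
Let der (i : 'I_4) (j : 'I_Nu) : plane -> R := dercomp D i (phi j).

Lemma div_le_energy_fem Q (v : 'cV[R]_(Q * Nu)) :
  \sum_a \int[area]_(x in D') (fe_sum (fun j x => der 0 j x + der 3 j x) v a x ^+ 2)
    <= energy area D' der v.
Proof.
apply: ler_sum => a _.
exact: (Rintegral_div_le D_domain T_mesh mN N0 N_int phi_basis
  (fun j => v (mxtens_index (a, j)) 0)).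
Qed.

Lemma energy_eq0_fem Q (v : 'cV[R]_(Q * Nu)) : energy area D' der v = 0 -> v = 0.
Proof.
move=> /eqP; rewrite /energy psumr_eq0 => [/allP v0|a _]; last first.
  by apply: Rintegral_ge0 => x _; apply: sumr_ge0 => i _; exact: sqr_ge0.
apply/matrixP => i l; rewrite ord1 mxE -(mxtens_unindexK i).
case: (mxtens_unindex i) => a j.
have /implyP/(_ isT)/eqP va0 := v0 a (mem_index_enum a).
exact: (@energy_eq0_basis R D Np p T D_domain T_mesh N mN N0 N_int Nu phi phi_basis
  (fun j => v (mxtens_index (a, j)) 0) va0 j).
Qed.

(** Energy and pairing are sums over the stochastic index, so normalised witnesses chosen block by
    block satisfy both inequalities after summation. *)
Lemma inf_sup_witness_blocks (psi : 'I_Np -> R * R -> R) (gamma g : R) Q (q : 'cV[R]_(Q * Np)) :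
  gamma%:E = inf_sup_constant D p T -> 0 <= g -> g < gamma ->
  let psi' : 'I_Np -> plane -> R := psi in
  (forall a, W0h D p T (fun x => \sum_j q (mxtens_index (a, j)) 0 * psi j x)) ->
  exists v : 'cV[R]_(Q * Nu),
    g * (\sum_a \int[area]_(x in D') (fe_sum psi' q a x ^+ 2))
      <= - (\sum_a \int[area]_(x in D') (fe_sum psi' q a x *
           fe_sum (fun j x => der 0 j x + der 3 j x) v a x)) /\
    energy area D' der v
      <= \sum_a \int[area]_(x in D') (fe_sum psi' q a x ^+ 2).
Proof.
move=> gammaE g0 gg psi' Wq.
have /(_ _)/cid block a : exists c : 'I_Nu -> R,
    g * (\int[area]_(x in D') (fe_sum psi' q a x ^+ 2))
      <= - (\int[area]_(x in D') (fe_sum psi' q a x *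
              \sum_j c j * (der 0 j x + der 3 j x))) /\
    (\int[area]_(x in D') (\sum_i (\sum_j c j * der i j x) ^+ 2))
      <= \int[area]_(x in D') (fe_sum psi' q a x ^+ 2).
  (* The inf-sup condition says nothing about a pressure block vanishing on [D]; there the zero
     velocity is chosen. *)
  have [qn0|q0] := pselect (exists2 x, D x & fe_sum psi' q a x != 0).
    exact: (inf_sup_witness D_domain T_mesh mN N0 N_int phi_basis gammaE g0 gg (Wq a) qn0).
  have z x : D' x -> fe_sum psi' q a x = 0.
    by move=> [Dx _]; apply/eqP; apply: contrapT => /negP qx; apply: q0; exists x.
  exists (fun=> 0).
  have int0 (f : plane -> R) : (forall x, D' x -> f x = 0) -> \int[area]_(x in D') f x = 0.
    move=> f0; rewrite (@eq_Rintegral _ _ _ area D' (fun=> 0) f).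
      by rewrite /Rintegral integral0.
    by move=> x; rewrite inE => /f0.
  rewrite !int0 ?mulr0 ?oppr0//.
  - by move=> x _; rewrite big1// => i _; rewrite big1 ?expr0n// => j _; rewrite mul0r.
  - by move=> x Dx; rewrite z// mul0r.
  - by move=> x Dx; rewrite z// expr0n.
pose v : 'cV[R]_(Q * Nu) := \col_i sval (block (mxtens_unindex i).1) (mxtens_unindex i).2.
have vE (f : 'I_Nu -> plane -> R) a : fe_sum f v a = fun x => \sum_j sval (block a) j * f j x.
  by apply/funext => x; apply: eq_bigr => j _; rewrite mxE mxtens_indexK.
exists v; split.
  rewrite mulr_sumr -sumrN; apply: ler_sum => a _.
  by rewrite vE; exact: (svalP (block a)).1.
apply: ler_sum => a _; apply: le_trans (svalP (block a)).2.
rewrite le_eqVlt; apply/orP; left; apply/eqP; apply: eq_Rintegral => x _.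
by apply: eq_bigr => i _; rewrite vE.
Qed.

End fem_matrices.

Lemma ler_norm_max (R : realDomainType) (lo hi x : R) : lo <= x <= hi ->
  `|x| <= Num.max `|lo| `|hi|.
Proof.
move=> /andP[lox xhi]; rewrite le_max; case: (leP 0 x) => x0.
  by rewrite (ger0_norm x0) (ger0_norm (le_trans x0 xhi)) xhi orbT.
by rewrite (ltr0_norm x0) (ltr0_norm (le_lt_trans lox x0)) lerN2 lox.
Qed.

Section ratio_bounds.
Variables (R : realType) (X mass d : R).
Hypothesis d_gt0 : 0 < d.

Lemma ratio_upper (a al t : R) : 0 < al -> al <= a -> 0 <= t ->
  a * X <= mass -> mass <= t * d -> X / d <= t / al.
Proof.
(* Replacing [a] by the smaller [al] needs [X] nonnegative; for negative [X] the claim is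
   trivial. *)
move=> al0 ala t0 aX mt; case: (leP 0 X) => X0; last first.
  apply: (@le_trans _ _ 0); last by rewrite divr_ge0// ltW.
  by rewrite pmulr_lle0 ?invr_gt0// ltW.
rewrite ler_pdivrMr// mulrAC ler_pdivlMr// mulrC.
by apply: le_trans mt; apply: le_trans aX; rewrite ler_wpM2r.
Qed.

Lemma ratio_lower (g b be t : R) : 0 < b -> b <= be -> 0 <= g -> 0 <= t ->
  g * (mass / b) <= X -> t * d <= mass -> t * g / be <= X / d.
Proof.
move=> b0 bbe g0 t0 gX td; have be0 : 0 < be := lt_le_trans b0 bbe.
rewrite ler_pdivlMr//; apply: le_trans gX.
rewrite (_ : t * g / be * d = g * (t * d / be)); last by ring.
rewrite ler_wpM2l//; apply: (@le_trans _ _ (mass / be)).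
  by rewrite ler_wpM2r// invr_ge0 ltW.
rewrite ler_wpM2l ?lef_pV2 ?posrE//.
by apply: le_trans td; rewrite mulr_ge0// ltW.
Qed.

End ratio_bounds.

(** The inf-sup constant tests mean-zero pressures only. The nodal functions sum to 1 and velocities
    vanishing on the boundary have divergence of mean zero, so the transpose of [calB] annihilates
    all vectors constant on each stochastic block. With several blocks these need not be constant;
    with a single one, adding a large constant to a mean-zero pressure enlarges the denominator and
    leaves the Schur form unchanged. This is why the lower bound asks every block of [q] to
    represent an element of [W0h]. *)
Theorem lemma7p2 (R : realType)
  (* domain and triangulation *)
  (D : set (R * R)) (D_domain : bounded_domain D)
  (Np : nat) (p : 'I_Np -> R * R) (T : {set {set 'I_Np}})
  (T_mesh : triangulation D p T)
  (* viscosity data; lam m and nu m stand for the (m+1)-st eigenpair *)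
  (nu0 : R * R -> R) (nu0_meas : measurable_fun D nu0)
  (nu_min nu_max : R)
  (nu_minE : nu_min%:E = ess_inf_on D nu0)
  (nu_maxE : nu_max%:E = ess_sup_on D nu0)
  (nu_min_gt0 : 0 < nu_min)
  (sigma : R) (sigma_gt0 : 0 < sigma)
  (C : R * R -> R * R -> R) (C_cov : covariance_function D C)
  (lam : nat -> R) (nu : nat -> R * R -> R)
  (nu_eig : forall m, covariance_eigenpair D C (lam m) (nu m))
  (chi : R)
  (chiE : chi%:E = (\sum_(0 <= m <oo)
     Linfty_norm D (fun x => Num.sqrt (lam m) * nu m x)%R)%E)
  (nu_min_large : Num.sqrt 3 * sigma * chi < nu_min)
  (* finite element bases and constants *)
  (Nu : nat) (phi : 'I_Nu -> R * R -> R * R) (phi_basis : V0h_basis D p T phi)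
  (vphi : 'I_Np -> R * R -> R) (vphi_basis : P1_nodal_basis D p T vphi)
  (gamma : R) (gammaE : gamma%:E = inf_sup_constant D p T)
  (gamma_gt0 : 0 < gamma)
  (theta Theta : R) (theta_gt0 : 0 < theta) (Theta_gt0 : 0 < Theta)
  (theta_Theta : forall q : 'cV[R]_Np, q != 0 ->
     let r := quad_form (mass_mx D vphi) q /
              quad_form (diag_part (mass_mx D vphi)) q in
     theta ^+ 2 <= r /\ r <= Theta ^+ 2)
  (* stochastic Galerkin basis *)
  (M k : nat) (al : 'I_('C(M + k, k)) -> M.-tuple 'I_k.+1)
  (al_ord : multiindex_ordering al) :
  let Q := 'C(M + k, k) in
  let A0 := stiffness_mx D nu0 phi in
  let A_ (m : 'I_M) :=
    stiffness_mx D (fun x => sigma * Num.sqrt (lam m) * nu m x) phi in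
  let Dp := diag_part (mass_mx D vphi) in
  let calA := (1%:M : 'M[R]_Q) *t A0 + \sum_(m < M) galerkin_mx R al m *t A_ m in
  let calB := (1%:M : 'M[R]_Q) *t divergence_mx D phi vphi in
  let calS := - (calB *m invmx calA *m calB^T) in
  let Sp := (1%:M : 'M[R]_Q) *t Dp in
  forall q : 'cV[R]_(Q * Np), (forall c : R, q <> const_mx c) ->
    ((* lower bound, for q representing an element of R^Q (x) W0h *)
     (forall a : 'I_Q,
        W0h D p T (fun x => \sum_j q (mxtens_index (a, j)) 0 * vphi j x)) ->
     theta ^+ 2 * gamma ^+ 2 / (nu_max + Num.sqrt 3 * sigma * chi)
       <= quad_form (- calS) q / quad_form Sp q) /\
    quad_form (- calS) q / quad_form Sp q
      <= Theta ^+ 2 / (nu_min - Num.sqrt 3 * sigma * chi).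
Proof.
move=> Q A0 A_ Dp calA calB calS Sp q q_cst.
pose plane := (measurableTypeR R * measurableTypeR R)%type.
have [c sum_c [N' [mN' N'0] visc]] := viscosity_bounds D_domain nu_minE nu_maxE chiE.
have [Nm [mNm Nm0] Nm_int] := mesh_edges_null T_mesh.
pose N : set plane := Nm `|` N'.
have mN : measurable N by exact: measurableU.
have N0 : area N = 0%E by rewrite /N null_set_setU.
have N_int x : closure D x -> ~ N x -> exists2 K, K \in T & (hull p K)° x.
  by move=> Dx /not_orP[nNx _]; exact: Nm_int.
have {}visc x : D x -> ~ N x -> nu_min <= nu0 x <= nu_max /\
    forall m, `|Num.sqrt (lam m) * nu m x| <= c m.
  by move=> Dx /not_orP[_ nNx]; exact: visc.
pose D' : set plane := D `\` N.
have mD' : measurable D' := measurable_D' D_domain mN.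
have D'oo : (area D' < +oo)%E := area_D'_lty D_domain mN.
pose der (i : 'I_4) (j : 'I_Nu) : plane -> R := dercomp D i (phi j).
pose psi : 'I_Np -> plane -> R := vphi.
pose nus (m : 'I_M) : plane -> R := fun x => sigma * Num.sqrt (lam m) * nu m x.
have [Vphi _ _] := phi_basis.
have bm_der i j : bounded_measurable D' (der i j).
  exact: (bm_dercomp D_domain T_mesh mN N_int).
have bm_psi i : bounded_measurable D' (psi i).
  exact: (bm_Pk D_domain T_mesh N (vphi_basis.1 i)).
have mDD : measurable (D : set plane) by apply: open_measurable_plane; exact: open_D D_domain.
have sub (f : plane -> R) : measurable_fun (D : set plane) f -> measurable_fun D' f.
  by apply: measurable_funS mDD _; exact: subDsetl.
have nu0_bound x : D' x -> nu_min <= nu0 x <= nu_max by move=> [Dx nNx]; exact: (visc x Dx nNx).1.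
pose cs (m : 'I_M) := sigma * c m.
have nus_bound m x : D' x -> `|nus m x| <= cs m.
  move=> [Dx nNx]; rewrite /nus /cs -mulrA normrM gtr0_norm// (ler_wpM2l (ltW sigma_gt0))//.
  exact: ((visc x Dx nNx).2 m).
have bm_nu0 : bounded_measurable D' (nu0 : plane -> R).
  split; first exact: sub.
  exists (Num.max `|nu_min| `|nu_max|) => x /nu0_bound; exact: ler_norm_max.
have bm_nus m : bounded_measurable D' (nus m).
  split; last by exists (cs m); exact: nus_bound.
  have [_ mnu _ _ _] := nu_eig m.
  by apply: sub; apply: measurable_funM; [exact: measurable_cst|exact: mnu].
have cs_le : \sum_m cs m <= sigma * chi by rewrite -mulr_sumr (ler_wpM2l (ltW sigma_gt0)).
have al_inj : injective al by case: al_ord.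
have s0 : 0 <= Num.sqrt (3 : R) by exact: sqrtr_ge0.
(* [a0] and [b0] involve the [M] modes actually present; [ratio_upper] and [ratio_lower] later pass
   to the full series [chi]. *)
pose a0 := nu_min - Num.sqrt 3 * \sum_m cs m.
pose b0 := nu_max + Num.sqrt 3 * \sum_m cs m.
have scs_le : Num.sqrt 3 * (\sum_m cs m) <= Num.sqrt 3 * sigma * chi.
  by rewrite -mulrA ler_wpM2l.
have den_gt0 : 0 < nu_min - Num.sqrt 3 * sigma * chi by rewrite subr_gt0.
have a0_ge : nu_min - Num.sqrt 3 * sigma * chi <= a0 by rewrite lerD2l lerN2.
have b0_le : b0 <= nu_max + Num.sqrt 3 * sigma * chi by rewrite lerD2l.
have a0_gt0 : 0 < a0 by exact: lt_le_trans a0_ge.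
(* A point where all bounds hold shows that [nu_max] is at least [nu_min] and that the [cs m] are
   nonnegative, hence that [b0] is positive. *)
have [x0 D'x0] : exists x, D' x.
  apply: contrapT => /forallNP D'0.
  have [oD _ Dn0 _ _] := D_domain.
  have := area_open_gt0 oD Dn0; rewrite ltNge -N0 le_measure ?inE//.
  by move=> x Dx; apply: contrapT => nNx; exact: (D'0 x).
have b0_gt0 : 0 < b0.
  have /andP[lo hi] := nu0_bound x0 D'x0.
  rewrite ltr_wpDr//; last by lra.
  by rewrite mulr_ge0// sumr_ge0// => m _; exact: le_trans (nus_bound m x0 D'x0).
have q0 : q != 0 by apply/eqP => q0; apply: (q_cst 0); rewrite q0; apply/matrixP => i j; rewrite !mxE.
have [d_gt0 lo_mass mass_hi] : [/\ 0 < quad_form Sp q,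
    theta ^+ 2 * quad_form Sp q <= quad_form ((1%:M : 'M[R]_Q) *t mass_mx D vphi) q
  & quad_form ((1%:M : 'M[R]_Q) *t mass_mx D vphi) q <= Theta ^+ 2 * quad_form Sp q].
  apply: diag_preconditioner_bounds => //; first by rewrite exprn_gt0.
  by move=> j; rewrite mxE; apply: Rintegral_ge0 => x _; rewrite -expr2 sqr_ge0.
set d := quad_form Sp q in d_gt0 lo_mass mass_hi *.
set mq := quad_form _ q in lo_mass mass_hi.
have mqE : mq = quad_form ((1%:M : 'M[R]_Q) *t
    \matrix_(i, j) \int[area]_(x in D') (psi i x * psi j x)) q.
  by rewrite /mq (mass_mxE D mN N0).
rewrite /calS opprK; set X := quad_form _ q.
(* The same matrices with integrals over [D'] and with [der] in place of the classical derivatives,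
   the form in which the abstract bounds apply. *)
have XE : X = quad_form
    (((1%:M : 'M[R]_Q) *t \matrix_(i, j) - \int[area]_(x in D')
        (psi i x * (fun j x => der 0 j x + der 3 j x) j x)) *m
     invmx ((1%:M : 'M[R]_Q) *t (\matrix_(j, l) \int[area]_(x in D')
         (nu0 x * \sum_i der i j x * der i l x)) +
       \sum_(m < M) galerkin_mx R al m *t (\matrix_(j, l) \int[area]_(x in D')
         (nus m x * \sum_i der i j x * der i l x))) *m
     ((1%:M : 'M[R]_Q) *t \matrix_(i, j) - \int[area]_(x in D')
        (psi i x * (fun j x => der 0 j x + der 3 j x) j x))^T) q.
  rewrite /X /calA /calB /A0 /A_ (divergence_mxE D_domain mN N0) (stiffness_mxE D_domain mN N0).
  by under eq_bigr do rewrite (stiffness_mxE D_domain mN N0).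
have upper : a0 * X <= mq.
  rewrite XE mqE.
  exact: (schur_upper mD' D'oo bm_der bm_psi bm_nu0 bm_nus nu0_bound nus_bound
    (galerkin_mx_bound al_inj)
    (@div_le_energy_fem _ _ _ _ _ D_domain T_mesh _ mN N0 N_int _ _ phi_basis Q)
    (@energy_eq0_fem _ _ _ _ _ D_domain T_mesh _ mN N0 N_int _ _ phi_basis Q) a0_gt0 q).
split; last exact: (ratio_upper d_gt0 den_gt0 a0_ge (sqr_ge0 Theta) upper mass_hi).
move=> Wq.
have mq_ge0 : 0 <= mq.
  by apply: le_trans lo_mass; apply: mulr_ge0; [exact: sqr_ge0|exact: ltW].
apply: (ratio_lower d_gt0 b0_gt0 b0_le (sqr_ge0 gamma) (sqr_ge0 theta) _ lo_mass).
(* Witnesses exist for every [g] below [gamma]; the bound for [gamma] itself is the limit. *)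
apply: (le_of_lt_family gamma_gt0) => [|g g0 gg].
  exact: (divr_ge0 mq_ge0 (ltW b0_gt0)).
have [v []] := inf_sup_witness_blocks D_domain T_mesh mN N0 N_int phi_basis gammaE g0 gg Wq.
rewrite -(massE mD' D'oo bm_psi) -mqE -(pairing_div mD' D'oo bm_der bm_psi) => lv ev.
rewrite mulrA XE.
exact: (schur_lower_witness mD' D'oo bm_der bm_nu0 bm_nus nu0_bound nus_bound
  (@galerkin_mx_sym R M k al) (galerkin_mx_bound al_inj)
  (@energy_eq0_fem _ _ _ _ _ D_domain T_mesh _ mN N0 N_int _ _ phi_basis Q)
  a0_gt0 b0_gt0 g0 lv ev).
Qed.
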